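(* Let $\mathcal O=\mathsf{Comm}$. As $GL(V)$-modules, $$H_{1,1}(\mathcal H\mathsf{Comm}_V)=0,\quad H_{2,1}(\mathcal H\mathsf{Comm}_V)\cong\textstyle\bigwedge^2V,\quad H_{3,1}(\mathcal H\mathsf{Comm}_V)\cong S^3V,$$ $$H_{4,1}(\mathcal H\mathsf{Comm}_V)\cong\textstyle\bigwedge^4V\oplus\mathbb S_{(2,2)}(V),\quad H_{5,1}(\mathcal H\mathsf{Comm}_V)\cong\mathbb S_{(3,1,1)}(V)\oplus\mathbb S_{(3,1,1)}(V).$$
   Context: $F$ is a field of characteristic $0$ and $V$ a finite-dimensional symplectic $F$-vector space; $\mathbb S_\lambda(V)$ is the $GL(V)$ Schur functor of the partition $\lambda$. $\mathsf{Comm}$ is the cyclic commutative operad: $\mathsf{Comm}((s))=F$ with trivial $\mathfrak S_s$-action for all $s\ge2$, all compositions being the identity of $F$. Hairy graph complex. An admissible graph is a finite graph with no bivalent vertices; univalent vertices are leaves, the edge at a leaf is a hair, other vertices and edges are internal. An orientation is an ordering of internal vertices and a direction of each internal edge; transposing two vertices or reversing an edge changes the sign. $C_k\mathcal H\mathsf{Comm}_V$ is spanned by oriented admissible graphs with $k$ internal vertices (each colored by the generator of $\mathsf{Comm}$, which adds no structure) and leaves labeled by vectors in $V$, modulo isomorphism, multilinearity in labels, and $(X,-or)=-(X,or)$. The boundary sums over contractions of non-loop internal edges (if the orientation is represented so that the edge goes from the first vertex to the second, the merged vertex is put first with sign $+$). $H_{k,1}(\mathcal H\mathsf{Comm}_V)$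 denotes the $k$-th homology of the subcomplex spanned by connected graphs with first Betti number $1$. *)

(* Defs.v *)
From HB Require Import structures.
From mathcomp Require Import all_boot all_order all_fingroup all_algebra.
From mathcomp Require Import boolp.
From mathcomp Require Import freeg.

Set Implicit Arguments.
Unset Strict Implicit.
Unset Printing Implicit Defensive.

Import generic_quotient GRing.Theory.

Local Open Scope ring_scope.
Local Open Scope quotient_scope.

(* -------------------------------------------------------------------------- *)
(* Submodules, quotients, modules given by generators and relations           *)
(* -------------------------------------------------------------------------- *)

Section Span.
Variables (F : fieldType) (L : lmodType F) (S : L -> Prop).

Definition lspan : {pred L} := fun x =>
  `[< exists2 s : seq (F * L), (forall p, p \in s -> S p.2) &
        x = \sum_(p <- s) p.1 *: p.2 >].

Lemma lspanP x :
  reflect (exists2 s : seq (F * L), (forall p, p \in s -> S p.2) &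
             x = \sum_(p <- s) p.1 *: p.2)
          (x \in lspan).
Proof. exact: asboolP. Qed.

Lemma lspan_submod_closed : submod_closed lspan.
Proof.
split.
  by apply/lspanP; exists [::] => [p|]; rewrite ?in_nil // big_nil.
move=> a u v /lspanP[s Ss ->] /lspanP[t St ->]; apply/lspanP.
exists ([seq (a * p.1, p.2) | p <- s] ++ t) => [p|].
  by rewrite mem_cat => /orP[/mapP[q /Ss Sq ->] //|/St].
rewrite big_cat big_map scaler_sumr /=; congr (_ + _).
by apply: eq_bigr => p _; rewrite scalerA.
Qed.

HB.instance Definition _ :=
  GRing.isSubmodClosed.Build F L lspan
    (GRing.submod_closed_semi lspan_submod_closed).

Lemma mem_lspan x : S x -> x \in lspan.
Proof.
move=> Sx; apply/lspanP; exists [:: (1, x)].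
  by move=> p; rewrite inE => /eqP ->.
by rewrite big_seq1 scale1r.
Qed.

Lemma lspan_ind (T : submodClosed L) :
  (forall x, S x -> x \in T) -> {subset lspan <= T}.
Proof.
move=> ST x /lspanP[s Ss ->]; rewrite big_seq; apply: rpred_sum => p ps.
exact/rpredZ/ST/Ss.
Qed.

End Span.

Section Image.
Variables (F : fieldType) (L M : lmodType F) (f : {linear L -> M}).
Variable S : submodClosed L.

Definition limage : {pred M} := fun y => `[< exists2 x, x \in S & y = f x >].

Lemma limageP y : reflect (exists2 x, x \in S & y = f x) (y \in limage).
Proof. exact: asboolP. Qed.

Lemma limage_submod_closed : submod_closed limage.
Proof.
split; first by apply/limageP; exists 0; rewrite ?rpred0 ?linear0.
move=> a u v /limageP[x xS ->] /limageP[y yS ->]; apply/limageP.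
by exists (a *: x + y); rewrite ?linearP // rpredD ?rpredZ.
Qed.

HB.instance Definition _ :=
  GRing.isSubmodClosed.Build F M limage
    (GRing.submod_closed_semi limage_submod_closed).

Definition lkernel : {pred L} := fun x => (x \in S) && (f x == 0).

Lemma lkernel_submod_closed : submod_closed lkernel.
Proof.
split; first by rewrite unfold_in rpred0 linear0 eqxx.
move=> a u v /andP[uS /eqP fu] /andP[vS /eqP fv].
by rewrite unfold_in linearP fu fv scaler0 addr0 eqxx rpredD ?rpredZ.
Qed.

HB.instance Definition _ :=
  GRing.isSubmodClosed.Build F L lkernel
    (GRing.submod_closed_semi lkernel_submod_closed).

Definition lpreim (T : submodClosed M) : {pred L} := fun x => f x \in T.

Lemma lpreim_submod_closed T : submod_closed (lpreim T).
Proof.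
split; first by rewrite unfold_in linear0 rpred0.
move=> a u v; rewrite ![_ \in lpreim T]unfold_in => fu fv.
by rewrite linearP rpredD ?rpredZ.
Qed.

HB.instance Definition _ T :=
  GRing.isSubmodClosed.Build F L (lpreim T)
    (GRing.submod_closed_semi (lpreim_submod_closed T)).

End Image.

Definition full_submod (F : fieldType) (L : lmodType F) : {pred L} := predT.

Lemma full_submod_closed (F : fieldType) (L : lmodType F) :
  submod_closed (@full_submod F L).
Proof. by []. Qed.

HB.instance Definition _ (F : fieldType) (L : lmodType F) :=
  GRing.isSubmodClosed.Build F L (@full_submod F L)
    (GRing.submod_closed_semi (@full_submod_closed F L)).

Section Submodule.
Variables (F : fieldType) (L : lmodType F) (S : submodClosed L).

Record submod := Submod { submod_val : L; _ : submod_val \in S }.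

HB.instance Definition _ := [isSub for submod_val].
HB.instance Definition _ := [Choice of submod by <:].
HB.instance Definition _ := [SubChoice_isSubLmodule of submod by <:].

End Submodule.

Section Quotient.
Variables (F : fieldType) (L : lmodType F) (S : submodClosed L).

(* [submodClosed] does not inherit from [zmodClosed] in the hierarchy. *)
Definition zmod_of : {pred L} := S.

Lemma zmod_of_closed : zmod_closed zmod_of.
Proof. exact: GRing.submod_closedB (submodClosedP S). Qed.

HB.instance Definition _ := GRing.isZmodClosed.Build L zmod_of zmod_of_closed.

Definition quotmod : Type := Quotient.quot zmod_of.

HB.instance Definition _ := GRing.Zmodule.on quotmod.

Definition qpi (x : L) : quotmod := \pi_(Quotient.quot zmod_of) x.
Definition qrepr (q : quotmod) : L := repr (q : (Quotient.quot zmod_of)).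

Lemma qreprK : cancel qrepr qpi.
Proof. exact: reprK. Qed.

Lemma qpi_eq x y : (qpi x == qpi y) = (x - y \in S).
Proof. exact/esym/(@Quotient.idealrBE L zmod_of). Qed.

Lemma qpi_eqP x y : reflect (qpi x = qpi y) (x - y \in S).
Proof. rewrite -qpi_eq; exact: eqP. Qed.

Lemma qrepr_pi x : qrepr (qpi x) - x \in S.
Proof. by rewrite -qpi_eq qreprK. Qed.

Lemma qpi_additive : zmod_morphism qpi.
Proof. exact: pi_is_zmod_morphism. Qed.

HB.instance Definition _ :=
  GRing.isZmodMorphism.Build L quotmod qpi qpi_additive.

Definition qscale a q : quotmod := qpi (a *: qrepr q).

Lemma qscale_pi a x : qscale a (qpi x) = qpi (a *: x).
Proof. by apply/qpi_eqP; rewrite -scalerBr rpredZ ?qrepr_pi. Qed.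

Lemma qscaleA a b q : qscale a (qscale b q) = qscale (a * b) q.
Proof. by rewrite -[q]qreprK !qscale_pi scalerA. Qed.

Lemma qscale1 : left_id 1 qscale.
Proof. by move=> q; rewrite -[q]qreprK qscale_pi scale1r. Qed.

Lemma qscaleDr : right_distributive qscale +%R.
Proof.
move=> a p q; rewrite -[p]qreprK -[q]qreprK.
by rewrite -raddfD !qscale_pi scalerDr raddfD.
Qed.

Lemma qscaleDl q : {morph qscale^~ q : a b / a + b}.
Proof. by move=> a b; rewrite -[q]qreprK !qscale_pi scalerDl raddfD. Qed.

HB.instance Definition _ :=
  GRing.Zmodule_isLmodule.Build F quotmod qscaleA qscale1 qscaleDr qscaleDl.

Lemma qpi_scalable : scalable qpi.
Proof. by move=> a x; rewrite -qscale_pi. Qed.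

HB.instance Definition _ :=
  GRing.isScalable.Build F L quotmod *:%R qpi qpi_scalable.

Lemma qpi_eq0 x : (qpi x == 0) = (x \in S).
Proof. by rewrite -(raddf0 qpi) qpi_eq subr0. Qed.

Definition qlift (M : lmodType F) (f : {linear L -> M})
  of (forall x, x \in S -> f x = 0) := fun q : quotmod => f (qrepr q).

Variables (M : lmodType F) (f : {linear L -> M}).
Hypothesis fS : forall x, x \in S -> f x = 0.

Lemma qliftE x : qlift fS (qpi x) = f x.
Proof. by apply/eqP; rewrite /qlift -subr_eq0 -linearB fS ?qrepr_pi. Qed.

Lemma qlift_linear : linear (qlift fS).
Proof.
move=> a p q; rewrite -[p]qreprK -[q]qreprK.
by rewrite -linearP !qliftE linearP.
Qed.

HB.instance Definition _ :=
  GRing.isLinear.Build F quotmod M *:%R (qlift fS) qlift_linear.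

End Quotient.


Arguments qpi {F L} S x.

Section FreeLift.
Variables (F : fieldType) (K : choiceType) (M : lmodType F) (f : K -> M).

Lemma fglift_linear : linear (fglift f : {freeg K / F} -> M).
Proof.
have fD : zmod_morphism (fglift f : {freeg K / F} -> M).
  exact: lift_is_additive.
have fDD (x y : {freeg K / F}) : fglift f (x + y) = fglift f x + fglift f y.
  have f0 : fglift f (0 : {freeg K / F}) = 0 by rewrite -(subrr 0) fD subrr.
  by rewrite -{1}[y]opprK fD -[- y]add0r fD f0 sub0r opprK.
have f_sum (s : seq K) (g : K -> F) :
    fglift f (\sum_(x <- s) << g x *g x >>) = \sum_(x <- s) g x *: f x.
  elim: s => [|x s IHs]; last by rewrite !big_cons fDD liftU IHs.
  by rewrite !big_nil -(subrr 0) fD subrr.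
move=> a x y; rewrite fDD; congr (_ + _).
have ax : a *: x = \sum_(z <- dom x) << a * coeff z x *g z >>.
  rewrite -{1}[x]freeg_sumE scaler_sumr; apply: eq_bigr => z _.
  by apply/eqP/freeg_eqP => t; rewrite coeffZ !coeffU mulrA.
rewrite ax f_sum -{3}[x]freeg_sumE f_sum scaler_sumr.
by apply: eq_bigr => z _; rewrite scalerA.
Qed.

HB.instance Definition _ :=
  GRing.isLinear.Build F {freeg K / F} M *:%R (fglift f) fglift_linear.

Lemma fgliftE x : fglift f (<<x>> : {freeg K / F}) = f x.
Proof. by rewrite liftU scale1r. Qed.

End FreeLift.

Lemma freeg_linear_eq (F : fieldType) (K : choiceType) (M : lmodType F)
    (f g : {linear {freeg K / F} -> M}) :
  (forall x, f <<x>> = g <<x>>) -> f =1 g.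
Proof.
move=> fg x; rewrite -[x]freeg_sumE !linear_sum; apply: eq_bigr => z _.
suff -> : << coeff z x *g z >> = coeff z x *: <<z>> :> {freeg K / F}.
  by rewrite !linearZ fg.
by apply/eqP/freeg_eqP => t; rewrite coeffZ !coeffU mul1r.
Qed.

(* [pres S] is the module generated by [K] subject to the relations [r = 0]   *)
(* for [r] in [S].                                                            *)
Section Presentation.
Variables (F : fieldType) (K : choiceType) (S : {freeg K / F} -> Prop).

Definition pres := quotmod (lspan S).

HB.instance Definition _ := GRing.Lmodule.on pres.

Definition pgen (x : K) : pres := qpi (lspan S) <<x>>.

Lemma pres_linear_eq (M : lmodType F) (f g : {linear pres -> M}) :
  (forall x, f (pgen x) = g (pgen x)) -> f =1 g.
Proof.
move=> fg q; rewrite -[q]qreprK.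
exact: (@freeg_linear_eq _ _ _ (f \o qpi (lspan S)) (g \o qpi (lspan S))).
Qed.

Variables (M : lmodType F) (f : K -> M).
Hypothesis fS : forall r, S r -> fglift f r = 0.

Lemma fglift_lspan r : r \in lspan S -> fglift f r = 0.
Proof.
move=> /lspanP[s Ss ->]; rewrite linear_sum big_seq big1 // => p /Ss/fS fp.
by rewrite linearZ /= fp scaler0.
Qed.

Definition plift : pres -> M := qlift fglift_lspan.

HB.instance Definition _ := GRing.Linear.on plift.

Lemma pliftE x : plift (pgen x) = f x.
Proof. by rewrite [LHS]qliftE /= fgliftE. Qed.

End Presentation.

(* -------------------------------------------------------------------------- *)
(* GL(V)-modules                                                              *)
(* -------------------------------------------------------------------------- *)

Section GLModules.
Variables (F : fieldType) (V : vectType F).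

Record glin := GLin { glin_fun :> 'End(V); glinP : lker glin_fun == 0%VS }.

Lemma glin_one_subproof : lker (\1%VF : 'End(V)) == 0%VS.
Proof. by apply/lker0P => x y; rewrite !id_lfunE. Qed.

Lemma glin_mul_subproof (g h : glin) : lker (g \o h)%VF == 0%VS.
Proof.
apply/lker0P => x y; rewrite !comp_lfunE.
by move/(lker0P (glinP g))/(lker0P (glinP h)).
Qed.

Definition glin_one := GLin glin_one_subproof.
Definition glin_mul g h := GLin (glin_mul_subproof g h).

Record glmod := GLMod {
  glmod_sort :> lmodType F;
  glact : glin -> {linear glmod_sort -> glmod_sort};
  glact1 : forall x, glact glin_one x = x;
  glactM : forall g h x, glact (glin_mul g h) x = glact g (glact h x)
}.

Definition glmod_iso (M N : glmod) : Prop :=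
  exists2 f : {linear M -> N}, bijective f &
    forall g x, f (glact M g x) = glact N g (f x).

Section Sub.
Variables (M : glmod) (S : submodClosed M).
Hypothesis gS : forall g x, x \in S -> glact M g x \in S.

Definition subact g (x : submod S) : submod S :=
  Submod (gS g (valP x)).

Lemma subact_linear g : linear (subact g).
Proof. by move=> a x y; apply: val_inj; rewrite /= !linearP. Qed.

HB.instance Definition _ g :=
  GRing.isLinear.Build F (submod S) (submod S) *:%R (subact g)
    (subact_linear g).

Lemma subact1 x : subact glin_one x = x.
Proof. by apply: val_inj; rewrite /= glact1. Qed.

Lemma subactM g h x : subact (glin_mul g h) x = subact g (subact h x).
Proof. by apply: val_inj; rewrite /= glactM. Qed.

Definition gl_sub : glmod := GLMod subact1 subactM.

End Sub.

Section Quo.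
Variables (M : glmod) (S : submodClosed M).
Hypothesis gS : forall g x, x \in S -> glact M g x \in S.

Lemma quoact_subproof g x : x \in S -> (qpi S \o glact M g) x = 0.
Proof. by move=> xS; apply/eqP; rewrite /= qpi_eq0 gS. Qed.

Definition quoact g : quotmod S -> quotmod S := qlift (quoact_subproof g).

HB.instance Definition _ g := GRing.Linear.on (quoact g).

Lemma quoactE g x : quoact g (qpi S x) = qpi S (glact M g x).
Proof. exact: qliftE. Qed.

Lemma quoact1 q : quoact glin_one q = q.
Proof. by rewrite -[q]qreprK quoactE glact1. Qed.

Lemma quoactM g h q : quoact (glin_mul g h) q = quoact g (quoact h q).
Proof. by rewrite -[q]qreprK !quoactE glactM. Qed.

Definition gl_quo : glmod := GLMod quoact1 quoactM.

End Quo.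

Section Pres.
Variables (K : choiceType) (S : {freeg K / F} -> Prop) (act : glin -> K -> K).
Hypothesis act1 : forall x, act glin_one x = x.
Hypothesis actM : forall g h x, act (glin_mul g h) x = act g (act h x).
Hypothesis actS : forall g r, S r ->
  fglift (fun x => pgen S (act g x)) r = 0.

Definition presact g : pres S -> pres S := plift (actS g).

HB.instance Definition _ g := GRing.Linear.on (presact g).

Lemma presactE g x : presact g (pgen S x) = pgen S (act g x).
Proof. exact: pliftE. Qed.

Lemma presact1 x : presact glin_one x = x.
Proof.
move: x; apply: (@pres_linear_eq _ _ _ _ (presact glin_one) idfun) => x.
by rewrite [LHS]presactE act1.
Qed.

Lemma presactM g h x : presact (glin_mul g h) x = presact g (presact h x).
Proof.
move: x; apply: (@pres_linear_eq _ _ _ _ _ (presact g \o presact h)) => x.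
by rewrite [LHS]presactE actM -!presactE.
Qed.

Definition gl_pres : glmod := GLMod presact1 presactM.

End Pres.

Section Sum.
Variables M N : glmod.

Definition sumact g (x : M * N) : M * N := (glact M g x.1, glact N g x.2).

Lemma sumact_linear g : linear (sumact g).
Proof. by move=> a x y; rewrite /sumact !linearP. Qed.

HB.instance Definition _ g :=
  GRing.isLinear.Build F (M * N)%type (M * N)%type *:%R (sumact g)
    (sumact_linear g).

Lemma sumact1 x : sumact glin_one x = x.
Proof. by rewrite /sumact !glact1 -surjective_pairing. Qed.

Lemma sumactM g h x : sumact (glin_mul g h) x = sumact g (sumact h x).
Proof. by rewrite /sumact !glactM. Qed.

Definition gl_sum : glmod := GLMod sumact1 sumactM.

End Sum.

End GLModules.

(* -------------------------------------------------------------------------- *)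
(* Tensor, symmetric and exterior powers; Schur functors                      *)
(* -------------------------------------------------------------------------- *)

Section Tensors.
Variables (F : fieldType) (V : vectType F).

Section Power.
Variable n : nat.
Implicit Types (t : {ffun 'I_n -> V}) (s : 'S_n).

Definition ffupd t i (x : V) : {ffun 'I_n -> V} :=
  [ffun j => if j == i then x else t j].

Inductive multilinear : {freeg {ffun 'I_n -> V} / F} -> Prop :=
  Multilinear t i a u v :
    multilinear (<<ffupd t i (a *: u + v)>> -
                 (a *: <<ffupd t i u>> + <<ffupd t i v>>)).

Definition ffact (g : glin V) t : {ffun 'I_n -> V} := [ffun i => g (t i)].

Lemma ffact1 t : ffact (glin_one V) t = t.
Proof. by apply/ffunP => i; rewrite ffunE id_lfunE. Qed.

Lemma ffactM g h t : ffact (glin_mul g h) t = ffact g (ffact h t).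
Proof. by apply/ffunP => i; rewrite !ffunE comp_lfunE. Qed.

Lemma pgen_multilinear t i a u v :
  pgen multilinear (ffupd t i (a *: u + v)) =
    a *: pgen multilinear (ffupd t i u) + pgen multilinear (ffupd t i v).
Proof.
by rewrite /pgen -linearP; apply/qpi_eqP/mem_lspan; constructor.
Qed.

Lemma ffact_multilinear g r : multilinear r ->
  fglift (fun t => pgen multilinear (ffact g t)) r = 0.
Proof.
case=> t i a u v; rewrite linearB linearP /= !fgliftE.
have ffact_upd x : ffact g (ffupd t i x) = ffupd (ffact g t) i (g x).
  by apply/ffunP => j; rewrite !ffunE; case: eqP.
by rewrite !ffact_upd linearP pgen_multilinear subrr.
Qed.

Definition tensor_power : glmod V := gl_pres ffact1 ffactM ffact_multilinear.

(* Place permutations, (v_1 * ... * v_n) s = v_(s 1) * ... * v_(s n): a right *)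
(* action of S_n for the composition of functions, (s t) i = s (t i).         *)
Definition ffperm s t : {ffun 'I_n -> V} := [ffun i => t (s i)].

Lemma ffperm_multilinear s r : multilinear r ->
  fglift (fun t => pgen multilinear (ffperm s t)) r = 0.
Proof.
case=> t i a u v; rewrite linearB linearP /= !fgliftE.
have ffperm_upd x :
    ffperm s (ffupd t i x) = ffupd (ffperm s t) ((s^-1)%g i) x.
  by apply/ffunP => j; rewrite !ffunE (canF_eq (permK s)).
by rewrite !ffperm_upd pgen_multilinear subrr.
Qed.

Definition place_perm s : tensor_power -> tensor_power :=
  plift (ffperm_multilinear s).

HB.instance Definition _ s := GRing.Linear.on (place_perm s).

Lemma place_permE s t :
  place_perm s (pgen multilinear t) = pgen multilinear (ffperm s t).
Proof. exact: pliftE. Qed.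

Lemma glact_tensorE g t :
  glact tensor_power g (pgen multilinear t) = pgen multilinear (ffact g t).
Proof. exact: presactE. Qed.

Lemma glact_place g s x :
  glact tensor_power g (place_perm s x) = place_perm s (glact tensor_power g x).
Proof.
move: x; apply: (@pres_linear_eq _ _ _ _
  (glact tensor_power g \o place_perm s)
  (place_perm s \o glact tensor_power g)) => t.
transitivity (place_perm s (glact tensor_power g (pgen multilinear t))) => //.
rewrite glact_tensorE place_permE -[LHS]/(glact _ _ (place_perm s _)).
rewrite place_permE glact_tensorE.
by congr (pgen _ _); apply/ffunP => i; rewrite !ffunE.
Qed.

Lemma glact_lspan (M : glmod V) (S : M -> Prop) :
    (forall g x, S x -> S (glact M g x)) ->
  forall g x, x \in lspan S -> glact M g x \in lspan S.
Proof.
move=> gS g x /lspanP[s Ss ->]; rewrite linear_sum big_seq.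
apply: rpred_sum => p /Ss Sp; rewrite linearZ /=.
by apply: rpredZ; apply: mem_lspan; apply: gS.
Qed.

Inductive sym_rel : tensor_power -> Prop :=
  SymRel s x : sym_rel (place_perm s x - x).

Lemma glact_sym_rel g x : sym_rel x -> sym_rel (glact tensor_power g x).
Proof. by case=> s y; rewrite linearB glact_place; constructor. Qed.

Definition sym_power : glmod V := gl_quo (glact_lspan glact_sym_rel).

Inductive ext_rel : tensor_power -> Prop :=
  ExtRel t i j : i != j -> t i = t j -> ext_rel (pgen multilinear t).

Lemma glact_ext_rel g x : ext_rel x -> ext_rel (glact tensor_power g x).
Proof.
case=> t i j ij tij; rewrite glact_tensorE.
by apply: (ExtRel ij); rewrite !ffunE tij.
Qed.

Definition ext_power : glmod V := gl_quo (glact_lspan glact_ext_rel).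

End Power.

(* The boxes of the Young diagram of [lam] are numbered row after row, from   *)
(* left to right, so that [reshape_index lam i] and [reshape_offset lam i]    *)
(* are the row and the column of the box [i].  The Schur functor is the image *)
(* of the Young symmetrizer, the product of the sum over the row group and    *)
(* the signed sum over the column group.                                      *)
Section Schur.
Variable lam : seq nat.
Local Notation n := (sumn lam).

Definition row_group : {set 'S_n} :=
  [set p : 'S_n | [forall i, reshape_index lam (p i) == reshape_index lam i]].

Definition col_group : {set 'S_n} :=
  [set q : 'S_n | [forall i, reshape_offset lam (q i) == reshape_offset lam i]].

Definition young_symmetrizer (x : tensor_power n) : tensor_power n :=
  \sum_(p in row_group) \sum_(q in col_group)
     (-1) ^+ q *: place_perm q (place_perm p x).

Lemma young_symmetrizer_linear : linear young_symmetrizer.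
Proof.
move=> a x y; rewrite scaler_sumr -big_split; apply: eq_bigr => p _.
rewrite scaler_sumr -big_split; apply: eq_bigr => q _ /=.
by rewrite !linearP.
Qed.

HB.instance Definition _ :=
  GRing.isLinear.Build F (tensor_power n) (tensor_power n) *:%R
    young_symmetrizer young_symmetrizer_linear.

Lemma glact_young g x :
  glact _ g (young_symmetrizer x) = young_symmetrizer (glact _ g x).
Proof.
rewrite linear_sum; apply: eq_bigr => p _; rewrite linear_sum.
by apply: eq_bigr => q _; rewrite linearZ /= !glact_place.
Qed.

Lemma glact_schur g x :
  x \in limage young_symmetrizer (@full_submod F _) ->
  glact _ g x \in limage young_symmetrizer (@full_submod F _).
Proof.
move=> /limageP[y _ ->]; apply/limageP.
by exists (glact _ g y); rewrite ?glact_young.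
Qed.

Definition schur : glmod V := gl_sub glact_schur.

End Schur.

End Tensors.

(* -------------------------------------------------------------------------- *)
(* The hairy graph complex of the commutative operad                          *)
(* -------------------------------------------------------------------------- *)

Section HairyGraphs.
Variables (F : fieldType) (V : vectType F).

(* An oriented graph with [k] ordered internal vertices: the list of its      *)
(* directed internal edges, and the list of its hairs, each given by the      *)
(* internal vertex carrying it and the label of its leaf.  Components without *)
(* internal vertices are not represented; they are trees.                     *)
Definition hgraph k := (seq ('I_k * 'I_k) * seq ('I_k * V))%type.

HB.instance Definition _ k := Choice.on (hgraph k).

Definition edges k (X : hgraph k) := X.1.
Definition hairs k (X : hgraph k) := X.2.

Definition relabel k l (f : 'I_k -> 'I_l) (X : hgraph k) : hgraph l :=
  ([seq (f e.1, f e.2) | e <- edges X], [seq (f h.1, h.2) | h <- hairs X]).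

(* A loop contributes 2 to the valence of its vertex. *)
Definition valence k (X : hgraph k) (v : 'I_k) : nat :=
  (count (fun e => e.1 == v) (edges X) + count (fun e => e.2 == v) (edges X) +
   count (fun h => h.1 == v) (hairs X))%N.

Definition admissible k (X : hgraph k) := [forall v, (2 < valence X v)%N].

Definition adj k (X : hgraph k) : rel 'I_k :=
  fun u v => ((u, v) \in edges X) || ((v, u) \in edges X).

Definition components k (X : hgraph k) : nat := n_comp (adj X) predT.

(* Edges minus vertices plus components; each hair adds one edge and one      *)
(* vertex, so that hairs can be left out.                                     *)
Definition betti1 k (X : hgraph k) : nat :=
  (size (edges X) + components X - k)%N.

Inductive hgraph_rel k : {freeg (hgraph k) / F} -> Prop :=
| RelList (X Y : hgraph k) :
    perm_eq (edges X) (edges Y) -> perm_eq (hairs X) (hairs Y) ->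
    hgraph_rel (<<X>> - <<Y>>)
| RelVertices (s : 'S_k) (X : hgraph k) :
    hgraph_rel (<<relabel s X>> - (-1) ^+ s *: <<X>>)
| RelEdge (i j : 'I_k) es hs :
    hgraph_rel (<<(((j, i) :: es, hs) : hgraph k)>> +
                <<(((i, j) :: es, hs) : hgraph k)>>)
| RelLabel (i : 'I_k) a u v es hs :
    hgraph_rel (<<((es, (i, a *: u + v) :: hs) : hgraph k)>> -
                (a *: <<((es, (i, u) :: hs) : hgraph k)>> +
                 <<((es, (i, v) :: hs) : hgraph k)>>)).

Local Notation cls := (pgen (@hgraph_rel _)).

Lemma cls_list k (X Y : hgraph k) :
  perm_eq (edges X) (edges Y) -> perm_eq (hairs X) (hairs Y) -> cls X = cls Y.
Proof. by move=> eXY hXY; apply/qpi_eqP/mem_lspan/RelList. Qed.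

Lemma cls_vertices k (s : 'S_k) (X : hgraph k) :
  cls (relabel s X) = (-1) ^+ s *: cls X.
Proof. by rewrite /pgen -linearZ; apply/qpi_eqP/mem_lspan/RelVertices. Qed.

Lemma cls_edge k (i j : 'I_k) es hs :
  cls (((j, i) :: es, hs) : hgraph k) = - cls (((i, j) :: es, hs) : hgraph k).
Proof.
rewrite /pgen -linearN; apply/qpi_eqP/mem_lspan; rewrite opprK.
exact: RelEdge.
Qed.

Lemma cls_label k (i : 'I_k) a u v es hs :
  cls ((es, (i, a *: u + v) :: hs) : hgraph k) =
    a *: cls ((es, (i, u) :: hs) : hgraph k) +
    cls ((es, (i, v) :: hs) : hgraph k).
Proof. by rewrite /pgen -linearP; apply/qpi_eqP/mem_lspan/RelLabel. Qed.

Definition hact k (g : glin V) (X : hgraph k) : hgraph k :=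
  (edges X, [seq (h.1, g h.2) | h <- hairs X]).

Lemma hact1 k (X : hgraph k) : hact (glin_one V) X = X.
Proof.
case: X => es hs; rewrite /hact /=; congr (_, _).
by rewrite -[RHS]map_id; apply: eq_map => -[i v]; rewrite /= id_lfunE.
Qed.

Lemma hactM k g h (X : hgraph k) :
  hact (glin_mul g h) X = hact g (hact h X).
Proof.
rewrite /hact /=; congr (_, _); rewrite -map_comp.
by apply: eq_map => -[i v]; rewrite /= comp_lfunE.
Qed.

Lemma hact_relabel k l (f : 'I_k -> 'I_l) g X :
  hact g (relabel f X) = relabel f (hact g X).
Proof. by rewrite /hact /relabel /= -!map_comp. Qed.

Lemma hact_rel k g r : hgraph_rel r ->
  fglift (fun X : hgraph k => cls (hact g X)) r = 0.
Proof.
case=> [X Y eXY hXY|s X|i j es hs|i a u v es hs].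
- rewrite linearB /= !fgliftE; apply/eqP; rewrite subr_eq0; apply/eqP.
  by apply: cls_list => //; apply: perm_map.
- by rewrite linearB linearZ /= !fgliftE hact_relabel cls_vertices subrr.
- by rewrite linearD /= !fgliftE [X in X + _]cls_edge addNr.
- by rewrite linearB linearP /= !fgliftE /hact /= linearP cls_label subrr.
Qed.

(* Spanned by all oriented graphs with [k] internal vertices, admissible or   *)
(* not; since the relations only involve orientations of one and the same     *)
(* underlying graph, admissibility is imposed in [chains1] below.             *)
Definition hairy k : glmod V := gl_pres (@hact1 k) (@hactM k) (@hact_rel k).

Lemma glact_hairyE k g (X : hgraph k) :
  glact (hairy k) g (cls X) = cls (hact g X).
Proof. exact: presactE. Qed.

(* Some permutation moving [e.1] to the first and [e.2] to the second place;  *)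
(* [boundary_indep] shows that the choice is immaterial.                      *)
Definition to_front n (e : 'I_n.+2 * 'I_n.+2) : 'S_n.+2 :=
  (tperm e.1 0%R * tperm (tperm e.1 0%R e.2) 1%R)%g.

(* Identifies the vertices 0 and 1, keeping the order of the other ones. *)
Definition merge01 n (v : 'I_n.+2) : 'I_n.+1 := inord v.-1.

Definition contract n (e : 'I_n.+2 * 'I_n.+2) (X : hgraph n.+2) : hgraph n.+1 :=
  relabel (fun v => merge01 (to_front e v)) (rem e (edges X), hairs X).

Definition boundary_gen k : hgraph k -> hairy k.-1 :=
  match k return hgraph k -> hairy k.-1 with
  | n.+2 => fun X => \sum_(e <- edges X | e.1 != e.2)
                       (-1) ^+ to_front e *: cls (contract e X)
  | _ => fun=> 0
  end.

Lemma to_frontE n (e : 'I_n.+2 * 'I_n.+2) :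
  e.1 != e.2 -> (to_front e e.1 = 0) * (to_front e e.2 = 1).
Proof.
case: e => i j /= ij; rewrite /to_front !permM /= tpermL; split; last first.
  by rewrite tpermL.
rewrite [LHS]tpermD //.
apply: contra ij => /eqP p0.
by rewrite -(inj_eq (@perm_inj _ (tperm i 0))) tpermL p0.
Qed.

Lemma merge_lift n (x : 'I_n.+1) : merge01 (fintype.lift ord0 x) = x.
Proof. by rewrite /merge01 lift0 inord_val. Qed.

Lemma lift_merge n (v : 'I_n.+2) : v != 0 -> fintype.lift ord0 (merge01 v) = v.
Proof. by case: (unliftP ord0 v) => [x -> _|-> //]; rewrite merge_lift. Qed.

Lemma merge_perm n (t : 'S_n.+2) : t 0 = 0 -> t 1 = 1 ->
  exists2 r : 'S_n.+1, (r : bool) = t & forall v, merge01 (t v) = r (merge01 v).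
Proof.
move=> t0 t1; have t_neq0 x : t (fintype.lift ord0 x) != 0.
  by rewrite -t0 (inj_eq perm_inj) eq_sym neq_lift.
have f_inj : injective (fun x : 'I_n.+1 => merge01 (t (fintype.lift ord0 x))).
  move=> x y /(congr1 (fintype.lift ord0)); rewrite !lift_merge //.
  by move=> /perm_inj/lift_inj.
exists (perm f_inj) => [|v].
  have tE : t = lift_perm ord0 ord0 (perm f_inj).
    apply/permP => v; case: (unliftP ord0 v) => [x ->|->].
      by rewrite lift_perm_lift permE lift_merge.
    by rewrite lift_perm_id t0.
  by rewrite [in RHS]tE odd_lift_perm.
case: (unliftP ord0 v) => [x ->|->]; first by rewrite merge_lift permE.
rewrite t0 permE (_ : fintype.lift _ _ = 1) ?t1; last first.
  by apply: val_inj; rewrite /= inordK.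
by apply: val_inj; rewrite /= !inordK.
Qed.

Lemma relabel_comp k l m (f : 'I_k -> 'I_l) (g : 'I_l -> 'I_m) X :
  relabel g (relabel f X) = relabel (g \o f) X.
Proof. by rewrite /relabel /= -!map_comp. Qed.

Lemma eq_relabel k l (f g : 'I_k -> 'I_l) X :
  f =1 g -> relabel f X = relabel g X.
Proof. by move=> fg; congr (_, _); apply: eq_map => -[i j] /=; rewrite !fg. Qed.

Lemma boundary_indep n (p q : 'S_n.+2) i j (Y : hgraph n.+2) :
    p i = 0 -> p j = 1 -> q i = 0 -> q j = 1 ->
  (-1) ^+ p *: cls (relabel (fun v => merge01 (p v)) Y) =
  (-1) ^+ q *: cls (relabel (fun v => merge01 (q v)) Y).
Proof.
move=> pi pj qi qj; have [||r r_odd rE] := @merge_perm n (q^-1 * p)%g.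
- by rewrite permM -{1}qi permK.
- by rewrite permM -{1}qj permK.
have -> : relabel (fun v => merge01 (p v)) Y =
          relabel r (relabel (fun v => merge01 (q v)) Y).
  by rewrite relabel_comp; apply: eq_relabel => v; rewrite /= -rE permM permK.
rewrite cls_vertices scalerA -signr_addb r_odd odd_permM odd_permV.
by rewrite addbCA addbb addbF.
Qed.

Lemma perm_rem (T : eqType) (x : T) s t :
  perm_eq s t -> perm_eq (rem x s) (rem x t).
Proof.
move=> st; have [xs|xs] := boolP (x \in s); last first.
  by rewrite !rem_id // -(perm_mem st).
rewrite -(perm_cons x); apply: perm_trans (perm_trans st _).
  by rewrite perm_sym perm_to_rem.
by rewrite perm_to_rem // -(perm_mem st).
Qed.

Lemma rem_map (T U : eqType) (f : T -> U) x s :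
  injective f -> rem (f x) (map f s) = map f (rem x s).
Proof.
move=> f_inj; elim: s => //= y s IHs; rewrite (inj_eq f_inj).
by case: eqP => //= _; rewrite IHs.
Qed.

Lemma boundary_rel k r : hgraph_rel r -> fglift (@boundary_gen k) r = 0.
Proof.
case: k r => [|[|n]] r rel_r.
- by apply: (@freeg_linear_eq _ _ _ (fglift (@boundary_gen 0)) \0) => X;
  rewrite [LHS]fgliftE.
- by apply: (@freeg_linear_eq _ _ _ (fglift (@boundary_gen 1)) \0) => X;
  rewrite [LHS]fgliftE.
case: rel_r => [X Y eXY hXY|s X|i j es hs|i a u v es hs].
- rewrite linearB /= !fgliftE; apply/eqP; rewrite subr_eq0; apply/eqP.
  rewrite /= (perm_big _ eXY); apply: eq_bigr => e _; congr (_ *: _).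
  by apply: cls_list; rewrite perm_map // perm_rem.
- rewrite linearB linearZ /= !fgliftE; apply/eqP; rewrite subr_eq0; apply/eqP.
  rewrite /= big_map scaler_sumr; apply: eq_big => [e|e].
    by rewrite /= (inj_eq perm_inj).
  move=> /= eN; pose f (e : 'I_n.+2 * 'I_n.+2) := (s e.1, s e.2).
  have eN' : e.1 != e.2 by rewrite -(inj_eq (@perm_inj _ s)).
  have f_inj : injective f by move=> [i j] [i' j'] [/perm_inj -> /perm_inj ->].
  rewrite {1}/contract /= -/(f e).
  have -> : rem (f e) [seq (s e0.1, s e0.2) | e0 <- edges X] =
    [seq f e0 | e0 <- rem e (edges X)] by rewrite -rem_map.
  rewrite -[(map f _, _)]/(relabel s (rem e (edges X), hairs X)) relabel_comp.
  have [p1 p2] := to_frontE eN'; have [q1 q2] := @to_frontE _ (f e) eN.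
  have := @boundary_indep n (s * to_front (f e))%g (to_front e) e.1 e.2
    (rem e (edges X), hairs X).
  rewrite !(permM s) p1 p2 [to_front (f e) _]q1 [to_front (f e) _]q2.
  move=> /(_ erefl erefl erefl erefl).
  rewrite odd_permM signr_addb -scalerA => /(congr1 (fun z => (-1) ^+ s *: z)).
  rewrite scalerA -expr2 sqrr_sign scale1r => <-.
  by congr (_ *: pgen _ _); apply: eq_relabel => v; rewrite permM.
- rewrite linearD /= !fgliftE /= !big_cons /= eq_sym.
  have tail : \sum_(e <- es | e.1 != e.2) (-1) ^+ to_front e *:
       cls (contract e (((j, i) :: es, hs) : hgraph n.+2)) =
     - \sum_(e <- es | e.1 != e.2) (-1) ^+ to_front e *:
       cls (contract e (((i, j) :: es, hs) : hgraph n.+2)).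
    rewrite -sumrN big_seq_cond [RHS]big_seq_cond; apply: eq_bigr => e.
    move=> /andP[ees _]; rewrite -scalerN; congr (_ *: _).
    have rem_cons x : cls (contract e ((x :: es, hs) : hgraph n.+2)) =
        cls (relabel (fun v => merge01 (to_front e v)) (x :: rem e es, hs)).
      apply: cls_list => //; apply: perm_map => /=; case: eqP => // ->.
      exact: perm_to_rem.
    by rewrite !rem_cons cls_edge.
  rewrite {}tail; case: ifP => ij; last by rewrite addNr.
  rewrite addrACA addNr addr0 /contract /= !eqxx.
  have [p1 p2] := @to_frontE n (i, j) ij.
  have [|q1 q2] := @to_frontE n (j, i); first by rewrite eq_sym.
  rewrite /= in p1 p2 q1 q2.
  rewrite (@boundary_indep n _ (to_front (i, j) * tperm 0%R 1%R)%g j i) //.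
  + rewrite odd_permM odd_tperm /= addbT signrN scaleNr.
    apply/eqP; rewrite addrC subr_eq0; apply/eqP; congr (_ *: cls _).
    apply: eq_relabel => v; rewrite (permM (to_front (i, j))).
    case: (tpermP 0 1 (to_front (i, j) v)) => [->|->|//];
    by apply: val_inj; rewrite /= !inordK.
  + by rewrite permM p2 tpermR.
  + by rewrite permM p1 tpermL.
- rewrite linearB linearP /= !fgliftE /=; apply/eqP; rewrite subr_eq0; apply/eqP.
  rewrite scaler_sumr -big_split; apply: eq_bigr => e _ /=.
  by rewrite /contract /relabel /= cls_label scalerDr !scalerA mulrC.
Qed.

Definition boundary k : hairy k -> hairy k.-1 := plift (@boundary_rel k).

HB.instance Definition _ k := GRing.Linear.on (@boundary k).

Lemma boundaryE k (X : hgraph k) : boundary (cls X) = boundary_gen X.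
Proof. exact: pliftE. Qed.

Lemma glact_boundary k g (x : hairy k) :
  glact _ g (boundary x) = boundary (glact _ g x).
Proof.
move: x; apply: (@pres_linear_eq _ _ _ _
  (glact (hairy k.-1) g \o @boundary k) (@boundary k \o glact (hairy k) g)).
move=> X /=; rewrite [boundary _]boundaryE.
rewrite [X in boundary X]glact_hairyE boundaryE.
case: k X => [|[|n]] X /=; rewrite ?linear0 // linear_sum.
apply: eq_bigr => e _; rewrite linearZ /=; congr (_ *: _).
by rewrite [LHS]glact_hairyE /contract hact_relabel.
Qed.

(* The chains of the subcomplex spanned by the connected admissible graphs of *)
(* first Betti number 1.                                                      *)
Inductive loop_graph k : hairy k -> Prop :=
  LoopGraph (X : hgraph k) :
    admissible X -> components X = 1%N -> betti1 X = 1%N -> loop_graph (cls X).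

Definition chains1 k : {pred hairy k} := lspan (@loop_graph k).
Arguments chains1 : clear implicits.

HB.instance Definition _ k :=
  GRing.SubmodClosed.copy (chains1 k) (lspan (@loop_graph k)).

Lemma glact_loop_graph k g (x : hairy k) :
  loop_graph x -> loop_graph (glact (hairy k) g x).
Proof.
case=> X admX conX betX; rewrite glact_hairyE; constructor=> //.
apply/forallP => v; have := forallP admX v.
by rewrite /valence count_map.
Qed.

Lemma glact_chains1 k g (x : hairy k) :
  x \in chains1 k -> glact (hairy k) g x \in chains1 k.
Proof. exact/glact_lspan/glact_loop_graph. Qed.

Definition cycles1 k : {pred hairy k} := lkernel (@boundary k) (chains1 k).
Arguments cycles1 : clear implicits.

HB.instance Definition _ k :=
  GRing.SubmodClosed.copy (cycles1 k) (lkernel (@boundary k) (chains1 k)).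

Lemma glact_cycles1 k g (x : hairy k) :
  x \in cycles1 k -> glact (hairy k) g x \in cycles1 k.
Proof.
move=> /andP[xC /eqP dx]; apply/andP; split; first exact: glact_chains1.
apply/eqP; transitivity (glact (hairy k.-1) g (boundary x)).
  exact/esym/glact_boundary.
by rewrite dx linear0.
Qed.

Definition cycles1_mod k : glmod V := gl_sub (@glact_cycles1 k).

Definition boundaries1 k : {pred cycles1_mod k} :=
  lpreim (val : submod (cycles1 k) -> hairy k)
    (limage (@boundary k.+1) (chains1 k.+1)).
Arguments boundaries1 : clear implicits.

HB.instance Definition _ k :=
  GRing.SubmodClosed.copy (boundaries1 k)
    (lpreim (val : submod (cycles1 k) -> hairy k)
       (limage (@boundary k.+1) (chains1 k.+1))).

Lemma glact_boundaries1 k g (x : cycles1_mod k) :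
  x \in boundaries1 k -> glact (cycles1_mod k) g x \in boundaries1 k.
Proof.
move=> /limageP[y yC xy]; apply/limageP; exists (glact (hairy k.+1) g y).
  exact: glact_chains1.
transitivity (glact (hairy k) g (val (x : submod (cycles1 k)))) => //.
by rewrite xy; apply: (@glact_boundary k.+1).
Qed.

Definition homology1 k : glmod V := gl_quo (@glact_boundaries1 k).

End HairyGraphs.

(* Main.v *)
(* The edges of a connected graph of first Betti number 1 can be directed so  *)
(* that every vertex has exactly one outgoing edge: the graph is that of a    *)
(* self-map [f] of its vertices, the periodic points of [f] forming the cycle.*)
(* Let [h] insert, at one periodic vertex after the other, a new edge between *)
(* that vertex and the branches hanging from it.  Up to terms with a shorter  *)
(* cycle, [d h + h d] multiplies a graph by the number of periodic vertices   *)
(* that carry something else than a single hair.  So the only homology is     *)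
(* that of the hedgehogs, the polygons with one hair at each vertex:          *)
(* [H_{k,1}] is the quotient of [V^{(x) k}] by the dihedral group acting      *)
(* through a sign character, realized here as the image of the signed sum     *)
(* over that group.  For [k <= 5] it is decomposed by explicit elements of    *)
(* the group algebra of [S_k].                                                *)

Require Import Defs.
From HB Require Import structures.
From mathcomp Require Import freeg boolp.
From mathcomp Require Import all_boot all_order all_fingroup all_algebra.
From mathcomp Require Import zify.

Set Implicit Arguments.
Unset Strict Implicit.
Unset Printing Implicit Defensive.

Import GRing.Theory.

Local Open Scope ring_scope.

(** * Periodic points of a self-map *)

(** A connected graph of first Betti number 1 has as many internal edges as vertices, so its edges
    can be directed as the arrows of a self-map [f] ([unicyclic_orientation]); [per f] is then its
    cycle. For a given graph, [f] is unique up to reversal of cycles ([moved_per]), so a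
    construction that only uses [per f] and the non-periodic arrows descends to classes of graphs.

    Write d for [boundary] and h for [homotopy]. By [homotopy_formula], d h + h d is, up to graphs
    with a shorter cycle, the identity on a graph with a fat vertex and 0 on the others. The graphs
    without a fat vertex are the polygons with one hair per vertex (section [FatFree]). The map
    [hedgehog] reads these in the tensor power and vanishes on boundaries and on the image of h.
    Induction on the length of the cycle then shows that a cycle of the complex killed by [hedgehog]
    is a boundary ([exactness]), while every value of [hedgehog] on a polygon is attained on a cycle
    of the complex ([lift_to_cycle]). Hence for k >= 2 the homology is the image of [hedgehog] after
    [std], that is, of the element [gdelta k] of the group ring ([homology1_iso],
    [hedgehog_std_op]). For k = 1 the only internal edge is a loop, and the class of a graph with a
    loop is its own opposite.

    For k >= 3, [gdelta k] is the sum over the dihedral group weighted by the sign of the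
    permutation, with a further factor (-1)^k on reflections. It is the antisymmetrizer for k = 2
    and the symmetrizer for k = 3. For k = 4 the induced representation of S_4 has dimension 3 = 1 +
    2, and for k = 5 that of S_5 has dimension 12 = 6 + 6. No character theory is used: the
    isomorphisms and their inverses are given by elements of the group ring, and the required
    identities are checked by computation ([chain_eq], [chain2_eq]). *)

Section Periodic.
Variables (T : finType) (f : T -> T).

(* The periodic points, described in a way that is easy to transport through  *)
(* contractions and expansions.                                               *)
Definition per : {set T} := \bigcup_(S : {set T} | S \subset f @: S) S.

Lemma per_sup (S : {set T}) : S \subset f @: S -> S \subset per.
Proof. by move=> SfS; apply: bigcup_sup. Qed.

(** The union of the sets contained in their image is again such a set; finiteness turns the
    inclusion into an equality, whence injectivity of [f] on [per]. *)
Lemma per_img : f @: per = per.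
Proof.
apply/esym/eqP; rewrite eqEcard leq_imset_card andbT.
apply/bigcupsP => S SfS; apply: (subset_trans SfS).
exact/imsetS/per_sup.
Qed.

Lemma per_inj : {in per &, injective f}.
Proof. by apply/imset_injP; rewrite per_img. Qed.

Lemma per_f x : x \in per -> f x \in per.
Proof. by move=> xP; rewrite -per_img imset_f. Qed.

Lemma per_pre x : x \in per -> exists2 y, y \in per & x = f y.
Proof. by rewrite -{1}per_img => /imsetP. Qed.

(** A minimal nonempty stable subset is mapped onto itself, hence lies in [per]. *)
Lemma per_meets (S : {set T}) x :
  x \in S -> {in S, forall y, f y \in S} -> exists2 y, y \in S & y \in per.
Proof.
move=> xS fS.
pose p (A : {set T}) := (A != set0) && (f @: A \subset A).
have [|A /minsetP[/andP[/set0Pn[y yA] fA] minA] AS] := @minset_exists _ p S.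
  apply/andP; split; first by apply/set0Pn; exists x.
  by apply/subsetP => _ /imsetP[y yS ->]; apply: fS.
exists y; first exact: (subsetP AS).
apply: (subsetP (per_sup _)) (yA).
suff {1}<- : f @: A = A by [].
apply: minA => //; apply/andP; split; last exact: imsetS.
by apply/set0Pn; exists (f y); apply: imset_f.
Qed.

Lemma inj_per : injective f -> per = setT.
Proof.
move=> finj; apply/eqP; rewrite eqEsubset subsetT per_sup //.
by apply/subsetP => x _; rewrite -(f_invF finj x) imset_f.
Qed.

End Periodic.

(** * Periodic points after merging a point into its image *)

Section Contraction.
Variables (T U : finType) (f : T -> T) (g : U -> U) (i : T).
Variables (c : T -> U) (l : U -> T).
Hypothesis cl : cancel l c.
Hypothesis lc : forall v, v != i -> l (c v) = v.
Hypothesis li : forall x, l x != i.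
Hypothesis ci : c (f i) = c i.
Hypothesis fi : f i != i.
Hypothesis gE : forall x, g x = c (f (l x)).

(** Only the image of [i] needs care: it collapses together with [i], and a periodic predecessor of
    [i], distinct from [i], takes over. *)
Lemma contract_per_img v : v \in per f -> c v \in per g.
Proof.
move=> vP; suff /subsetP : c @: per f \subset per g by apply; apply: imset_f.
have step u : u \in per f -> c (f u) \in g @: (c @: per f).
  have [-> iP|ui uP] := eqVneq u i.
    rewrite ci; have [u' u'P iE] := per_pre iP.
    have u'i : u' != i by apply: contraNneq fi => e; rewrite -e -iE e.
    have <- : g (c u') = c i by rewrite gE lc // -iE.
    by do 2!apply: imset_f.
  have <- : g (c u) = c (f u) by rewrite gE lc.
  by do 2!apply: imset_f.
apply: per_sup; apply/subsetP => _ /imsetP[u uP ->].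
by have [u' u'P ->] := per_pre uP; apply: step.
Qed.

(** The lift of [per g] is contained in its image under [f], unless a lifted arrow passes through
    [i]; in that case adding [i] to the set repairs this. *)
Lemma contract_per_lift x : x \in per g -> l x \in per f.
Proof.
move=> xP.
have step z : z \in per g ->
    (exists2 y, y \in per g & l z = f (l y)) \/
    (l z = f i /\ exists2 y, y \in per g & i = f (l y)).
  case/per_pre => y yP ->; rewrite gE; have [fy|fy] := eqVneq (f (l y)) i.
    by right; rewrite fy -ci lc //; split=> //; exists y.
  by left; exists y; rewrite ?lc.
have [/existsP[y /andP[yP /eqP iE]]|noy] :=
    boolP [exists y, (y \in per g) && (i == f (l y))].
  apply: (subsetP (per_sup _) _ (_ : _ \in i |: l @: per g)); last first.
    by rewrite !inE imset_f ?orbT.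
  apply/subsetP => v; rewrite !inE => /orP[/eqP -> |/imsetP[z zP ->]].
    by rewrite {1}iE imset_f // !inE imset_f ?orbT.
  have [[u uP ->]|[-> _]] := step z zP; apply: imset_f; rewrite !inE ?eqxx //.
  by rewrite imset_f ?orbT.
apply: (subsetP (per_sup _) _ (imset_f l xP)).
apply/subsetP => _ /imsetP[z zP ->].
have [[u uP ->]|[_ [u uP iE]]] := step z zP; first by do 2!apply: imset_f.
by case/existsP: noy; exists u; rewrite uP iE eqxx.
Qed.

Lemma contract_per v : v != i -> (c v \in per g) = (v \in per f).
Proof.
move=> vi; apply/idP/idP; last exact: contract_per_img.
by move/contract_per_lift; rewrite lc.
Qed.

(** Contracting an edge of the cycle therefore shortens the cycle: the source of the filtration. *)
Lemma card_contract_per : (#|per g| <= #|per f :\ i|)%N.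
Proof.
rewrite -(card_imset _ (can_inj cl)); apply/subset_leq_card/subsetP.
by move=> _ /imsetP[x xP ->]; rewrite !inE li contract_per_lift.
Qed.

End Contraction.

(** * Periodic points after inserting a point between a periodic point and its branches *)

Section Expansion.
Variables (T U : finType) (f : T -> T) (g : U -> U) (v : T) (w : U).
Variable l : T -> U.
Hypothesis l_inj : injective l.
Hypothesis lw : forall u, l u != w.
Hypothesis U_cases : forall y, y = w \/ exists u, y = l u.
Hypothesis vP : v \in per f.
Hypothesis gw : g w = l v.
Hypothesis gl : forall u,
  g (l u) = if (f u == v) && (u \notin per f) then w else l (f u).

(** The only arrow out of [w] goes to [v], which already has a periodic preimage, so [w] can be left
    out of any set contained in its image. *)
Lemma expand_per u : (l u \in per g) = (u \in per f).
Proof.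
have sub u' : u' \in per f -> l u' \in per g.
  move=> u'P; apply: (subsetP (per_sup _) _ (imset_f l u'P)).
  apply/subsetP => _ /imsetP[z /per_pre[z' z'P ->] ->].
  have <- : g (l z') = l (f z') by rewrite gl z'P andbF.
  by do 2!apply: imset_f.
apply/idP/idP; last exact: sub.
move=> uP; pose S := [set z | l z \in per g].
have /subsetP : S \subset per f; last by apply; rewrite inE.
apply: per_sup; apply/subsetP => z; rewrite inE => /per_pre[y yP zE].
have [yw|[u' yu]] := U_cases y; subst y.
  move: zE; rewrite gw => /l_inj ->; have [v' v'P ->] := per_pre vP.
  by apply: imset_f; rewrite inE sub.
move: zE; rewrite gl; case: ifP => _ zE; first by case/eqP: (lw z).
by rewrite (l_inj zE); apply: imset_f; rewrite inE.
Qed.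

Lemma expand_per_new : w \notin per g.
Proof.
apply/negP => wP; have [y yP yw] := per_pre wP.
have [ey|[u yu]] := U_cases y; subst y.
  by move: yw; rewrite gw => e; case/eqP: (lw v).
move: yw yP; rewrite gl expand_per; case: ifP => [/andP[_ /negbTE->] //|_ e].
by case/eqP: (lw (f u)).
Qed.

Lemma card_expand_per : #|per g| = #|per f|.
Proof.
rewrite -(card_imset _ l_inj); apply: eq_card => y.
have [->|[u ->]] := U_cases y; last by rewrite (mem_imset _ _ l_inj) expand_per.
rewrite (negbTE expand_per_new); apply/esym/imsetP => -[u _ e].
by case/eqP: (lw u).
Qed.

End Expansion.

(** * Graphs of functions and the boundary *)

(** A simplicial identity: [x] is the position of [j] once [i] is deleted, [x'] that of [i] once [j]
    is deleted, and both orders of deletion leave the same numbering. *)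
Lemma bump_swap (i j x x' y : nat) : i != j -> bump i x = j -> bump j x' = i ->
  bump i (bump x y) = bump j (bump x' y).
Proof. by rewrite /bump => ij; lia. Qed.

(** The two orders of deletion carry opposite signs, which is why the boundary squares to zero. *)
Lemma bump_odd (i j x x' : nat) : i != j -> bump i x = j -> bump j x' = i ->
  odd (i + x) = ~~ odd (j + x').
Proof. by rewrite /bump => ij; lia. Qed.

(* The junk value [ord0] is only taken when [j = i].                          *)
Definition collapse n (i j v : 'I_n.+2) : 'I_n.+1 :=
  odflt ord0 (unlift i (if v == i then j else v)).

Section CollapseTheory.
Variables (n : nat) (i j : 'I_n.+2).

Lemma collapse_lift x : collapse i j (fintype.lift i x) = x.
Proof. by rewrite /collapse eq_sym (negbTE (neq_lift i x)) liftK. Qed.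

Lemma lift_coll v : v != i -> fintype.lift i (collapse i j v) = v.
Proof.
by move=> vi; have [x ->|/eqP] := unliftP i v;
  rewrite ?collapse_lift ?(negbTE vi).
Qed.

Lemma collapse_merge : j != i -> collapse i j j = collapse i j i.
Proof. by move=> ji; rewrite /collapse eqxx (negbTE ji). Qed.

End CollapseTheory.

Section FunctionalGraphs.
Variables (F : fieldType) (V : vectType F).

Local Notation cls := (pgen (@hgraph_rel F V _)).

Definition und k (e : 'I_k * 'I_k) := if (e.1 <= e.2)%N then e else (e.2, e.1).

(** A loop gets 0, because reversing it negates the class and leaves the graph unchanged. *)
Definition sgn k (e : 'I_k * 'I_k) : F :=
  if (e.1 < e.2)%N then 1 else if (e.2 < e.1)%N then -1 else 0.

Definition sg k (es : seq ('I_k * 'I_k)) : F := \prod_(e <- es) sgn e.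

Definition lmap k l (c : 'I_k -> 'I_l) (hs : seq ('I_k * V)) :=
  [seq (c h.1, h.2) | h <- hs].

Definition fedges k (f : 'I_k -> 'I_k) := [seq (i, f i) | i <- enum 'I_k].

(* The graph with an edge from [i] to [f i] for every vertex [i]: a single    *)
(* self-map encodes both the graph and its orientation.                       *)
Definition ugraph k (f : 'I_k -> 'I_k) hs : hgraph V k := (fedges f, hs).

Lemma eq_ugraph k (f g : 'I_k -> 'I_k) hs : f =1 g -> ugraph f hs = ugraph g hs.
Proof. by move=> fg; congr (_, _); apply: eq_map => i; rewrite fg. Qed.

Lemma und_flip k (e : 'I_k * 'I_k) : und (e.2, e.1) = und e.
Proof.
case: e => i j; rewrite /und /=.
by case: ltngtP => // /val_inj ->.
Qed.

Lemma sgn_flip k (e : 'I_k * 'I_k) : sgn (e.2, e.1) = - sgn e.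
Proof.
by case: e => i j; rewrite /sgn /=; case: ltngtP; rewrite ?opprK ?oppr0.
Qed.

Lemma und_eq k (e e' : 'I_k * 'I_k) :
  und e = und e' -> e' = e \/ e' = (e.2, e.1).
Proof.
case: e e' => i j [i' j']; rewrite /und /=.
by case: ifP => _; case: ifP => _ [-> ->]; auto.
Qed.

Lemma sgn_sq k (e : 'I_k * 'I_k) : e.1 != e.2 -> sgn e * sgn e = 1.
Proof.
rewrite /sgn neq_ltn => /orP[lt|lt]; last rewrite ltnNge (ltnW lt) /=.
  by rewrite lt mulr1.
by rewrite lt mulrNN mulr1.
Qed.

Lemma sg_sq k (es : seq ('I_k * 'I_k)) :
  all (fun e => e.1 != e.2) es -> sg es * sg es = 1.
Proof.
move=> /allP nl; rewrite /sg -big_split big_seq big1 //= => e /nl.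
exact: sgn_sq.
Qed.

Lemma sg_loop k (es : seq ('I_k * 'I_k)) :
  ~~ all (fun e => e.1 != e.2) es -> sg es = 0.
Proof.
move=> /allPn[[i j] ees]; rewrite /= negbK => /eqP ij.
by rewrite /sg (big_rem _ ees) /= /sgn /= ij ltnn mul0r.
Qed.

Lemma all_loopless_und k (es es' : seq ('I_k * 'I_k)) :
  perm_eq (map (@und k) es) (map (@und k) es') ->
  all (fun e => e.1 != e.2) es = all (fun e => e.1 != e.2) es'.
Proof.
have undE (s : seq ('I_k * 'I_k)) : all (fun e => e.1 != e.2) s =
    all (fun e => e.1 != e.2) (map (@und k) s).
  rewrite all_map; apply: eq_all => e; rewrite /= /und.
  by case: ifP => //= _; rewrite eq_sym.
by move=> es_es'; rewrite undE [RHS]undE; apply: perm_all.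
Qed.

Hypothesis F2 : (2%:R : F) != 0.

Lemma self_opp0 (L : lmodType F) (x : L) : x = - x -> x = 0.
Proof.
move=> xN; have : 2%:R *: x = 0 by rewrite scaler_nat mulr2n {2}xN subrr.
by move/eqP; rewrite scaler_eq0 (negbTE F2) => /eqP.
Qed.

Lemma cls_und_cat k (es1 es2 : seq ('I_k * 'I_k)) (hs : seq ('I_k * V)) :
  cls ((es1 ++ es2, hs) : hgraph V k) =
  sg es2 *: cls ((es1 ++ map (@und k) es2, hs) : hgraph V k).
Proof.
elim: es2 es1 => [|[i j] es2 IHes] es1.
  by rewrite /sg big_nil scale1r.
have headE e : cls ((es1 ++ e :: es2, hs) : hgraph V k) =
               cls ((e :: es1 ++ es2, hs) : hgraph V k).
  by apply: cls_list => //=; rewrite -cat1s perm_catCA.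
have -> : cls ((es1 ++ (i, j) :: es2, hs) : hgraph V k) =
          sgn (i, j) *: cls ((es1 ++ und (i, j) :: es2, hs) : hgraph V k).
  rewrite !headE /sgn /und /=; case: ltngtP => [_|_|/val_inj ->].
  - by rewrite scale1r.
  - by rewrite scaleN1r cls_edge.
  by rewrite scale0r; apply: self_opp0; apply: cls_edge.
rewrite -cat_rcons IHes scalerA cat_rcons; congr (_ *: _).
by rewrite /sg big_cons.
Qed.

Lemma cls_und k (es : seq ('I_k * 'I_k)) (hs : seq ('I_k * V)) :
  cls ((es, hs) : hgraph V k) = sg es *: cls ((map (@und k) es, hs) : hgraph V
    k).
Proof. exact: (cls_und_cat [::]). Qed.

(** Both lists are normalised by [cls_und]; if there is a loop, both sides vanish. *)
Lemma cls_same k (es es' : seq ('I_k * 'I_k)) (hs : seq ('I_k * V)) :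
  perm_eq (map (@und k) es) (map (@und k) es') ->
  cls ((es, hs) : hgraph V k) = (sg es * sg es') *: cls ((es', hs) : hgraph V
    k).
Proof.
move=> uu; rewrite cls_und [in RHS]cls_und scalerA.
have nlE := all_loopless_und uu.
have [nl|nl] := boolP (all (fun e => e.1 != e.2) es); last first.
  by rewrite (sg_loop nl) !mul0r !scale0r.
rewrite -mulrA sg_sq -?nlE // mulr1; congr (_ *: _).
exact: cls_list.
Qed.

Lemma perm_map_perm k (s : 'S_k) : perm_eq (map s (enum 'I_k)) (enum 'I_k).
Proof.
apply: uniq_perm; rewrite ?enum_uniq ?(map_inj_uniq perm_inj) ?enum_uniq //.
move=> x; rewrite mem_enum; apply/mapP; exists ((s^-1)%g x).
  by rewrite mem_enum.
by rewrite permKV.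
Qed.

Lemma cls_conj k (s : 'S_k) (f g : 'I_k -> 'I_k) hs :
  (forall u, g (s u) = s (f u)) ->
  cls (ugraph g (lmap s hs)) = (-1) ^+ s *: cls (ugraph f hs).
Proof.
move=> gs; rewrite -cls_vertices; apply: cls_list => //=.
rewrite /relabel /edges /ugraph /fedges /=.
have -> : [seq (s e.1, s e.2) | e <- [seq (i, f i) | i <- enum 'I_k]] =
          [seq (j, g j) | j <- map s (enum 'I_k)].
  by rewrite -!map_comp; apply: eq_map => i /=; rewrite gs.
by apply: perm_map; rewrite perm_sym perm_map_perm.
Qed.

Definition nofix k (f : 'I_k -> 'I_k) := [forall i, f i != i].

Lemma nofixE k (f : 'I_k -> 'I_k) :
  all (fun e => e.1 != e.2) (fedges f) = nofix f.
Proof.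
rewrite all_map; apply/allP/forallP => [nl i|nf i _] /=.
  by rewrite eq_sym; apply: nl; rewrite mem_enum.
by rewrite eq_sym; apply: nf.
Qed.

Lemma cls_fix k (f : 'I_k -> 'I_k) hs : ~~ nofix f -> cls (ugraph f hs) = 0.
Proof. by rewrite -nofixE cls_und => /sg_loop ->; rewrite scale0r. Qed.

Definition contract_fun n (f : 'I_n.+2 -> 'I_n.+2) i : {ffun 'I_n.+1 ->
  'I_n.+1} :=
  [ffun x => collapse i (f i) (f (fintype.lift i x))].

(* Merging [i] into [f i] keeps the order of the other vertices, so the sign  *)
(* is that of moving [i] to the front.                                        *)
Lemma cls_contract n (f : 'I_n.+2 -> 'I_n.+2) hs i : f i != i ->
  (-1) ^+ to_front (i, f i) *: cls (contract (i, f i) (ugraph f hs)) =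
  (-1) ^+ i *: cls (ugraph (contract_fun f i) (lmap (collapse i (f i)) hs)).
Proof.
move=> fi; set e := (i, f i); pose t : 'S_n.+1 := tperm (collapse i (f i) (f
  i)) 0.
have e12 : e.1 != e.2 by rewrite eq_sym.
have [p1 p2] := to_frontE e12.
pose q : 'S_n.+2 := lift_perm i ord0 t.
have q1 : q i = 0 by rewrite lift_perm_id.
have q2 : q (f i) = 1.
  rewrite -[f i in LHS](lift_coll (f i) fi) lift_perm_lift tpermL.
  by apply: val_inj.
rewrite (boundary_indep _ p1 p2 q1 q2).
have -> : relabel (fun v => merge01 (q v)) (rem e (fedges f), hs) =
  relabel t (relabel (collapse i (f i)) (rem e (fedges f), hs)).
  rewrite relabel_comp; apply: eq_relabel => v /=.
  have [x ->|->] := unliftP i v.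
    by rewrite lift_perm_lift merge_lift collapse_lift.
  rewrite lift_perm_id -collapse_merge // tpermL.
  by apply: val_inj; rewrite /= inordK.
rewrite cls_vertices scalerA odd_lift_perm /= addbF signr_addb.
rewrite -mulrA -expr2 sqrr_sign mulr1 signr_odd; congr (_ *: _).
apply: cls_list => //=; rewrite /fedges.
have -> : rem e [seq (j, f j) | j <- enum 'I_n.+2] =
          [seq (j, f j) | j <- rem i (enum 'I_n.+2)].
  by rewrite -rem_map // => x y [].
rewrite -map_comp.
have /(perm_map (fun j => (collapse i (f i) j, collapse i (f i) (f j)))) :
    perm_eq (rem i (enum 'I_n.+2)) (map (fintype.lift i) (enum 'I_n.+1)).
  apply: uniq_perm; first by rewrite rem_uniq ?enum_uniq.
    by rewrite (map_inj_uniq lift_inj) enum_uniq.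
  move=> x; rewrite mem_rem_uniq ?enum_uniq // inE mem_enum andbT.
  have [y ->|->] := unliftP i x.
    by rewrite eq_sym neq_lift map_f // mem_enum.
  rewrite eqxx; apply/esym/mapP => -[y _ /eqP].
  by rewrite (negbTE (neq_lift i y)).
rewrite -map_comp (eq_map (_ : _ =1 (fun x => (x, contract_fun f i x)))) // =>
  x /=.
by rewrite collapse_lift ffunE.
Qed.

Lemma boundary_ugraph n (f : 'I_n.+2 -> 'I_n.+2) hs :
  boundary (cls (ugraph f hs)) =
  \sum_(i | f i != i)
    (-1) ^+ i *: cls (ugraph (contract_fun f i) (lmap (collapse i (f i)) hs)).
Proof.
rewrite boundaryE /= big_map big_enum_cond /=.
by apply: eq_big => [i|i]; rewrite eq_sym // => fi; apply: cls_contract.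
Qed.

(** The double sum is antisymmetric: contracting the edges that leave [i] and [j] gives the same
    graph in either order, with opposite signs. *)
Lemma boundary_sq_ugraph n (f : 'I_n.+3 -> 'I_n.+3) hs :
  boundary (boundary (cls (ugraph f hs))) = 0.
Proof.
rewrite boundary_ugraph linear_sum /=.
(* The ordered pairs for which both contractions take place. The last clause discards 2-cycles,
   where contracting one edge turns the other into a loop. *)
pose C (i j : 'I_n.+3) := [&& i != j, f i != i, f j != j & ~~ ((f i == j) && (f
  j == i))].
pose cc (i j v : 'I_n.+3) : 'I_n.+1 :=
  let x := collapse i (f i) j in collapse x (contract_fun f i x) (collapse i (f
    i) v).
pose ll (i j : 'I_n.+3) (y : 'I_n.+1) : 'I_n.+3 :=
  fintype.lift i (fintype.lift (collapse i (f i) j) y).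
pose A (i j : 'I_n.+3) : hairy V n.+1 := (-1) ^+ (i + collapse i (f i) j) *:
  cls (ugraph (fun y => cc i j (f (ll i j y))) (lmap (cc i j) hs)).
have collN i j : C i j -> collapse i (f i) (f j) != collapse i (f i) j.
  case/and4P=> ij fi fj /nandP nij; have [fji|fji] := eqVneq (f j) i.
    rewrite fji -collapse_merge //.
    apply/eqP => /(congr1 (fintype.lift i)).
    rewrite !lift_coll // 1?eq_sym // => e.
    by case: nij; rewrite ?e ?fji eqxx.
  apply: contraNneq fj => /(congr1 (fintype.lift i)).
  by rewrite !lift_coll // 1?eq_sym // => ->.
transitivity (\sum_i \sum_(j | C i j) A i j).
  rewrite big_mkcond; apply: eq_bigr => i _; case: ifP => fi; last first.
    by rewrite big_pred0 // => j; rewrite /C fi andbF.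
  rewrite linearZ /= boundary_ugraph scaler_sumr.
  rewrite [RHS](reindex_onto (fintype.lift i) (collapse i (f i))) /=;
    last first.
    by move=> j /and4P[ij _ _ _]; rewrite lift_coll // eq_sym.
  apply: eq_big => [x|x nx].
    rewrite collapse_lift eqxx andbT /C neq_lift fi /= ffunE.
    have xi : fintype.lift i x != i by rewrite eq_sym neq_lift.
    set j := fintype.lift i x in xi *.
    apply/idP/idP => [nx|/andP[fj nij]].
      have fj : f j != j by apply: contraNneq nx => ->; rewrite collapse_lift.
      rewrite fj; apply: contra nx => /andP[/eqP fij /eqP fji].
      by rewrite fji -collapse_merge // fij collapse_lift.
    rewrite -(collapse_lift i (f i) x); apply: collN.
    by rewrite /C neq_lift fi fj.
  rewrite scalerA -exprD /A collapse_lift; congr (_ *: cls _).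
  rewrite /ugraph; congr (_, _).
    apply: eq_map => y; rewrite !ffunE /cc /ll collapse_lift.
    by rewrite ffunE.
  by rewrite /lmap -map_comp; apply: eq_map => h; rewrite /= /cc collapse_lift.
have Csym i j : C i j = C j i.
  by rewrite /C eq_sym [(f j == i) && _]andbC; congr (_ && _); rewrite andbCA.
have swap i j : C i j -> A i j = - A j i.
  move=> Cij; have Cji : C j i by rewrite Csym.
  have /and4P[ij fi fj nij] := Cij.
  have xE := lift_coll (f i) (_ : j != i); rewrite eq_sym in xE.
  have {}xE := xE ij; have yE := lift_coll (f j) ij.
  have ijN : (i : nat) != j by [].
  have xEN : bump i (collapse i (f i) j) = j by rewrite -[RHS](congr1 val xE).
  have yEN : bump j (collapse j (f j) i) = i by rewrite -[RHS](congr1 val yE).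
  have llE y : ll i j y = ll j i y by exact/val_inj/(bump_swap y ijN xEN yEN).
  have ccL y : cc i j (ll i j y) = y by rewrite /cc /ll !collapse_lift.
  have ccL' y : cc j i (ll i j y) = y by rewrite llE /cc /ll !collapse_lift.
  have ccf a b : C a b -> (cc a b (f a) = cc a b a) * (cc a b (f b) = cc a b b).
    move=> Cab; have /and4P[ab fa fb nab] := Cab.
    rewrite /cc; split; first by rewrite collapse_merge.
    have fxE : contract_fun f a (collapse a (f a) b) = collapse a (f a) (f b).
      by rewrite ffunE lift_coll // eq_sym.
    by rewrite fxE collapse_merge // -?fxE // fxE collN.
  have ll_cases v : v != i -> v != j -> exists y, v = ll i j y.
    move=> vi vj; exists (collapse (collapse i (f i) j) (collapse i (f i) j)
      (collapse i (f i) v)).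
    rewrite /ll lift_coll ?lift_coll //.
    apply: contraNneq vj => /(congr1 (fintype.lift i)).
    by rewrite !lift_coll // 1?eq_sym // => ->.
  (* The two composite collapses agree on surviving vertices. As each of [i], [j] is merged with its
     image, its value is found by following [f] to a surviving vertex, in at most two steps since
     [i] and [j] form no 2-cycle. *)
  have ccE v : cc i j v = cc j i v.
    have eqL u : u != i -> u != j -> cc i j u = cc j i u.
      by move=> ui uj; have [y ->] := ll_cases u ui uj; rewrite ccL ccL'.
    have [->|vi] := eqVneq v i; last have [->|vj] := eqVneq v j.
    - rewrite -(ccf _ _ Cij).1 -(ccf _ _ Cji).2.
      have [fij|fij] := eqVneq (f i) j; last exact: eqL.
      rewrite fij -(ccf _ _ Cij).2 -(ccf _ _ Cji).1; apply: eqL => //.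
      by apply: contraNneq nij => ->; rewrite fij !eqxx.
    - rewrite -(ccf _ _ Cij).2 -(ccf _ _ Cji).1.
      have [fji|fji] := eqVneq (f j) i; last exact: eqL.
      rewrite fji -(ccf _ _ Cij).1 -(ccf _ _ Cji).2; apply: eqL => //.
      by apply: contraNneq nij => ->; rewrite fji !eqxx.
    exact: eqL.
  have oddE : odd (i + collapse i (f i) j) = ~~ odd (j + collapse j (f j) i).
    exact: bump_odd ijN xEN yEN.
  rewrite /A -[(-1) ^+ (i + _)]signr_odd oddE signrN signr_odd scaleNr.
  congr (- (_ *: cls _)); rewrite /ugraph; congr (_, _).
    by apply: eq_map => y; rewrite llE ccE.
  by apply: eq_map => h; rewrite ccE.
have S0 : \sum_i \sum_(j | C i j) A i j = - \sum_i \sum_(j | C i j) A i j.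
  rewrite -sumrN [RHS](eq_bigr (fun i => \sum_(j | C i j) A j i)); last first.
    by move=> i _; rewrite -sumrN; apply: eq_bigr => j /swap ->; rewrite opprK.
  rewrite [RHS](exchange_big_dep predT) //=; apply: eq_bigr => i _.
  by apply: eq_bigl => j; rewrite Csym.
exact: self_opp0 S0.
Qed.

End FunctionalGraphs.

(** * The homotopy *)

Section Matching.
Variables (F : fieldType).

Lemma sg_fedges k (f : 'I_k -> 'I_k) :
  sg F (fedges f) = \prod_i sgn F (i, f i).
Proof. by rewrite /sg /fedges big_map big_enum. Qed.

Definition fmatch k (f g : 'I_k -> 'I_k) :=
  perm_eq (map (@und k) (fedges f)) (map (@und k) (fedges g)).

Lemma fmatchP k (f g : 'I_k -> 'I_k) :
  reflect (exists p : 'S_k, forall i, und (i, f i) = und (p i, g (p i)))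
          (fmatch f g).
Proof.
pose t (h : 'I_k -> 'I_k) := [tuple und (i, h i) | i < k].
have tE h : map (@und k) (fedges h) = t h by rewrite /fedges -map_comp.
rewrite /fmatch !tE; apply: (iffP tuple_permP) => -[p pE]; exists p.
  move=> i; have /(congr1 (fun s => nth (und (i, f i)) s i)) := pE.
  rewrite -!tnth_nth.
  by rewrite !tnth_map !tnth_ord_tuple.
congr (tval _); apply: eq_from_tnth => i.
by rewrite !tnth_map !tnth_ord_tuple pE.
Qed.

Section Witness.
Variables (k : nat) (f g : 'I_k -> 'I_k) (p : 'S_k).
Hypothesis pE : forall i, und (i, f i) = und (p i, g (p i)).

Lemma match_fix i : p i = i -> g i = f i.
Proof.
by move=> pi; have := pE i; rewrite pi => /und_eq[[->]//|[{2}-> ->]].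
Qed.

(** A moved index is an edge that [f] and [g] traverse in opposite directions. *)
Lemma match_move i : p i != i -> p i = f i /\ g (f i) = i.
Proof.
by move=> pi; have /und_eq[[e _]|[<- ->]//] := pE i; case/eqP: pi.
Qed.

(** On the set of its moved points [p] is a permutation and coincides with [f], so this set is its
    own image under [f]. Thus [f] and [g] differ only by reversal of cycles. *)
Lemma moved_per i : p i != i -> i \in per f.
Proof.
move=> pi; pose R := [set j | p j != j].
have /subsetP/(_ i) : R \subset per f; last by rewrite inE; apply.
apply: per_sup; suff -> : f @: R = p @: R.
  have -> : p @: R = R; last exact: subxx.
  apply/eqP; rewrite eqEcard card_imset ?leqnn ?andbT; last exact: perm_inj.
  apply/subsetP => _ /imsetP[j jR ->]; move: jR.
  by rewrite !inE (inj_eq perm_inj).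
apply: eq_in_imset => j; rewrite inE => /match_move[-> _] //.
Qed.

Lemma per_match_sub : per f \subset per g.
Proof.
apply: per_sup; apply/subsetP => v vP.
have [pv|/match_move[_ gfv]] := eqVneq (p v) v; last first.
  by apply/imsetP; exists (f v); rewrite ?per_f.
have [u uP vE] := per_pre vP; apply/imsetP; exists u => //.
have [pu|pu] := eqVneq (p u) u; first by rewrite (match_fix pu).
have [e _] := match_move pu; move: pu.
by rewrite -(inj_eq (@perm_inj _ p)) e -vE pv eqxx.
Qed.

Lemma sg_match : nofix f ->
  sg F (fedges f) * sg F (fedges g) =
  \prod_i (if p i == i then 1 else -1).
Proof.
move=> /forallP nf; rewrite !sg_fedges.
rewrite [X in _ * X](reindex_inj (@perm_inj _ p)) -big_split /=.
apply: eq_bigr => i _; have [pi|pi] := eqVneq (p i) i.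
  by rewrite pi (match_fix pi) sgn_sq // eq_sym nf.
have [-> ->] := match_move pi.
by rewrite (sgn_flip F (i, f i)) mulrN sgn_sq // eq_sym nf.
Qed.

End Witness.

Lemma fmatch_sym k (f g : 'I_k -> 'I_k) : fmatch f g = fmatch g f.
Proof. exact: perm_sym. Qed.

Lemma per_match k (f g : 'I_k -> 'I_k) : fmatch f g -> per f = per g.
Proof.
move=> fg; have /fmatchP[p pE] := fg; move: fg; rewrite fmatch_sym.
move=> /fmatchP[q qE]; apply/eqP; rewrite eqEsubset.
by rewrite (per_match_sub pE) (per_match_sub qE).
Qed.

Definition kid k (f : 'I_k -> 'I_k) v u := (f u == v) && (u \notin per f).

Lemma kid_match k (f g : 'I_k -> 'I_k) : fmatch f g -> kid f =2 kid g.
Proof.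
move=> fg v u; rewrite /kid -(per_match fg).
have [uP|uP] := boolP (u \in per f); rewrite ?andbF // !andbT.
have /fmatchP[p pE] := fg; have [pu|pu] := eqVneq (p u) u.
  by rewrite (match_fix pE pu).
by case/negP: uP; apply: (moved_per pE).
Qed.

(* The new vertex [ord0] is put between [v] and its non-periodic branches.    *)
Definition expand_fun k (f : 'I_k -> 'I_k) v : {ffun 'I_k.+1 -> 'I_k.+1} :=
  [ffun x => if unlift ord0 x is Some u
             then (if kid f v u then ord0 else fintype.lift ord0 (f u))
             else fintype.lift ord0 v].

Lemma expand_fun0 k (f : 'I_k -> 'I_k) v : expand_fun f v ord0 = fintype.lift
  ord0 v.
Proof. by rewrite ffunE unlift_none. Qed.

Lemma expand_funS k (f : 'I_k -> 'I_k) v u : expand_fun f v (fintype.lift ord0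
  u) =
  if kid f v u then ord0 else fintype.lift ord0 (f u).
Proof. by rewrite ffunE liftK. Qed.

Lemma expand_fun_nofix k (f : 'I_k -> 'I_k) v : nofix f -> nofix (expand_fun f
  v).
Proof.
move=> /forallP nf; apply/forallP => x; have [u ->|->] := unliftP ord0 x.
  rewrite expand_funS; case: ifP => _; first exact: neq_lift.
  by rewrite (inj_eq lift_inj).
by rewrite expand_fun0 eq_sym neq_lift.
Qed.

Lemma expand_fun_match_witness k (f g : 'I_k -> 'I_k) v (p : 'S_k) :
    fmatch f g ->
    (forall i, und (i, f i) = und (p i, g (p i))) ->
  forall i, und (i, expand_fun f v i) =
    und (lift_perm ord0 ord0 p i, expand_fun g v (lift_perm ord0 ord0 p i)).
Proof.
move=> fg pE i; have [u ->|->] := unliftP ord0 i; last first.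
  by rewrite lift_perm_id !expand_fun0.
rewrite lift_perm_lift !expand_funS.
have [pu|pu] := eqVneq (p u) u.
  by rewrite pu (match_fix pE pu) (kid_match fg).
have [-> gfu] := match_move pE pu.
have uP := moved_per pE pu.
rewrite gfu /kid -(per_match fg) uP per_f // !andbF.
by rewrite -[RHS]und_flip.
Qed.

Lemma expand_fun_match k (f g : 'I_k -> 'I_k) v :
  fmatch f g -> fmatch (expand_fun f v) (expand_fun g v).
Proof.
move=> fg; have /fmatchP[p pE] := fg; apply/fmatchP.
by exists (lift_perm ord0 ord0 p); apply: expand_fun_match_witness.
Qed.

(** The witness for the expansions fixes the new vertex and moves the old ones as before, so
    [sg_match] gives the same product. *)
Lemma sg_expand_fun_match k (f g : 'I_k -> 'I_k) v : fmatch f g -> nofix f ->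
  sg F (fedges (expand_fun f v)) * sg F (fedges (expand_fun g v)) =
  sg F (fedges f) * sg F (fedges g).
Proof.
move=> fg nf; have /fmatchP[p pE] := fg.
rewrite (sg_match pE) // (sg_match (expand_fun_match_witness v fg pE)).
  rewrite big_ord_recl lift_perm_id eqxx mul1r; apply: eq_bigr => i _.
  by rewrite lift_perm_lift (inj_eq lift_inj).
exact: expand_fun_nofix.
Qed.

Definition rel2 k l (c : 'I_k -> 'I_l) (e : 'I_k * 'I_k) := (c e.1, c e.2).

Lemma und_rel2 k l (c : 'I_k -> 'I_l) e : und (rel2 c (und e)) = und (rel2 c e).
Proof.
case: e => i j; rewrite {2}/und; case: ifP => _ //.
by rewrite -[RHS]und_flip.
Qed.

Lemma perm_und_rel2 k l (c : 'I_k -> 'I_l) (es es' : seq ('I_k * 'I_k)) :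
  perm_eq (map (@und k) es) (map (@und k) es') ->
  perm_eq (map (@und l) (map (rel2 c) es)) (map (@und l) (map (rel2 c) es')).
Proof.
move=> /(perm_map (fun e => und (rel2 c e))); rewrite -!map_comp.
by rewrite !(eq_map (_ : _ =1 (@und l \o rel2 c))) // => e /=; apply: und_rel2.
Qed.

(** The factor by which a renumbering changes the sign of an edge depends only on the undirected
    edge. *)
Lemma sg_rel2 k (s : 'S_k) (es es' : seq ('I_k * 'I_k)) :
    all (fun e => e.1 != e.2) es ->
    perm_eq (map (@und k) es) (map (@und k) es') ->
  sg F (map (rel2 s) es) * sg F (map (rel2 s) es') = sg F es * sg F es'.
Proof.
move=> nl uu; have nl' : all (fun e => e.1 != e.2) es'.
  by rewrite -(all_loopless_und uu).
pose q e : F := sgn F e * sgn F (rel2 s e).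
have qE e : q (und e) = q e.
  case: e => i j; rewrite /und; case: ifP => // _.
  by rewrite /q (sgn_flip F (i, j)) (sgn_flip F (rel2 s (i, j))) mulrNN.
have sgE (t : seq ('I_k * 'I_k)) : sg F t * sg F (map (rel2 s) t) =
    \prod_(e <- map (@und k) t) q e.
  rewrite /sg !big_map -big_split /=; apply: eq_bigr => e _; exact/esym/qE.
have e1 : sg F es * sg F (map (rel2 s) es) = sg F es' * sg F (map (rel2 s) es').
  by rewrite !sgE; apply: perm_big.
have sq' : sg F (map (rel2 s) es') * sg F (map (rel2 s) es') = 1.
  apply: sg_sq; rewrite all_map; apply: sub_all nl' => e /=.
  by rewrite (inj_eq perm_inj).
rewrite -[LHS]mul1r -(sg_sq F nl) -!mulrA; congr (_ * _).
by rewrite mulrA e1 -mulrA sq' mulr1.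
Qed.

Lemma per_conj k (s : 'S_k) (f g : 'I_k -> 'I_k) u :
  (forall u, g (s u) = s (f u)) -> (s u \in per g) = (u \in per f).
Proof.
move=> gs; suff sub (s' : 'S_k) (f' g' : 'I_k -> 'I_k) w :
    (forall u, g' (s' u) = s' (f' u)) -> w \in per f' -> s' w \in per g'.
  apply/idP/idP; last exact: sub.
  move=> /(sub (s^-1)%g g f (s u)); rewrite permK; apply=> w.
  by rewrite -{2}[w](permKV s) gs permK.
move=> gs' wP; apply: (subsetP (per_sup _) _ (imset_f s' wP)).
apply/subsetP => _ /imsetP[x /per_pre[y yP ->] ->].
by rewrite -gs'; do 2!apply: imset_f.
Qed.

Lemma kid_conj k (s : 'S_k) (f g : 'I_k -> 'I_k) v u :
  (forall u, g (s u) = s (f u)) -> kid g (s v) (s u) = kid f v u.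
Proof. by move=> gs; rewrite /kid gs (inj_eq perm_inj) (per_conj _ gs). Qed.

Lemma expand_fun_conj k (s : 'S_k) (f g : 'I_k -> 'I_k) v x :
    (forall u, g (s u) = s (f u)) ->
  expand_fun g (s v) (lift_perm ord0 ord0 s x) = lift_perm ord0 ord0 s
    (expand_fun f v x).
Proof.
move=> gs; have [u ->|->] := unliftP ord0 x.
  rewrite lift_perm_lift !expand_funS (kid_conj _ _ gs) gs.
  by case: ifP; rewrite ?lift_perm_id ?lift_perm_lift.
by rewrite lift_perm_id !expand_fun0 lift_perm_lift.
Qed.

End Matching.

(** * The operator that inserts an edge at the vertices of the cycle *)

Section Homotopy.
Variables (F : fieldType) (V : vectType F).
Hypothesis F2 : (2%:R : F) != 0.

Local Notation cls := (pgen (@hgraph_rel F V _)).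
Implicit Types k : nat.

Definition evert k (v u : 'I_k) : 'I_k.+1 :=
  if u == v then ord0 else fintype.lift ord0 u.

Definition kids k (f : 'I_k -> 'I_k) v := #|[pred u | kid f v u]|.

Definition nhairs k (hs : seq ('I_k * V)) v := count (fun h => h.1 == v) hs.

Definition branch k f (hs : seq ('I_k * V)) v := (kids f v + nhairs hs v)%N.

(* Before the division in [expansion_sum], [d h + h d] multiplies by the       *)
(* number of fat vertices.                                                    *)
Definition fat k (f : 'I_k -> 'I_k) (hs : seq ('I_k * V)) : {set 'I_k} :=
  [set v in per f | ~~ ((kids f v == 0%N) && (nhairs hs v == 1%N))].

(** The bound on [branch] makes the new vertex at least trivalent. If no vertex is fat the sum is
    empty, so the inverse of 0 is harmless. *)
Definition expansion_sum k (f : 'I_k -> 'I_k) (hs : seq ('I_k * V)) : hairy V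
  k.+1 :=
  #|fat f hs|%:R^-1 *:
    \sum_(v in per f | (1 < branch f hs v)%N)
       cls (ugraph (expand_fun f v) (lmap (evert v) hs)).

Lemma kids_match k (f g : 'I_k -> 'I_k) : fmatch f g -> kids f =1 kids g.
Proof. by move=> fg v; apply: eq_card => u; rewrite !inE (kid_match fg). Qed.

(** The index set and the insertions are expressed by [per] and [kid], which do not see the
    direction of a cycle; the signs agree by [sg_expand_fun_match]. *)
Lemma expansion_sum_match k (f g : 'I_k -> 'I_k) hs : nofix f -> fmatch f g ->
  expansion_sum f hs = (sg F (fedges f) * sg F (fedges g)) *: expansion_sum g
    hs.
Proof.
move=> nf fg; rewrite /expansion_sum scalerA mulrC -scalerA; congr (_^-1 *: _).
  congr (_%:R); apply: eq_card => v.
  by rewrite !inE (per_match fg) (kids_match fg).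
rewrite scaler_sumr (per_match fg); apply: eq_big => [v|v _].
  by rewrite /branch (kids_match fg).
by rewrite (cls_same F2 _ (expand_fun_match v fg)) (sg_expand_fun_match F v fg
  nf).
Qed.

Lemma nhairs_lmap k (s : 'S_k) (hs : seq ('I_k * V)) v :
  nhairs (lmap s hs) (s v) = nhairs hs v.
Proof.
by rewrite /nhairs count_map; apply: eq_count => h /=;
  rewrite (inj_eq perm_inj).
Qed.

Lemma kids_conj k (s : 'S_k) (f g : 'I_k -> 'I_k) v :
  (forall u, g (s u) = s (f u)) -> kids g (s v) = kids f v.
Proof.
move=> gs; rewrite /kids -[RHS](card_image (@perm_inj _ s));
  apply: eq_card => u.
rewrite -[u](permKV s) (mem_image (@perm_inj _ s)) !inE.
exact: kid_conj.
Qed.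

Lemma fat_conj k (s : 'S_k) (f g : 'I_k -> 'I_k) hs :
  (forall u, g (s u) = s (f u)) -> #|fat g (lmap s hs)| = #|fat f hs|.
Proof.
move=> gs; rewrite -[RHS](card_imset _ (@perm_inj _ s)); apply: eq_card => u.
rewrite -[u](permKV s) (mem_imset _ _ (@perm_inj _ s)) !inE.
by rewrite (per_conj _ gs) (kids_conj _ gs) nhairs_lmap.
Qed.

Lemma expansion_sum_conj k (s : 'S_k) (f g : 'I_k -> 'I_k) hs :
    (forall u, g (s u) = s (f u)) ->
  expansion_sum g (lmap s hs) = (-1) ^+ s *: expansion_sum f hs.
Proof.
move=> gs; rewrite /expansion_sum (fat_conj _ gs) scalerA mulrC -scalerA;
  congr (_ *: _).
rewrite (reindex_inj (@perm_inj _ s)) scaler_sumr /=.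
apply: eq_big => [v|v _].
  by rewrite (per_conj _ gs) /branch (kids_conj _ gs) nhairs_lmap.
have -> : (-1) ^+ s = (-1) ^+ lift_perm ord0 ord0 s :> F.
  by rewrite odd_lift_perm.
rewrite -(cls_conj (g := expand_fun g (s v))); last by move=> x;
  apply: expand_fun_conj.
congr (cls _); congr (_, _); rewrite /lmap -!map_comp; apply: eq_map => h /=.
rewrite /evert (inj_eq perm_inj); congr (_, _).
by case: ifP; rewrite ?lift_perm_id ?lift_perm_lift.
Qed.

Lemma expansion_sum_perm k (f : 'I_k -> 'I_k) hs hs' :
  perm_eq hs hs' -> expansion_sum f hs = expansion_sum f hs'.
Proof.
move=> hh; have nE v : nhairs hs v = nhairs hs' v by apply/seq.permP.
rewrite /expansion_sum; congr (_%:R^-1 *: _).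
  by apply: eq_card => v; rewrite !inE nE.
apply: eq_big => [v|v _]; first by rewrite /branch nE.
by apply: cls_list => //=; apply: perm_map.
Qed.

Lemma expansion_sum_label k (f : 'I_k -> 'I_k) i a u v hs :
  expansion_sum f ((i, a *: u + v) :: hs) =
  a *: expansion_sum f ((i, u) :: hs) + expansion_sum f ((i, v) :: hs).
Proof.
rewrite /expansion_sum scalerA mulrC -scalerA -scalerDr; congr (_ *: _).
rewrite scaler_sumr -big_split /=; apply: eq_bigr => w _.
exact: cls_label.
Qed.

Definition xmatch k (X : hgraph V k) (f : 'I_k -> 'I_k) :=
  nofix f && perm_eq (map (@und k) (edges X)) (map (@und k) (fedges f)).

(* By [expansion_sum_match] the choice of [f] is immaterial.                  *)
Definition homotopy_graph k (X : hgraph V k) : hairy V k.+1 :=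
  if [pick f : {ffun 'I_k -> 'I_k} | xmatch X f] is Some f
  then (sg F (edges X) * sg F (fedges f)) *: expansion_sum f (hairs X) else 0.

Lemma homotopy_graph_match k (X : hgraph V k) (f : {ffun 'I_k -> 'I_k}) :
  xmatch X f ->
  homotopy_graph X = (sg F (edges X) * sg F (fedges f)) *: expansion_sum f
    (hairs X).
Proof.
move=> Xf; rewrite /homotopy_graph; case: pickP => [g Xg|/(_ f)];
  last by rewrite Xf.
have [ng uXg] := andP Xg; have [nf uXf] := andP Xf.
have gf : fmatch g f 
  by apply: perm_trans uXf; rewrite perm_sym.
rewrite (expansion_sum_match _ ng gf) scalerA; congr (_ *: _).
rewrite -!mulrA; congr (_ * _); rewrite mulrA sg_sq ?mul1r //.
by rewrite nofixE.
Qed.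

Lemma homotopy_graph_none k (X : hgraph V k) : (forall f, ~~ xmatch X f) ->
  homotopy_graph X = 0.
Proof. by rewrite /homotopy_graph => none; case: pickP => // f;
  rewrite (negbTE (none f)). Qed.

Lemma xmatch_ex k (X : hgraph V k) :
  (exists f : {ffun 'I_k -> 'I_k}, xmatch X f) \/ (forall f, ~~ xmatch X f).
Proof.
have [/existsP|/existsPn none] :=
  boolP [exists f : {ffun 'I_k -> 'I_k}, xmatch X f]; first by left.
right=> f; have := none (finfun f); congr (~~ _); rewrite /xmatch;
  congr (_ && _).
  by apply: eq_forallb => i; rewrite ffunE.
have -> // : fedges (finfun f) = fedges f.
by apply: eq_map => i; rewrite ffunE.
Qed.

Lemma xmatch_relabel k (s : 'S_k) (X : hgraph V k) (f : 'I_k -> 'I_k) :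
  xmatch X f -> xmatch (relabel s X) [ffun x => s (f ((s^-1)%g x))].
Proof.
case/andP=> /forallP nf uXf; apply/andP; split.
  apply/forallP => x; rewrite ffunE -{2}[x](permKV s) (inj_eq perm_inj).
  exact: nf.
apply: (perm_trans (perm_und_rel2 s uXf)); apply: perm_map.
set g := finfun _; have gs i : g (s i) = s (f i) by rewrite ffunE permK.
have -> : map (rel2 s) (fedges f) = [seq (x, g x) | x <- map s (enum 'I_k)].
  by rewrite /fedges -!map_comp; apply: eq_map => i /=; rewrite gs.
exact/perm_map/perm_map_perm.
Qed.

Lemma homotopy_graph_rel k r : hgraph_rel r -> fglift (@homotopy_graph k) r = 0.
Proof.
case=> [X Y eXY hXY|s X|i j es hs|i a u v es hs].
- rewrite linearB /= !fgliftE; apply/eqP; rewrite subr_eq0; apply/eqP.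
  have xE f : xmatch X f = xmatch Y f.
    rewrite /xmatch; congr (_ && _); have /permPl := perm_map (@und k) eXY.
    exact.
  have [[f Xf]|none] := xmatch_ex X; last first.
    by rewrite !homotopy_graph_none // => f; rewrite -xE.
  rewrite (homotopy_graph_match Xf) (@homotopy_graph_match _ Y f) -?xE //
    (expansion_sum_perm _ hXY).
  by congr ((_ * _) *: _); apply: perm_big.
- rewrite linearB linearZ /= !fgliftE; apply/eqP; rewrite subr_eq0; apply/eqP.
  have [[f Xf]|none] := xmatch_ex X; last first.
    rewrite !homotopy_graph_none ?scaler0 // => f;
      apply/negP => /(xmatch_relabel (s^-1)%g).
    rewrite relabel_comp (@eq_relabel _ _ _ _ _ id) => [|x]; last exact: permK.
    have -> : relabel id X = X.
      by case: (X) => es hs; rewrite /relabel /=; congr (_, _);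
        rewrite -[RHS]map_id; apply: eq_map => -[].
    exact/negP.
  have [nf uXf] := andP Xf.
  rewrite (homotopy_graph_match Xf) (homotopy_graph_match (xmatch_relabel s
    Xf)).
  set g := [ffun x => _].
  have gs u : g (s u) = s (f u) by rewrite ffunE permK.
  rewrite (expansion_sum_conj _ gs) [LHS]scalerA [RHS]scalerA mulrC;
    congr (_ * _ *: _).
  have -> : sg F (fedges g) = sg F (map (rel2 s) (fedges f)).
    rewrite /fedges -map_comp [RHS]big_map big_enum sg_fedges (reindex_inj
      (@perm_inj _ s)).
    by apply: eq_bigr => x _; rewrite gs.
  apply: sg_rel2 => //; first by rewrite (all_loopless_und uXf) nofixE.
- rewrite linearD /= !fgliftE.
  have xE f : xmatch ((j, i) :: es, hs) f = xmatch ((i, j) :: es, hs) f.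
    by rewrite /xmatch /= -(und_flip (i, j)).
  have [[f Xf]|none] := xmatch_ex (((i, j) :: es, hs) : hgraph V k); last first.
    by rewrite !homotopy_graph_none ?addr0 // => f; rewrite ?xE.
  rewrite (homotopy_graph_match Xf) (@homotopy_graph_match _ _ f) ?xE // /sg /=
    !big_cons.
  by rewrite (sgn_flip F (i, j)) !mulNr scaleNr addNr.
- rewrite linearB linearP /= !fgliftE /=; apply/eqP; rewrite subr_eq0;
    apply/eqP.
  have [[f Xf]|none] := xmatch_ex ((es, (i, u) :: hs) : hgraph V k); last first.
    have n0 w : homotopy_graph ((es, (i, w) :: hs) : hgraph V k) = 0 by apply:
      homotopy_graph_none => g; apply: none.
    by rewrite !n0 scaler0 addr0.
  have fE w : homotopy_graph ((es, (i, w) :: hs) : hgraph V k) =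
      (sg F es * sg F (fedges f)) *: expansion_sum f ((i, w) :: hs) by exact:
        homotopy_graph_match.
  rewrite !fE expansion_sum_label scalerDr; congr (_ + _).
  by rewrite [LHS]scalerA [RHS]scalerA mulrC.
Qed.

Definition homotopy k : hairy V k -> hairy V k.+1 := plift (@homotopy_graph_rel
  k).

HB.instance Definition _ k := GRing.Linear.on (@homotopy k).

Lemma hom_ugraph k (f : {ffun 'I_k -> 'I_k}) hs :
  nofix f -> homotopy (cls (ugraph f hs)) = expansion_sum f hs.
Proof.
move=> nf; rewrite [LHS]pliftE (@homotopy_graph_match _ _ f) /=.
  by rewrite sg_sq ?nofixE // scale1r.
by rewrite /xmatch nf /=.
Qed.

End Homotopy.

(** * The homotopy formula *)

Section Shapes.
Variables (F : fieldType) (V : vectType F).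

Implicit Types k n : nat.

Definition npre k (f : 'I_k -> 'I_k) v := #|[pred u | f u == v]|.

Lemma valence_ugraph k (f : 'I_k -> 'I_k) (hs : seq ('I_k * V)) v :
  valence (ugraph f hs) v = (npre f v + nhairs hs v).+1.
Proof.
rewrite /valence /edges /hairs /= /fedges !(count_map (fun i => (i, f i))).
rewrite (_ : count _ (enum _) = 1%N); last first.
  by rewrite -[LHS]/(count_mem v _) count_uniq_mem ?enum_uniq ?mem_enum.
rewrite (_ : count _ (enum _) = npre f v) ?add1n //.
by rewrite enumT /npre cardE /enum_mem size_filter.
Qed.

(** Exactly one preimage of a periodic point is periodic, since [f] permutes [per f]. *)
Lemma npre_per k (f : 'I_k -> 'I_k) v : v \in per f -> npre f v = (kids f v).+1.
Proof.
case/per_pre=> u0 u0P vE; rewrite /npre (cardD1 u0) !inE -vE eqxx add1n.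
congr (_.+1); apply: eq_card => u; rewrite !inE /kid.
have [->|uu0] /= := eqVneq u u0; first by rewrite u0P andbF.
case: eqP => //= fu; apply/esym; apply: contra uu0 => uP.
by apply/eqP/(per_inj uP u0P); rewrite fu.
Qed.

Lemma valence_per k (f : 'I_k -> 'I_k) (hs : seq ('I_k * V)) v :
  v \in per f -> valence (ugraph f hs) v = (branch f hs v).+2.
Proof. by move=> vP; rewrite valence_ugraph npre_per // /branch addSn. Qed.

Lemma collapse_eq n (i j u : 'I_n.+2) x : j != i ->
  (collapse i j u == x) =
  (u == fintype.lift i x) || (u == i) && (j == fintype.lift i x).
Proof.
move=> ji; have [y ->|->] := unliftP i u.
  rewrite collapse_lift (inj_eq lift_inj) [_ == i]eq_sym (negbTE (neq_lift i
    y)).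
  by rewrite orbF.
rewrite eqxx (negbTE (neq_lift i x)) /= -collapse_merge //.
by rewrite -(inj_eq (@lift_inj _ i)) lift_coll.
Qed.

Section Contract.
Variables (n : nat) (f : 'I_n.+2 -> 'I_n.+2) (hs : seq ('I_n.+2 * V)).
Variable i : 'I_n.+2.
Hypothesis fi : f i != i.

Local Notation c := (collapse i (f i)).

Lemma nhairs_contract x : nhairs (lmap c hs) x =
  (nhairs hs (fintype.lift i x) +
   (if f i == fintype.lift i x then nhairs hs i else 0))%N.
Proof.
rewrite /nhairs count_map; case: eqP => [fE|/eqP/negbTE fE].
  rewrite -count_predUI [X in (_ + X)%N](@eq_count _ _ pred0) => [|h /=].
    rewrite count_pred0 addn0; apply: eq_count => h.
    by rewrite /= collapse_eq // fE eqxx andbT.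
  by case: eqP => // ->; rewrite eq_sym; apply/negbTE/neq_lift.
rewrite addn0; apply: eq_count => h.
by rewrite /= collapse_eq // fE andbF orbF.
Qed.

(** At the merged vertex the arrow from [i] to [f i] has disappeared, whence the predecessor. *)
Lemma npre_contract x : npre (contract_fun f i) x =
  if f i == fintype.lift i x then ((npre f (f i)).-1 + npre f i)%N
  else npre f (fintype.lift i x).
Proof.
have -> : npre (contract_fun f i) x = #|[pred u | (u != i) && (c (f u) == x)]|.
  rewrite /npre -(card_image (@lift_inj _ i)); apply: eq_card => u.
  rewrite !inE; have [y ->|->] := unliftP i u.
    by rewrite (mem_image (@lift_inj _ i)) inE ffunE [_ == i]eq_sym neq_lift.
  rewrite eqxx; apply/imageP => -[y _ /eqP].
  by rewrite (negbTE (neq_lift i y)).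
case: eqP => [fE|/eqP/negbTE fE]; last first.
  apply: eq_card => u; rewrite !inE collapse_eq // fE andbF orbF.
  by case: (eqVneq u i) => [->|//]; rewrite fE.
have -> : (npre f (f i)).-1 = #|[pred u | (u != i) && (f u == f i)]|.
  by rewrite /npre (cardD1 i) inE eqxx /=; apply: eq_card => u; rewrite !inE.
rewrite /npre -cardUI [X in (_ + X)%N]eq_card0 ?addn0 => [|u]; last first.
  rewrite !inE; case: (eqVneq (f u) i) => [->|]; rewrite ?andbF //.
  by rewrite [i == _]eq_sym (negbTE fi) andbF.
apply: eq_card => u; rewrite !inE collapse_eq // -fE eqxx andbT.
by case: (eqVneq u i) => [->|//]; rewrite (negbTE fi).
Qed.

Lemma valence_contract x :
  valence (ugraph (contract_fun f i) (lmap c hs)) x =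
  if f i == fintype.lift i x
  then (valence (ugraph f hs) (f i) + valence (ugraph f hs) i - 2)%N
  else valence (ugraph f hs) (fintype.lift i x).
Proof.
rewrite !valence_ugraph npre_contract nhairs_contract; case: eqP => [fE|_].
  have : (0 < npre f (f i))%N by apply/card_gt0P; exists i; rewrite inE.
  by rewrite fE; lia.
by rewrite addn0.
Qed.

End Contract.
End Shapes.

Lemma connect_homo (T U : finType) (e : rel T) (e' : rel U) (h : T -> U) u v :
  (forall x y, e x y -> connect e' (h x) (h y)) ->
  connect e u v -> connect e' (h u) (h v).
Proof.
move=> he /connectP[p]; elim: p u => [|x p IHp] u /= => [_ -> //|].
by case/andP=> /he ux /IHp{}IHp /IHp; apply: connect_trans.
Qed.

(** * The filtration by the length of the cycle *)

Section GoodGraphs.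
Variables (F : fieldType) (V : vectType F).
Hypothesis F2 : (2%:R : F) != 0.

Implicit Types k n m : nat.
Local Notation cls := (pgen (@hgraph_rel F V _)).

Definition fadj k (f : 'I_k -> 'I_k) : rel 'I_k :=
  fun u v => (f u == v) || (f v == u).

Definition conn k (f : 'I_k -> 'I_k) :=
  [forall u, forall v, connect (fadj f) u v].

Definition good k (f : 'I_k -> 'I_k) (hs : seq ('I_k * V)) :=
  [&& nofix f, admissible (ugraph f hs) & conn f].

(** The graph of a connected self-map has a single cycle, so [#|per f|] is its length. *)
Inductive fil_gen k m : hairy V k -> Prop :=
  FilGen (f : {ffun 'I_k -> 'I_k}) hs of good f hs & (#|per f| <= m)%N :
    fil_gen m (cls (ugraph f hs)).

Definition filt k m : {pred hairy V k} := lspan (@fil_gen k m).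
Arguments filt : clear implicits.

HB.instance Definition _ k m :=
  GRing.SubmodClosed.copy (filt k m) (lspan (@fil_gen k m)).

Lemma fil_le k m m' : (m <= m')%N -> {subset filt k m <= filt k m'}.
Proof.
move=> mm'; apply: (@lspan_ind _ _ _ (filt k m')) => _ [f hs gf fm].
by apply: mem_lspan; constructor=> //; apply: leq_trans mm'.
Qed.

Lemma fadj_sym k (f : 'I_k -> 'I_k) : connect_sym (fadj f).
Proof. by apply: sym_connect_sym => u v; rewrite /fadj orbC. Qed.

Section Contract.
Variables (n : nat) (f : 'I_n.+2 -> 'I_n.+2) (i : 'I_n.+2).
Hypothesis fi : f i != i.
Local Notation c := (collapse i (f i)).

Lemma per_contract_fun v : v != i -> (c v \in per (contract_fun f i)) = (v \in
  per f).
Proof.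
apply: (@contract_per _ _ f _ i c (fintype.lift i)) => //.
- exact: lift_coll.
- exact: collapse_merge.
- by move=> x; rewrite ffunE.
Qed.

Lemma per_contract_fun_lift x : (x \in per (contract_fun f i)) = (fintype.lift
  i x \in per f).
Proof. by rewrite -per_contract_fun ?collapse_lift // eq_sym neq_lift. Qed.

Lemma card_per_contract_fun : (#|per (contract_fun f i)| <= #|per f :\ i|)%N.
Proof.
apply: (@card_contract_per _ _ f _ i c (fintype.lift i)) => //.
- exact: collapse_lift.
- exact: lift_coll.
- by move=> x; rewrite eq_sym neq_lift.
- exact: collapse_merge.
- by move=> x; rewrite ffunE.
Qed.

Lemma contract_funE u : u != i -> contract_fun f i (c u) = c (f u).
Proof. by move=> ui; rewrite ffunE lift_coll. Qed.

Lemma conn_contract_fun : conn f -> conn (contract_fun f i).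
Proof.
move=> /forallP cf; apply/forallP => x; apply/forallP => y.
rewrite -(collapse_lift i (f i) x) -(collapse_lift i (f i) y).
apply: (@connect_homo _ _ (fadj f) _ c) (forallP (cf _) _) => u v.
have edge w : connect (fadj (contract_fun f i)) (c w) (c (f w)).
  have [->|wi] := eqVneq w i; first by rewrite collapse_merge.
  by rewrite -contract_funE //; apply: connect1; rewrite /fadj eqxx.
by case/orP=> /eqP <- //; rewrite fadj_sym.
Qed.

(** A fixed point could only arise from a 2-cycle through [i], and [i] would then be periodic. *)
Lemma nofix_contract_fun : nofix f -> i \notin per f -> nofix (contract_fun f
  i).
Proof.
move=> /forallP nf; apply: contraR => /forallPn[x]; rewrite negbK ffunE.
rewrite collapse_eq // (negbTE (nf _)) /= => /andP[/eqP fx /eqP ix].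
apply: (subsetP (per_sup (S := [set i; f i]) _)); last by rewrite !inE eqxx.
apply/subsetP => u; rewrite !inE => /orP[]/eqP->.
  by rewrite -{1}fx -ix imset_f // !inE eqxx orbT.
by rewrite imset_f // !inE eqxx.
Qed.

Lemma admissible_contract_fun (hs : seq ('I_n.+2 * V)) :
  admissible (ugraph f hs) -> admissible (ugraph (contract_fun f i) (lmap c
    hs)).
Proof.
move=> /forallP adm; apply/forallP => x; rewrite valence_contract //.
by case: ifP => // _; have := adm i; have := adm (f i); lia.
Qed.

(** When the contraction creates a loop the class is 0; otherwise the contracted map is again
    good. *)
Lemma fil_contract_fun hs : good f hs ->
  cls (ugraph (contract_fun f i) (lmap c hs)) \in filt n.+1 #|per f :\ i|.
Proof.
case/and3P=> nf adm cf.
have [nf'|/(cls_fix F2) ->] := boolP (nofix (contract_fun f i));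
  last exact: rpred0.
apply: mem_lspan; constructor; last exact: card_per_contract_fun.
by rewrite /good nf' admissible_contract_fun ?conn_contract_fun.
Qed.

End Contract.

Section Expand.
Variables (k : nat) (f : 'I_k -> 'I_k) (hs : seq ('I_k * V)) (v : 'I_k).
Hypothesis vP : v \in per f.
Local Notation ehs := (lmap (evert v) hs).

Lemma per_expand_fun u : (fintype.lift ord0 u \in per (expand_fun f v)) = (u
  \in per f).
Proof.
apply: (@expand_per _ _ f _ v ord0) => //; first exact: lift_inj.
- by move=> y; have [z ->|->] := unliftP ord0 y; [right; exists z|left].
- exact: expand_fun0.
by move=> w; rewrite expand_funS.
Qed.

Lemma card_per_expand_fun : #|per (expand_fun f v)| = #|per f|.
Proof.
apply: (@card_expand_per _ _ f _ v ord0 (fintype.lift ord0)) => //.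
- exact: lift_inj.
- by move=> y; have [z ->|->] := unliftP ord0 y; [right; exists z|left].
- exact: expand_fun0.
by move=> w; rewrite expand_funS.
Qed.

Lemma conn_expand_fun : conn f -> conn (expand_fun f v).
Proof.
move=> /forallP cf.
suff to_v x : connect (fadj (expand_fun f v)) x (fintype.lift ord0 v).
  apply/forallP => x; apply/forallP => y.
  by apply: connect_trans (to_v x) _; rewrite fadj_sym.
have new : connect (fadj (expand_fun f v)) ord0 (fintype.lift ord0 v).
  by apply: connect1; rewrite /fadj expand_fun0 eqxx.
have [u ->|-> //] := unliftP ord0 x.
apply: (@connect_homo _ _ (fadj f) _ (fintype.lift ord0)) (forallP (cf u) v).
have edge w : connect (fadj (expand_fun f v)) (fintype.lift ord0 w)
                                        (fintype.lift ord0 (f w)).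
  have [kw|kw] := boolP (kid f v w); last first.
    by apply: connect1; rewrite /fadj expand_funS (negbTE kw) eqxx.
  have /andP[/eqP -> _] := kw; apply: connect_trans new; apply: connect1.
  by rewrite /fadj expand_funS kw eqxx.
by move=> a b /orP[]/eqP <- //; rewrite fadj_sym.
Qed.

Lemma nhairs_new : nhairs ehs ord0 = nhairs hs v.
Proof.
rewrite /nhairs count_map; apply: eq_count => h; rewrite /= /evert.
by case: ifP => _; rewrite ?eqxx // eq_sym; apply/negbTE/neq_lift.
Qed.

Lemma nhairs_old u : nhairs ehs (fintype.lift ord0 u) =
  if u == v then 0%N else nhairs hs u.
Proof.
rewrite /nhairs count_map; case: ifP => [/eqP ->|uv].
  rewrite (@eq_count _ _ pred0) ?count_pred0 // => h; rewrite /= /evert.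
  by case: ifP => hv; rewrite ?(negbTE (neq_lift _ _)) // (inj_eq lift_inj).
apply: eq_count => h; rewrite /= /evert.
case: ifP => [/eqP ->|_]; last by rewrite (inj_eq lift_inj).
by rewrite (negbTE (neq_lift _ _)) eq_sym uv.
Qed.

Lemma npre_new : npre (expand_fun f v) ord0 = kids f v.
Proof.
rewrite /npre /kids -[RHS](card_image (@lift_inj _ ord0)); apply: eq_card => x.
have [u ->|->] := unliftP ord0 x.
  rewrite (mem_image (@lift_inj _ ord0)) !inE expand_funS.
  by case: ifP => //; rewrite eq_sym (negbTE (neq_lift _ _)).
rewrite inE expand_fun0 eq_sym (negbTE (neq_lift _ _)); apply/esym/imageP.
by case=> y _ /eqP; rewrite (negbTE (neq_lift _ _)).
Qed.

Lemma npre_old u : u != v -> npre (expand_fun f v) (fintype.lift ord0 u) = npre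
  f u.
Proof.
move=> uv; rewrite /npre -[RHS](card_image (@lift_inj _ ord0)).
apply: eq_card => x; have [w ->|->] := unliftP ord0 x.
  rewrite (mem_image (@lift_inj _ ord0)) !inE expand_funS /kid.
  have [->|fwv] := eqVneq (f w) v; last by rewrite (inj_eq lift_inj).
  rewrite [RHS]eq_sym (negbTE uv); case: ifP => //.
  by rewrite (inj_eq lift_inj) eq_sym (negbTE uv).
rewrite inE expand_fun0 (inj_eq lift_inj) eq_sym (negbTE uv); apply/esym/imageP.
by case=> y _ /eqP; rewrite (negbTE (neq_lift _ _)).
Qed.

Lemma npre_root : (1 < npre (expand_fun f v) (fintype.lift ord0 v))%N.
Proof.
have [u uP vE] := per_pre vP; apply/card_gt1P.
exists ord0, (fintype.lift ord0 u); split; last exact: neq_lift.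
  by rewrite inE expand_fun0.
by rewrite inE expand_funS /kid uP andbF -vE.
Qed.

(** Although [v] loses its hairs, it has two incoming edges, from its periodic preimage and from the
    new vertex, and one outgoing edge. The new vertex has valence [branch f hs v] plus 1. *)
Lemma good_expand_fun : (1 < branch f hs v)%N -> good f hs -> good (expand_fun
  f v) ehs.
Proof.
move=> bv /and3P[nf /forallP adm cf]; apply/and3P; split.
- exact: expand_fun_nofix.
- apply/forallP => x; rewrite valence_ugraph; have [u ->|->] := unliftP ord0 x.
    have [->|uv] := eqVneq u v; first by rewrite !ltnS ltn_addr // npre_root.
    by rewrite nhairs_old (negbTE uv) npre_old // -valence_ugraph adm.
  by rewrite nhairs_new npre_new.
exact: conn_expand_fun.
Qed.

End Expand.

End GoodGraphs.

Lemma lspan_linear (F : fieldType) (L M : lmodType F) (h : {linear L -> M})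
    (S : L -> Prop) (T : submodClosed M) :
  (forall x, S x -> h x \in T) -> forall x, x \in lspan S -> h x \in T.
Proof.
move=> hS x /lspanP[s Ss ->]; rewrite linear_sum big_seq.
by apply: rpred_sum => p /Ss/hS hp; rewrite linearZ rpredZ.
Qed.

(** * The homotopy is a contraction up to shorter cycles *)

Section HomotopyFormula.
Variables (F : fieldType) (V : vectType F).
Hypothesis F2 : (2%:R : F) != 0.

Implicit Types k n m : nat.
Local Notation cls := (pgen (@hgraph_rel F V _)).
Local Notation lift0 := (fintype.lift ord0).
Local Notation fil k m := (@filt F V k m).
Local Notation hom := (@homotopy F V F2 _).

Section Branches.
Variables (n : nat) (f : {ffun 'I_n.+2 -> 'I_n.+2}) (hs : seq ('I_n.+2 * V)).
Hypothesis gf : good f hs.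
Local Notation c i := (collapse i (f i)).

Let nf i : f i != i.
Proof. by case/and3P: gf => /forallP. Qed.

Let adm v : (2 < valence (ugraph f hs) v)%N.
Proof. by case/and3P: gf => _ /forallP. Qed.

Let collapse_same i a v : a != i -> v != i -> (c i a == c i v) = (a == v).
Proof. by move=> ai vi; rewrite -(inj_eq (@lift_inj _ i)) !lift_coll. Qed.

Let collapse_base i v : v != i -> (c i i == c i v) = (f i == v).
Proof. by move=> vi; rewrite -collapse_merge // collapse_same. Qed.

Let E (v i : 'I_n.+2) := collapse (lift0 i) (expand_fun f v (lift0 i)).

(** Up to sign, the term in the boundary of the expansion at [v] that contracts the edge leaving the
    old vertex [i]. *)
Let D (v i : 'I_n.+2) : hairy V n.+2 := cls (ugraph (contract_fun (expand_fun f
  v) (lift0 i))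
                             (lmap (E v i) (lmap (evert v) hs))).

Let E0 v i : E v i ord0 = ord0.
Proof.
have -> : ord0 = fintype.lift (lift0 i) ord0 :> 'I_n.+3 by apply: val_inj.
by rewrite /E collapse_lift.
Qed.

Let ES v i u : u != i -> E v i (lift0 u) = lift0 (c i u).
Proof.
move=> ui; rewrite -{1}(lift_coll (f i) ui).
have -> x : lift0 (fintype.lift i x) = fintype.lift (lift0 i) (lift0 x).
  by apply: val_inj; rewrite /= /bump; lia.
by rewrite /E collapse_lift.
Qed.

Let Ebase v i : i \notin per f ->
  E v i (lift0 i) = if f i == v then ord0 else lift0 (c i i).
Proof.
move=> iP; rewrite /E -collapse_merge -/(E v i).
  rewrite expand_funS /kid iP andbT; case: ifP => // _; rewrite ?E0 //.
  by rewrite ES ?nf // collapse_merge.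
rewrite expand_funS; case: ifP => _; first exact: neq_lift.
by rewrite (inj_eq lift_inj) nf.
Qed.

(** Contracting an edge off the cycle commutes with the insertion at [v], even when that edge ends
    at [v] and so is moved to the new vertex. *)
Lemma contract_expand v i : v \in per f -> i \notin per f ->
  D v i = cls (ugraph (expand_fun (contract_fun f i) (c i v))
                      (lmap (evert (c i v)) (lmap (c i) hs))).
Proof.
move=> vP iP; have vi : v != i by apply: contraNneq iP => <-.
rewrite /D; congr (cls _); rewrite /ugraph; congr (_, _); last first.
  rewrite /lmap -!map_comp; apply: eq_map => -[u x] /=; congr (_, _).
  rewrite {1}/evert; have [->|uv] := eqVneq u v.
    by rewrite E0 /evert eqxx.
  have [->|ui] := eqVneq u i; last by rewrite ES // /evert collapse_same //
    (negbTE uv).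
  by rewrite Ebase // /evert collapse_base.
apply: eq_map => x; congr (_, _); rewrite ffunE -/(E v i).
have [y ->|->] := unliftP ord0 x; last first.
  have -> : fintype.lift (lift0 i) ord0 = ord0 :> 'I_n.+3 by apply: val_inj.
  by rewrite !expand_fun0 ES.
have -> : fintype.lift (lift0 i) (lift0 y) = lift0 (fintype.lift i y).
  by apply: val_inj; rewrite /= /bump; lia.
rewrite !expand_funS /kid per_contract_fun_lift ?nf // ffunE.
set u := fintype.lift i y.
have [fui|fui] := eqVneq (f u) i; last first.
  by rewrite collapse_same //; case: ifP => _; rewrite ?E0 // ES.
have uP : u \notin per f by apply: contra iP; rewrite -fui; apply: per_f.
rewrite fui [i == v]eq_sym (negbTE vi) uP collapse_base //= Ebase // ?andbT;
  reflexivity.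
Qed.

(** If [i] is the only branch of [v], contracting it and then expanding at [v] recreates it as
    vertex 0; the sign is that of moving [i] to the front. *)
Lemma contract_expand_kid v i : v \in per f -> i \notin per f -> f i = v ->
  branch f hs v = 1%N -> (-1) ^+ i *: D v i = cls (ugraph f hs).
Proof.
move=> vP iP fiv bv; have vi : v != i by apply: contraNneq iP => <-.
have ki : kid f v i by rewrite /kid fiv eqxx iP.
have [k1 h0] : kids f v = 1%N /\ nhairs hs v = 0%N.
  have : (0 < kids f v)%N by apply/card_gt0P; exists i.
  by move: bv; rewrite /branch; lia.
have kidE u : kid f v u -> u = i.
  move/eqP: k1 => /card1P -[j jE] ku.
  by have := jE u; have := jE i; rewrite !inE ku ki => /esym/eqP-> /esym/eqP.
pose s : 'S_n.+2 := lift_perm i ord0 1%g.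
have si : s i = ord0 by rewrite lift_perm_id.
have sE u : u != i -> s u = lift0 (c i u).
  by move=> ui; rewrite -{1}(lift_coll (f i) ui) lift_perm_lift perm1.
rewrite contract_expand //.
have -> : lmap (evert (c i v)) (lmap (c i) hs) = lmap s hs.
  rewrite /lmap -map_comp; apply/eq_in_map => -[u x] uhs /=; congr (_, _).
  have uv : u != v.
    apply: contraTneq (isT) => uv; move/eqP: h0; rewrite /nhairs -leqn0 leqNgt.
    by rewrite -has_count => /hasPn/(_ _ uhs); rewrite /= uv eqxx.
  have [->|ui] := eqVneq u i; first by rewrite si /evert collapse_base // fiv
    eqxx.
  by rewrite sE // /evert collapse_same // (negbTE uv).
rewrite (cls_conj (s := s) (f := f)) => [|u].
  rewrite scalerA odd_lift_perm odd_perm1 !addbF signr_odd -expr2 sqrr_sign.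
  by rewrite scale1r.
have [->|ui] := eqVneq u i; first by rewrite si expand_fun0 [in RHS]fiv sE.
rewrite (sE u ui) expand_funS /kid per_contract_fun ?nf // contract_funE //.
have [fui|fui] := eqVneq (f u) i.
  rewrite fui collapse_base // fiv eqxx si.
  by rewrite (_ : u \notin per f) //; apply: contra iP; rewrite -fui;
    apply: per_f.
rewrite collapse_same // -/(kid f v u); have [/kidE e|_] := boolP (kid f v u).
  by rewrite e eqxx in ui.
by rewrite sE.
Qed.

Let big (v : 'I_n.+2) := (1 < branch f hs v)%N.

Lemma branch_gt0 v : v \in per f -> (0 < branch f hs v)%N.
Proof. by move=> vP; have := adm v; rewrite valence_per. Qed.

(** Being at least trivalent, [i] brings at least two branches to the vertex it is merged into. *)
Lemma branch_contract i x : i \notin per f -> x \in per (contract_fun f i) ->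
  (1 < branch (contract_fun f i) (lmap (c i) hs) x)%N =
  big (fintype.lift i x) || (fintype.lift i x == f i).
Proof.
move=> iP xP; have lxP : fintype.lift i x \in per f by rewrite
  -per_contract_fun_lift.
have := @valence_contract _ _ _ f hs i (nf i) x.
rewrite (valence_per _ xP) (valence_per _ lxP) [_ == f i]eq_sym.
case: ifP => _; last by case=> ->; rewrite orbF.
by have := adm i; have := adm (f i); rewrite orbT; lia.
Qed.

(** This gives d h and h d the same denominator on terms off the cycle. If [f i] is periodic, it is
    fat before the contraction because of the kid [i], and after it by [branch_contract]. *)
Lemma fat_contract i : i \notin per f ->
  #|fat (contract_fun f i) (lmap (c i) hs)| = #|fat f hs|.
Proof.
move=> iP; rewrite -(card_imset _ (@lift_inj _ i)); apply: eq_card => u.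
have [x ->|->] := unliftP i u; last first.
  rewrite inE (negbTE iP); apply/imsetP => -[y _ /eqP].
  by rewrite (negbTE (neq_lift _ _)).
rewrite (mem_imset _ _ (@lift_inj _ i)) !inE.
rewrite per_contract_fun_lift ?nf //; have [lxP|//] := boolP (_ \in per f).
have xP : x \in per (contract_fun f i) by rewrite per_contract_fun_lift ?nf.
have := branch_contract iP xP; rewrite /branch.
have := nhairs_contract hs (nf i) x; have := @npre_contract _ f i (nf i) x.
rewrite (npre_per xP) (npre_per lxP) [_ == f i]eq_sym.
case: eqP => [fix_|_] /=; last by move=> [->] ->; rewrite addn0.
have : (0 < kids f (fintype.lift i x))%N.
  by apply/card_gt0P; exists i; rewrite inE /kid fix_ eqxx iP.
by rewrite orbT => *; lia.
Qed.

Lemma expansion_sum_contract i : i \notin per f ->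
  expansion_sum (contract_fun f i) (lmap (c i) hs) =
  #|fat f hs|%:R^-1 *: \sum_(v in per f | big v || (v == f i)) D v i.
Proof.
move=> iP; rewrite /expansion_sum fat_contract //; congr (_ *: _).
have inP v : v \in per f -> v != i by apply: contraTneq => ->.
rewrite [RHS](reindex_onto (fintype.lift i) (c i)) /=; last first.
  by move=> v /andP[/inP vi _]; rewrite lift_coll.
apply: eq_big => [x|x /andP[xP _]].
  rewrite collapse_lift eqxx andbT -per_contract_fun_lift ?nf //.
  by have [xP|//] := boolP (x \in per _); rewrite branch_contract.
by rewrite contract_expand -?per_contract_fun_lift ?nf // collapse_lift.
Qed.

(** A periodic vertex that is not big has exactly one branch, and is fat precisely when this branch
    is a kid and not a hair. *)
Lemma card_fat : #|fat f hs| =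
  (\sum_(v in per f | big v) 1 + \sum_(v in per f | ~~ big v) kids f v)%N.
Proof.
transitivity (\sum_(v in per f | ~~ ((kids f v == 0%N) && (nhairs hs v ==
  1%N))) 1)%N.
  by rewrite -sum1_card; apply: eq_bigl => v; rewrite inE.
rewrite (bigID big) /=; congr (_ + _)%N.
  apply: eq_bigl => v; rewrite -andbA; congr (_ && _); rewrite /big /branch.
  by apply/idP/idP; lia.
rewrite [LHS]big_mkcond [RHS]big_mkcond /=; apply: eq_bigr => v _.
have [vP|//] := boolP (v \in per f); have := branch_gt0 vP.
by rewrite /big /branch /=; case: ifP; case: ifP => //; lia.
Qed.

(** Contracting the edge of the new vertex 0 gives the graph back with sign +; the old vertices are
    shifted by one, whence the minus sign. *)
Lemma boundary_expand v : v \in per f ->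
  boundary (cls (ugraph (expand_fun f v) (lmap (evert v) hs))) =
  cls (ugraph f hs) - \sum_(i < n.+2) (-1) ^+ i *: D v i.
Proof.
move=> vP; rewrite boundary_ugraph (eq_bigl predT) => [|i]; last first.
  by apply/forallP: i; apply: expand_fun_nofix; apply/forallP.
rewrite big_ord_recl expr0 scale1r -sumrN; congr (_ + _); last first.
  by apply: eq_bigr => i _; rewrite exprS mulN1r scaleNr.
congr (cls _); rewrite expand_fun0 /ugraph; congr (_, _).
  apply: eq_map => x; congr (_, _); rewrite ffunE expand_fun0 expand_funS.
  case: ifP => [/andP[/eqP -> _]|_]; last by rewrite collapse_lift.
  by rewrite -collapse_merge ?collapse_lift // eq_sym neq_lift.
rewrite /lmap -map_comp -[RHS]map_id; apply: eq_map => -[u x] /=.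
rewrite /evert; case: eqP => [->|_]; last by rewrite collapse_lift.
by rewrite -collapse_merge ?collapse_lift // eq_sym neq_lift.
Qed.

Lemma expansion_sum_fil : expansion_sum f hs \in fil n.+3 #|per f|.
Proof.
apply: rpredZ; apply: rpred_sum => v /andP[vP bv].
apply: mem_lspan; constructor; first exact: good_expand_fun.
by rewrite card_per_expand_fun.
Qed.

End Branches.

Lemma expansion_sum_fil_gen k (f : {ffun 'I_k -> 'I_k}) (hs : seq ('I_k * V)) :
  good f hs -> expansion_sum f hs \in fil k.+1 #|per f|.
Proof.
case: k f hs => [|[|n]] f hs gf; last exact: expansion_sum_fil.
  by rewrite /expansion_sum big1 ?scaler0 ?rpred0 // => -[].
by case/and3P: gf => /forallP/(_ ord0); rewrite [f ord0]ord1.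
Qed.

Lemma hom_fil k m x : x \in fil k m -> hom x \in fil k.+1 m.
Proof.
apply: lspan_linear => _ [f hs gf fm].
rewrite /= hom_ugraph; last by case/and3P: gf.
exact/(fil_le fm)/expansion_sum_fil_gen.
Qed.

(** Before division, d h returns the graph once for each big vertex, and h d once for each fat
    vertex that is not big; [card_fat] adds these up to the denominator. *)
Lemma homotopy_formula n (f : {ffun 'I_n.+2 -> 'I_n.+2})
    (hs : seq ('I_n.+2 * V)) : [pchar F] =i pred0 -> good f hs ->
  boundary (hom (cls (ugraph f hs))) + hom (boundary (cls (ugraph f hs)))
    - (if fat f hs == set0 then 0 else cls (ugraph f hs))
  \in fil n.+2 #|per f|.-1.
Proof.
move=> F0 gf; have nf : nofix f by case/and3P: gf.
rewrite (hom_ugraph F2 _ nf) boundary_ugraph (eq_bigl predT) => [|i];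
  last first.
  exact: (forallP nf).
set X := cls (ugraph f hs); pose B v := (1 < branch f hs v)%N.
set a : F := #|fat f hs|%:R^-1.
pose D (v i : 'I_n.+2) : hairy V n.+2 := cls (ugraph (contract_fun (expand_fun
  f v) (lift0 i))
   (lmap (collapse (lift0 i) (expand_fun f v (lift0 i))) (lmap (evert v) hs))).
have -> : boundary (expansion_sum f hs) =
    a *: \sum_(v in per f | B v) (X - \sum_(i < n.+2) (-1) ^+ i *: D v i).
  rewrite linearZ linear_sum /=; congr (_ *: _).
  by apply: eq_bigr => v /andP[vP _]; rewrite boundary_expand.
(* [R1] and [R2] gather the contractions of cycle edges in d h and h d, which shorten the cycle.
   [S], the contractions off the cycle, occurs in both with opposite signs and cancels. *)
pose R1 := \sum_(v in per f | B v) \sum_(i in per f) (-1) ^+ i *: D v i.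
pose R2 := \sum_(i in per f) (-1) ^+ i *:
   hom (cls (ugraph (contract_fun f i) (lmap (collapse i (f i)) hs))).
pose S := \sum_(v in per f | B v) \sum_(i | i \notin per f) (-1) ^+ i *: D v i.
have cardN i : i \in per f -> #|per f :\ i| = #|per f|.-1.
  by move=> iP; rewrite (cardsD1 i (per f)) iP.
have R1fil : R1 \in fil n.+2 #|per f|.-1.
  apply: rpred_sum => v /andP[vP Bv]; apply: rpred_sum => i iP; apply: rpredZ.
  have := fil_contract_fun F2 (i := lift0 i) (f := expand_fun f v) _
    (good_expand_fun vP Bv gf).
  rewrite (_ : #|_ :\ _| = #|per f|.-1); first apply.
    exact: (forallP (expand_fun_nofix v nf)).
  by rewrite -(card_per_expand_fun vP) (cardsD1 (lift0 i) (per (expand_fun f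
    v))) per_expand_fun ?iP.
have R2fil : R2 \in fil n.+2 #|per f|.-1.
  apply: rpred_sum => i iP; apply: rpredZ; apply: hom_fil.
  by rewrite -(cardN i iP); apply: fil_contract_fun => //; apply: (forallP nf).
have -> : \sum_(v in per f | B v) (X - \sum_(i < n.+2) (-1) ^+ i *: D v i) =
    \sum_(v in per f | B v) X - (R1 + S).
  rewrite -big_split /= -sumrN -big_split /=; apply: eq_bigr => v _.
  by rewrite (bigID (mem (per f))).
(* The copies of the graph that h d produces by [contract_expand_kid]. *)
pose Y := \sum_(v in per f | ~~ B v) X *+ kids f v.
have -> : hom (\sum_(i < n.+2) (-1) ^+ i *: cls (ugraph (contract_fun f i)
  (lmap (collapse i (f i)) hs))) =
    R2 + a *: (S + Y).
  rewrite linear_sum (bigID (mem (per f))) /=; congr (_ + _).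
    by apply: eq_bigr => i _; rewrite linearZ.
  transitivity (\sum_(i | i \notin per f) a *: ((-1) ^+ i *:
      \sum_(v in per f | B v || (v == f i)) D v i)).
    apply: eq_bigr => i iP; rewrite linearZ /= hom_ugraph; last first.
      by apply: nofix_contract_fun => //; apply: (forallP nf).
    by rewrite expansion_sum_contract // [LHS]scalerA [RHS]scalerA mulrC.
  rewrite -scaler_sumr; congr (_ *: _).
  rewrite /S exchange_big /= /Y.
  have -> : \sum_(v in per f | ~~ B v) X *+ kids f v =
      \sum_(i | i \notin per f) \sum_(v in per f | ~~ B v && (v == f i)) X.
    rewrite (exchange_big_dep (fun v => (v \in per f) && ~~ B v)) /=;
      last first.
      by move=> i v _ /and3P[-> ->].
    apply: eq_bigr => v /andP[vP nB]; rewrite sumr_const; congr (_ *+ _).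
    apply: eq_card => i; rewrite !inE /kid vP nB eq_sym.
    by rewrite andbC.
  rewrite -big_split /=; apply: eq_bigr => i iP.
  rewrite (bigID B) /= scalerDr -scaler_sumr; congr (_ *: _ + _).
    by apply: eq_bigl => v; case: (B v); rewrite ?andbT ?andbF.
  rewrite scaler_sumr; apply: eq_big => [v|v /andP[/andP[vP Bv] nB]].
    by case: (B v); rewrite ?andbT ?andbF.
  rewrite (negbTE nB) /= in Bv; apply: contract_expand_kid => //.
    by rewrite (eqP Bv).
  by have := branch_gt0 gf vP; move: nB; rewrite /B; lia.
have <- : a *: \sum_(v in per f | B v) X + a *: Y =
    if fat f hs == set0 then 0 else X.
  have -> : \sum_(v in per f | B v) X = X *+ (\sum_(v in per f | B v) 1)%N.
    by rewrite -sumrMnr; apply: eq_bigr => v _.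
  rewrite /Y sumrMnr -scalerDr -mulrnDr -(card_fat gf) -scaler_nat scalerA.
  rewrite -cards_eq0; have [->|fat0] := eqVneq #|fat f hs| 0%N.
    by rewrite mulr0 scale0r.
  by rewrite mulVf ?scale1r // ((pcharf0P F).1 F0).
have -> : a *: (\sum_(v in per f | B v) X - (R1 + S)) + (R2 + a *: (S + Y)) -
    (a *: \sum_(v in per f | B v) X + a *: Y) = R2 - a *: R1.
  rewrite scalerBr !scalerDr; apply/eqP; rewrite subr_eq opprD !addrA.
  by rewrite (ACl (4*2*1*6*(3*5))) /= addNr addr0.
by rewrite rpredB ?rpredZ.
Qed.

End HomotopyFormula.

(** * Hedgehogs *)

Section Hedgehogs.
Variables (F : fieldType) (V : vectType F).
Hypothesis F2 : (2%:R : F) != 0.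

Implicit Types k n m : nat.
Local Notation cls := (pgen (@hgraph_rel F V _)).
Local Notation tens := (pgen (@multilinear F V _)).
Local Notation fil k m := (@filt F V k m).
Local Notation hom := (@homotopy F V F2 _).

Definition label k (hs : seq ('I_k * V)) : {ffun 'I_k -> V} :=
  [ffun i => \sum_(h <- hs | h.1 == i) h.2].

Definition simple k (hs : seq ('I_k * V)) :=
  perm_eq (map fst hs) (enum 'I_k).

Definition read k (hs : seq ('I_k * V)) : tensor_power V k :=
  if simple hs then tens (label hs) else 0.

Definition polygonal k (es : seq ('I_k * 'I_k)) :=
  perm_eq (map (@und k) es) (map (@und k) (fedges (@ordS k))).

Definition polysign k (es : seq ('I_k * 'I_k)) : F :=
  if polygonal es then sg F es * sg F (fedges (@ordS k)) else 0.

(* Summing over all renumberings of the vertices makes the reading of the     *)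
(* hair labels compatible with the relations.                                 *)
Definition hedgehog_gen k (X : hgraph V k) : tensor_power V k :=
  \sum_(s : 'S_k) ((-1) ^+ s * polysign (map (rel2 s) (edges X))) *:
                    read (lmap s (hairs X)).

Lemma polysign_perm k (es es' : seq ('I_k * 'I_k)) :
  perm_eq es es' -> polysign es = polysign es'.
Proof.
move=> ee; rewrite /polysign /polygonal /sg (perm_big _ ee).
by have /permPl -> := perm_map (@und k) ee.
Qed.

Lemma read_perm k (hs hs' : seq ('I_k * V)) :
  perm_eq hs hs' -> read hs = read hs'.
Proof.
move=> hh; rewrite /read /simple; have /permPl -> := perm_map fst hh.
have -> // : label hs = label hs'.
by apply/ffunP => i; rewrite !ffunE; apply: perm_big.
Qed.

Lemma label_cons k i w (hs : seq ('I_k * V)) : simple ((i, w) :: hs) ->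
  label ((i, w) :: hs) = ffupd (label hs) i w.
Proof.
move=> /perm_uniq; rewrite enum_uniq /= => /andP[ihs _].
apply/ffunP => j; rewrite !ffunE big_cons /= eq_sym; case: eqP => // ->.
rewrite big_seq_cond big1 ?addr0 // => h /andP[hhs /eqP hi].
by case/mapP: ihs; exists h.
Qed.

Lemma read_label k i a u v (hs : seq ('I_k * V)) :
  read ((i, a *: u + v) :: hs) = a *: read ((i, u) :: hs) + read ((i, v) :: hs).
Proof.
rewrite /read; case: ifP => shs; last first.
  by rewrite !ifF ?scaler0 ?addr0.
rewrite !ifT // !label_cons //.
exact: pgen_multilinear.
Qed.

Lemma rel2_comp k (s r : 'S_k) (es : seq ('I_k * 'I_k)) :
  map (rel2 s) (map (rel2 r) es) = map (rel2 (r * s)%g) es.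
Proof. by rewrite -map_comp; apply: eq_map => e; rewrite /rel2 /= !permM. Qed.

Lemma lmap_comp k (s r : 'S_k) (hs : seq ('I_k * V)) :
  lmap s (lmap r hs) = lmap (r * s)%g hs.
Proof. by rewrite /lmap -map_comp; apply: eq_map => h; rewrite /= !permM. Qed.

Lemma hedgehog_rel k r : hgraph_rel r -> fglift (@hedgehog_gen k) r = 0.
Proof.
case=> [X Y eXY hXY|s X|i j es hs|i a u v es hs].
- rewrite linearB /= !fgliftE; apply/eqP; rewrite subr_eq0; apply/eqP.
  apply: eq_bigr => s _; rewrite (polysign_perm (perm_map _ eXY)).
  by rewrite (read_perm (perm_map _ hXY)).
- rewrite linearB linearZ /= !fgliftE; apply/eqP; rewrite subr_eq0; apply/eqP.
  rewrite /hedgehog_gen [in RHS](reindex_inj (mulgI s)) scaler_sumr /=.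
  apply: eq_bigr => t _; rewrite scalerA -rel2_comp -lmap_comp; congr (_ *: _).
  rewrite odd_permM signr_addb !mulrA -signr_addb addbb mul1r //.
- rewrite linearD /= !fgliftE -big_split big1 //= => s _.
  rewrite -scalerDl -mulrDr.
  have -> : polysign (rel2 s (j, i) :: map (rel2 s) es) =
          - polysign (rel2 s (i, j) :: map (rel2 s) es).
    rewrite /polysign /polygonal /= -(und_flip (rel2 s (i, j))).
    case: ifP; rewrite ?oppr0 // => _; rewrite /sg !big_cons.
    by rewrite (sgn_flip F (rel2 s (i, j))) !mulNr.
  by rewrite addNr mulr0 scale0r.
- rewrite linearB linearP /= !fgliftE /=; apply/eqP; rewrite subr_eq0;
    apply/eqP.
  rewrite /hedgehog_gen scaler_sumr -big_split /=; apply: eq_bigr => s _.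
  by rewrite read_label scalerDr !scalerA mulrC.
Qed.

Definition hedgehog k : hairy V k -> tensor_power V k := plift (@hedgehog_rel
  k).

HB.instance Definition _ k := GRing.Linear.on (@hedgehog k).

Lemma hedgehogE k (X : hgraph V k) : hedgehog (cls X) = hedgehog_gen X.
Proof. exact: pliftE. Qed.

Lemma read_act k (g : glin V) (hs : seq ('I_k * V)) :
  read [seq (h.1, g h.2) | h <- hs] = glact (tensor_power V k) g (read hs).
Proof.
rewrite /read /simple -map_comp (eq_map (_ : fst \o _ =1 fst)) //.
case: ifP => _; last by rewrite linear0.
rewrite glact_tensorE; congr (tens _); apply/ffunP => i; rewrite !ffunE.
by rewrite big_map linear_sum.
Qed.

Lemma glact_hedgehog k g x :
  hedgehog (glact (hairy V k) g x) = glact (tensor_power V k) g (hedgehog x).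
Proof.
move: x; apply: (@pres_linear_eq _ _ _ _
  (hedgehog (k := k) \o glact (hairy V k) g)
  (glact (tensor_power V k) g \o hedgehog (k := k))) => X.
transitivity (hedgehog (glact (hairy V k) g (cls X))) => //.
rewrite glact_hairyE hedgehogE.
transitivity (glact (tensor_power V k) g (hedgehog (cls X))) => //.
rewrite hedgehogE linear_sum; apply: eq_bigr => s _.
rewrite linearZ /= -read_act; congr (_ *: read _).
by rewrite /lmap -!map_comp.
Qed.

Definition std_hairs k (t : 'I_k -> V) := [seq (i, t i) | i <- enum 'I_k].

Lemma std_hairs_upd k (t : {ffun 'I_k -> V}) i w :
  perm_eq (std_hairs (ffupd t i w))
          ((i, w) :: [seq (j, t j) | j <- rem i (enum 'I_k)]).
Proof.
rewrite /std_hairs; have iE : i \in enum 'I_k by rewrite mem_enum.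
have /permPl -> := perm_map (fun j => (j, ffupd t i w j)) (perm_to_rem iE).
rewrite /= ffunE eqxx perm_cons.
rewrite (_ : map _ _ = [seq (j, t j) | j <- rem i (enum 'I_k)]) //.
apply/eq_in_map => j; rewrite mem_rem_uniq ?enum_uniq // inE => /andP[ji _].
by rewrite ffunE (negbTE ji).
Qed.

Definition std_gen k (t : {ffun 'I_k -> V}) : hairy V k :=
  cls (ugraph (@ordS k) (std_hairs t)).

Lemma std_rel k r : multilinear r -> fglift (@std_gen k) r = 0.
Proof.
case=> t i a u v; rewrite linearB linearP /= !fgliftE.
have gE w : std_gen (ffupd t i w) = cls (ugraph (@ordS k)
    ((i, w) :: [seq (j, t j) | j <- rem i (enum 'I_k)])).
  by apply: cls_list => //=; apply: std_hairs_upd.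
by rewrite !gE cls_label subrr.
Qed.

Definition std k : tensor_power V k -> hairy V k := plift (@std_rel k).

HB.instance Definition _ k := GRing.Linear.on (@std k).

Lemma stdE k (t : {ffun 'I_k -> V}) :
  std (tens t) = cls (ugraph (@ordS k) (std_hairs t)).
Proof. exact: pliftE. Qed.

Lemma std_hairs_label k (hs : seq ('I_k * V)) :
  simple hs -> perm_eq (std_hairs (label hs)) hs.
Proof.
move=> shs; rewrite perm_sym.
have uhs : uniq (map fst hs) by rewrite (perm_uniq shs) enum_uniq.
have lE h : h \in hs -> (h.1, label hs h.1) = h.
  move=> hhs; rewrite ffunE (big_rem h hhs) /= eqxx big_seq_cond big1 ?addr0.
    by case: h hhs.
  move=> h' /andP[h'hs /eqP e].
  have := perm_uniq (perm_map fst (perm_to_rem hhs)).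
  by rewrite uhs /= -e => /esym/andP[/negP[]]; apply: map_f.
have hsE : hs = [seq (j, label hs j) | j <- map fst hs].
  rewrite -map_comp -[LHS]map_id; apply/eq_in_map => h hhs.
  by rewrite /= lE.
by rewrite {1}hsE; apply: perm_map.
Qed.

Definition edeg k (es : seq ('I_k * 'I_k)) v :=
  (count (fun e => e.1 == v) es + count (fun e => e.2 == v) es)%N.

Lemma valenceE k (X : hgraph V k) v :
  valence X v = (edeg (edges X) v + nhairs (hairs X) v)%N.
Proof. by []. Qed.

Lemma edeg_und k (es es' : seq ('I_k * 'I_k)) v :
  perm_eq (map (@und k) es) (map (@und k) es') -> edeg es v = edeg es' v.
Proof.
have undE (t : seq ('I_k * 'I_k)) : edeg t v = edeg (map (@und k) t) v.
  elim: t => //= e t; rewrite /edeg /= => IHt.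
  rewrite addnACA IHt [RHS]addnACA; congr (_ + _)%N.
  by rewrite /und; case: ifP => //= _; rewrite addnC.
by move=> uu; rewrite undE [RHS]undE /edeg !(seq.permP uu).
Qed.

Lemma edeg_rel2 k (s : 'S_k) (es : seq ('I_k * 'I_k)) v :
  edeg (map (rel2 s) es) (s v) = edeg es v.
Proof.
rewrite /edeg !count_map; congr (_ + _)%N; apply: eq_count => e /=;
  by rewrite (inj_eq perm_inj).
Qed.

Lemma npre_inj k (f : 'I_k -> 'I_k) v : injective f -> npre f v = 1%N.
Proof.
move=> finj; rewrite /npre -(card1 (invF finj v)); apply: eq_card => u.
by rewrite !inE -[RHS](inj_eq finj) f_invF.
Qed.

Lemma ordS_inj k : injective (@ordS k).
Proof. by apply: can_inj; apply: ordSK. Qed.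

Lemma edeg_fedges k (f : 'I_k -> 'I_k) v : edeg (fedges f) v = (npre f v).+1.
Proof.
have := @valence_ugraph F V k f [::] v.
by rewrite valenceE /edges /hairs /= /nhairs /= !addn0.
Qed.

Lemma nhairs_simple k (hs : seq ('I_k * V)) v : simple hs -> nhairs hs v = 1%N.
Proof.
move=> shs; rewrite /nhairs -(count_map fst (pred1 v)) (seq.permP shs).
by rewrite count_uniq_mem ?enum_uniq ?mem_enum.
Qed.

(** A nonzero value requires some renumbering onto the polygon with one hair per vertex. This serves
    as a vanishing criterion below. *)
Lemma hedgehog_shape k (X : hgraph V k) v : hedgehog (cls X) != 0 ->
  edeg (edges X) v = 2%N /\ nhairs (hairs X) v = 1%N.
Proof.
rewrite hedgehogE => X0.
have [/existsP[s /andP[ps ss]]|/existsPn none] := boolP [exists s : 'S_k,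
    polygonal (map (rel2 s) (edges X)) && simple (lmap s (hairs X))].
  rewrite -(edeg_rel2 s) (edeg_und _ ps) edeg_fedges npre_inj;
    last exact: ordS_inj.
  by rewrite -(nhairs_lmap s) nhairs_simple.
case/eqP: X0; apply: big1 => s _; have := none s; rewrite negb_and.
case/orP=> /negbTE sE; first by rewrite /polysign sE mulr0 scale0r.
by rewrite /read sE scaler0.
Qed.

(** A merged vertex has valence at least 3 + 3 - 2 = 4, whereas the vertices of a hedgehog are
    trivalent. *)
Lemma hedgehog_boundary n m x :
  x \in fil n.+2 m -> hedgehog (boundary x) = 0.
Proof.
suff H : forall y : hairy V n.+2, fil_gen m y -> hedgehog (boundary y) = 0.
  move=> /lspanP[s Ss ->]; rewrite !linear_sum big_seq big1 // => p /Ss/H e.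
  by rewrite !linearZ /= e scaler0.
move=> _ [f hs gf _]; rewrite boundary_ugraph linear_sum big1 //= => i fi.
rewrite linearZ /=; apply/eqP; rewrite scaler_eq0; apply/orP; right.
apply: contraTT isT => /(hedgehog_shape (collapse i (f i) i)) [e2 n1].
case/and3P: gf => _ /forallP adm _.
have := @valence_contract _ _ _ f hs i fi (collapse i (f i) i).
rewrite valenceE e2 n1 -collapse_merge // lift_coll // eqxx.
by have := adm i; have := adm (f i); lia.
Qed.

(** The expanded vertex has given all its hairs to the new one. *)
Lemma hedgehog_expansion_sum k (f : {ffun 'I_k -> 'I_k}) hs : hedgehog
  (expansion_sum f hs) = 0.
Proof.
rewrite linearZ linear_sum big1 => [|v _]; first exact: scaler0.
apply/eqP.
apply: contraTT isT => /(hedgehog_shape (fintype.lift ord0 v)) [_].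
by rewrite /= nhairs_old eqxx.
Qed.

Lemma hedgehog_hom k m x : x \in fil k m -> hedgehog (hom x) = 0.
Proof.
suff H : forall y : hairy V k, fil_gen m y -> hedgehog (hom y) = 0.
  move=> /lspanP[s Ss ->]; rewrite !linear_sum big_seq big1 // => p /Ss/H e.
  by rewrite !linearZ /= e scaler0.
move=> _ [f hs /and3P[nf _ _] _].
by rewrite hom_ugraph // hedgehog_expansion_sum.
Qed.

Lemma hedgehog_fat k (f : 'I_k -> 'I_k) hs :
  hedgehog (cls (ugraph f hs)) != 0 -> fat f hs = set0.
Proof.
move=> h0; have pre1 v : npre f v = 1%N.
  by have [] := hedgehog_shape v h0; rewrite edeg_fedges => -[].
have finj : injective f.
  move=> u w fuw; have /eqP/card1P[z zE] := pre1 (f u).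
  by have := zE u; have := zE w; rewrite !inE fuw eqxx => /esym/eqP-> /esym/eqP.
apply/setP => v; rewrite !inE (inj_per finj) inE /=; apply/negbTE;
  rewrite negbK.
have [_ /= ->] := hedgehog_shape v h0.
have := @npre_per _ f v; rewrite (inj_per finj) inE pre1 => /(_ isT) [<-].
by [].
Qed.

Section FatFree.
Variables (k : nat) (f : {ffun 'I_k -> 'I_k}) (hs : seq ('I_k * V)).
Hypotheses (gf : good f hs) (fat0 : fat f hs = set0).

Let thin v : v \in per f -> kids f v = 0%N /\ nhairs hs v = 1%N.
Proof.
move=> vP; have : v \notin fat f hs by rewrite fat0 inE.
by rewrite inE vP negbK => /andP[/eqP -> /eqP ->].
Qed.

(** A thin vertex has no kids, so no arrow enters the cycle from outside; a nonempty complement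
    would be stable and hence meet [per f]. *)
Lemma fatfree_per : per f = setT.
Proof.
apply/eqP; rewrite eqEsubset subsetT /=; apply/subsetP => u _.
apply: contraTT isT => uP.
have [||y] := @per_meets _ f (~: per f) u; rewrite ?inE //; last first.
  by move=> /negP.
move=> y; rewrite !inE => yP; apply/negP => fyP.
have [/eqP + _] := thin fyP; rewrite -leqn0 leqNgt => /negP; apply.
by apply/card_gt0P; exists y; rewrite inE /kid eqxx.
Qed.

Lemma fatfree_inj : injective f.
Proof. by move=> u w; apply: per_inj; rewrite fatfree_per. Qed.

Lemma fatfree_simple : simple hs.
Proof.
apply/allP => v _; apply/eqP; rewrite count_map.
have vP : v \in per f by rewrite fatfree_per inE.
have [_ /= h1] := thin vP; rewrite -[LHS]/(nhairs hs v) h1.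
by rewrite count_uniq_mem ?enum_uniq ?mem_enum.
Qed.

(** By connectedness the permutation [f] is a single cycle, and [s] numbers the vertices along the
    orbit of [x0]. *)
Lemma fatfree_conj : exists s : 'S_k, forall u, ordS (s u) = s (f u).
Proof.
have [k0|k_gt0] := posnP k.
  by exists 1%g => u; have := ltn_ord u; rewrite [X in (_ < X)%N]k0.
pose x0 := Ordinal k_gt0.
have fx u : fconnect f x0 u.
  have /forallP/(_ x0)/forallP/(_ u) : conn f by case/and3P: gf.
  apply: (@connect_homo _ _ (fadj f) _ id) => x y /orP[]/eqP <-.
    exact: fconnect1.
  by rewrite fconnect_sym ?fconnect1 //; apply: fatfree_inj.
have ordk : fingraph.order f x0 = k.
  by rewrite -[RHS]card_ord; apply: eq_card => u; rewrite !inE; apply: fx.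
have lt u : (findex f x0 u < k)%N by rewrite -[X in (_ < X)%N]ordk findex_max.
have s_inj : injective (fun u => Ordinal (lt u)).
  by move=> u w [] e; rewrite -(iter_findex (fx u)) -(iter_findex (fx w)) e.
exists (perm s_inj) => u; rewrite !permE; apply: val_inj => /=.
set j := findex f x0 u; have uE : u = iter j f x0 by rewrite iter_findex.
have [jk|jk] := ltnP j.+1 k.
  by rewrite modn_small // uE -iterS findex_iter ?ordk.
have jkE : j.+1 = k by apply/eqP; rewrite eqn_leq jk andbT; apply: lt.
rewrite jkE modnn uE -iterS jkE -[X in iter X]ordk iter_order;
  last exact: fatfree_inj.
by rewrite findex0.
Qed.

End FatFree.

(** The order of the dihedral group when k >= 3. *)
Definition poly_stab k := #|[pred s : 'S_k | polygonal (map (rel2 s) (fedges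
  (@ordS k)))]|.

(** The renumberings that carry the graph to the standard polygon form a coset of the polygon's
    stabilizer, and each contributes the graph itself: its sign is undone by the relations. *)
Lemma std_hedgehog_ugraph k (f : 'I_k -> 'I_k) hs (s0 : 'S_k) :
  (forall u, ordS (s0 u) = s0 (f u)) -> simple hs ->
  std (hedgehog (cls (ugraph f hs))) = (poly_stab k)%:R *: cls (ugraph f hs).
Proof.
move=> s0f shs; set X := ugraph f hs.
rewrite hedgehogE linear_sum /=.
have readE (s : 'S_k) : std (read (lmap s hs)) = cls (ugraph (@ordS k) (lmap s
  hs)).
  have sshs : simple (lmap s hs).
    rewrite /simple -map_comp (map_comp s fst).
    apply: perm_trans (perm_map_perm s); exact: perm_map.
  rewrite /read sshs stdE; apply: cls_list => //=; exact: std_hairs_label.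
transitivity (\sum_(s : 'S_k | polygonal (map (rel2 s) (edges X))) cls X).
  rewrite [RHS]big_mkcond; apply: eq_bigr => s _; rewrite linearZ /= readE.
  rewrite /polysign; case: ifP => ps; last by rewrite mulr0 scale0r.
  rewrite -scalerA -(cls_same F2 _ ps).
  rewrite -[(map _ _, _)]/(relabel s X) cls_vertices scalerA.
  by rewrite -signr_addb addbb scale1r.
rewrite sumr_const scaler_nat; congr (_ *+ _).
rewrite /poly_stab -[RHS](card_image (mulgI s0)); apply: eq_card => s.
have s0E : perm_eq (map (rel2 s0) (fedges f)) (fedges (@ordS k)).
  rewrite /fedges -map_comp (eq_map (_ : _ =1 (fun j => (j, ordS j)) \o s0)).
    by rewrite map_comp; apply/perm_map/perm_map_perm.
  by move=> u /=; rewrite /rel2 /= s0f.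
have polygonalE es es' : perm_eq es es' -> polygonal es = @polygonal k es'.
  by move=> ee; rewrite /polygonal; have /permPl -> := perm_map (@und k) ee.
rewrite -[s](mulKVg s0) (mem_image (mulgI s0)); set t := (_ * s)%g.
rewrite -[LHS]/(polygonal (map (rel2 (s0 * t)%g) (fedges f))) -rel2_comp.
exact/polygonalE/perm_map.
Qed.

Lemma poly_stab_gt0 k : (0 < poly_stab k)%N.
Proof.
apply/card_gt0P; exists 1%g; rewrite inE /polygonal.
rewrite (eq_map (_ : rel2 (1%g : 'S_k) =1 id)) ?map_id // => -[i j].
by rewrite /rel2 /= !perm1.
Qed.

End Hedgehogs.

(** * Homology in terms of hedgehogs *)

Section Exactness.
Variables (F : fieldType) (V : vectType F).
Hypothesis F0 : [pchar F] =i pred0.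

Implicit Types k n m : nat.
Local Notation cls := (pgen (@hgraph_rel F V _)).
Local Notation fil k m := (@filt F V k m).

Lemma char0_neq0 (a : nat) : (0 < a)%N -> (a%:R : F) != 0.
Proof. by rewrite ((pcharf0P F).1 F0) -lt0n. Qed.

Let F2 : (2%:R : F) != 0 := char0_neq0 (isT : 0 < 2)%N.

Local Notation hom := (@homotopy F V F2 _).

Lemma std_hedgehog_good k (f : {ffun 'I_k -> 'I_k}) hs : good f hs ->
  (poly_stab k)%:R^-1 *: std (hedgehog (cls (ugraph f hs))) =
  if fat f hs == set0 then cls (ugraph f hs) else 0.
Proof.
move=> gf; have [f0|f1] := eqVneq.
  have [s0 s0f] := fatfree_conj gf f0.
  rewrite (std_hedgehog_ugraph F2 s0f (fatfree_simple f0)) scalerA.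
  by rewrite mulVf ?scale1r // char0_neq0 ?poly_stab_gt0.
have [->|h0] := eqVneq (hedgehog (cls (ugraph f hs))) 0.
  by rewrite linear0 scaler0.
by case/eqP: f1; apply: hedgehog_fat h0.
Qed.

Lemma homotopy_fil n m x : x \in fil n.+2 m ->
  (boundary (hom x) + hom (boundary x)) -
     (x - (poly_stab n.+2)%:R^-1 *: std (hedgehog x)) \in fil n.+2 m.-1.
Proof.
set a := _^-1.
pose h : {linear hairy V n.+2 -> hairy V n.+2} :=
  (((@boundary F V n.+3 \o @homotopy F V F2 n.+2)
   \+ (@homotopy F V F2 n.+1 \o @boundary F V n.+2))
  \- (idfun \- (a \*: (@std F V n.+2 \o @hedgehog F V n.+2))))%R.
apply: (@lspan_linear _ _ _ h) => _ [f hs gf fm].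
have /fil_le H : (#|per f|.-1 <= m.-1)%N by lia.
apply: H; rewrite /h /=.
have := homotopy_formula F2 F0 gf; rewrite std_hedgehog_good //.
by case: ifP => _; rewrite ?subrr ?subr0.
Qed.

Lemma boundary_sq n m x : x \in fil n.+3 m -> boundary (boundary x) = 0.
Proof.
suff H : forall y : hairy V n.+3, fil_gen m y -> boundary (boundary y) = 0.
  move=> /lspanP[s Ss ->]; rewrite !linear_sum big_seq big1 // => p /Ss/H e.
  by rewrite !linearZ /= e scaler0.
by move=> _ [f hs _ _]; apply: boundary_sq_ugraph.
Qed.

Lemma fil0 n x : x \in fil n.+2 0 -> x = 0.
Proof.
suff H : forall y : hairy V n.+2, fil_gen 0 y -> y = 0.
  by move=> /lspanP[s Ss ->]; rewrite big_seq big1 // => p /Ss/H ->;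
    rewrite scaler0.
move=> _ [f hs gf]; rewrite leqn0 cards_eq0 => /eqP per0.
have [||y _] := @per_meets _ f setT ord0; first by rewrite inE.
  by move=> y _; rewrite inE.
by rewrite per0 inE.
Qed.

(** Induction on the length of the cycle: by [homotopy_fil] the cycle [boundary (hom x) - x] lies
    one step lower, hence is a boundary. The control on [hedgehog y] is used again in
    [lift_to_cycle]. *)
Lemma exactness n m x : x \in fil n.+2 m -> boundary x = 0 -> hedgehog x = 0 ->
  exists2 y, y \in fil n.+3 m & x = boundary y /\ hedgehog y = 0.
Proof.
elim: m x => [|m IHm] x xF dx hx.
  by exists 0; rewrite ?rpred0 // !linear0 (fil0 xF).
have std0 : std (hedgehog x) = 0 by rewrite hx; apply: linear0.
have hom0 : hom (boundary x) = 0 by rewrite dx; apply: linear0.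
have := homotopy_fil xF; rewrite std0 hom0 scaler0 subr0 addr0.
set z := boundary (hom x) - x => zF.
have homF : hom x \in fil n.+3 m.+1 by apply: hom_fil.
have [||y yF [zy hy]] := IHm z zF.
- by rewrite linearB /= dx subr0; apply: boundary_sq homF.
- by rewrite linearB /= hx subr0; apply: hedgehog_boundary homF.
exists (hom x - y); first by rewrite rpredB // (fil_le (leqnSn m)).
split; first by rewrite linearB /= -zy /z opprB addrC subrK.
by rewrite linearB /= hy (hedgehog_hom _ xF) subr0.
Qed.

End Exactness.

(** * Orienting a unicyclic graph as a self-map *)

Section Orientation.
Variable k : nat.
Implicit Types (es : seq ('I_k * 'I_k)) (A : {set 'I_k}) (f : 'I_k -> 'I_k).

Definition eadj es : rel 'I_k := fun u v => ((u, v) \in es) || ((v, u) \in es).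

Lemma eadj_sym es : connect_sym (eadj es).
Proof. by apply: sym_connect_sym => u v; rewrite /eadj orbC. Qed.

Definition tree_edges f A := [seq (v, f v) | v <- enum (~: A)].

Lemma und_ends (e e' : 'I_k * 'I_k) : und e = und e' ->
  (e'.1 = e.1 /\ e'.2 = e.2) \/ (e'.1 = e.2 /\ e'.2 = e.1).
Proof. by move/und_eq => [->|->]; auto. Qed.

Lemma und_und (e : 'I_k * 'I_k) : und (und e) = und e.
Proof. by rewrite {2}/und; case: ifP => // _; rewrite und_flip. Qed.

(** A spanning forest rooted at [A], by induction on the complement: connectedness provides an edge
    from some [u] in [A] to some [v] outside, and [v] is sent to [u] after a forest rooted at
    [v |: A] is found. *)
Lemma tree_orientation es A : A != set0 ->
    (forall u v, connect (eadj es) u v) ->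
  exists f rest,
    perm_eq (map (@und k) es) (map (@und k) (tree_edges f A) ++ rest) /\
    forall v, exists2 a, a \in A & connect (eadj (tree_edges f A)) v a.
Proof.
move=> A0 ces; have [n] := ubnP #|~: A|; elim: n A A0 => // n IHn A A0 An.
have [a aA] := set0Pn _ A0.
have [A1|/set0Pn[w]] := eqVneq (~: A) set0.
  exists id, (map (@und k) es); rewrite /tree_edges A1 enum_set0 /=;
    split=> // v.
  by exists v => //; rewrite -[A]setCK A1 !inE.
rewrite inE => wA.
have [/existsP[u /existsP[v /and3P[uA vA uv]]]|none] :=
    boolP [exists u, exists v, [&& u \in A, v \notin A & eadj es u v]];
      last first.
  have cA : closed (eadj es) (mem A).
    apply: intro_closed; first exact: eadj_sym.
    move=> u v uv uA; apply: contraNT none => vA; apply/existsP; exists u.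
    by apply/existsP; exists v; rewrite uA vA uv.
  have : (a \in A) = (w \in A) := closed_connect cA (ces a w).
  by rewrite aA (negbTE wA).
have [||f0 [rest0 [esE con]]] := IHn (v |: A).
- by apply/set0Pn; exists v; rewrite !inE eqxx.
- move: An; rewrite (cardsD1 v (~: A)) inE vA add1n ltnS; apply: leq_trans.
  rewrite ltnS leq_eqVlt; apply/orP; left; apply/eqP; apply: eq_card => x.
  by rewrite !inE negb_or.
pose f x := if x == v then u else f0 x.
have enumE : perm_eq (enum (~: A)) (v :: enum (~: (v |: A))).
  apply: uniq_perm; rewrite ?enum_uniq //=.
    by rewrite mem_enum !inE eqxx /= enum_uniq.
  move=> x; rewrite inE !mem_enum !inE negb_or.
  by have [->|] := eqVneq x v; rewrite ?vA.
have treeE : perm_eq (tree_edges f A) ((v, u) :: tree_edges f0 (v |: A)).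
  rewrite /tree_edges; have /permPl -> := perm_map (fun x => (x, f x)) enumE.
  rewrite /= {1}/f eqxx perm_cons.
  rewrite (_ : map _ _ = [seq (x, f0 x) | x <- enum (~: (v |: A))]) //.
  apply/eq_in_map => x; rewrite mem_enum !inE negb_or /f.
  by case/andP=> /negbTE ->.
have vu_rest : und (v, u) \in rest0.
  have : und (v, u) \in map (@und k) es.
    case/orP: uv => [uv|vu]; last exact: map_f.
    by rewrite -und_flip map_f.
  rewrite (perm_mem esE) mem_cat => /orP[|//].
  case/mapP=> e /mapP[x]; rewrite mem_enum !inE negb_or => /andP[xv xA] ->.
  case/und_ends=> -[/= ex _]; first by rewrite ex eqxx in xv.
  by rewrite ex uA in xA.
exists f, (rem (und (v, u)) rest0); split.
  apply: perm_trans esE _.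
  have /permPr -> : perm_eq (map (@und k) (tree_edges f A) ++ rem (und (v, u))
    rest0)
     (und (v, u) :: map (@und k) (tree_edges f0 (v |: A)) ++ rem (und (v, u))
       rest0).
    by rewrite -cat_cons perm_cat2r; apply: (perm_map _ treeE).
  have /permPl -> : perm_eq (map (@und k) (tree_edges f0 (v |: A)) ++ rest0)
      (map (@und k) (tree_edges f0 (v |: A)) ++ und (v, u) :: rem (und (v, u))
        rest0).
    by rewrite perm_cat2l perm_to_rem.
  by rewrite -cat1s perm_catCA.
have sub x y : connect (eadj (tree_edges f0 (v |: A))) x y ->
               connect (eadj (tree_edges f A)) x y.
  apply: connect_sub => a' b' ab; apply: connect1; move: ab.
  by rewrite /eadj !(perm_mem treeE) !inE => /orP[] ->; rewrite ?orbT.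
move=> x; have [b] := con x; rewrite !inE => /orP[/eqP ->|bA] /sub xb.
  exists u => //; apply: connect_trans xb (connect1 _).
  by rewrite /eadj (perm_mem treeE) inE eqxx.
by exists b.
Qed.

Lemma tree_orientation1 es a : (forall u v, connect (eadj es) u v) ->
  exists f rest,
    perm_eq (map (@und k) es) (map (@und k) (tree_edges f [set a]) ++ rest) /\
    forall u v, connect (eadj (tree_edges f [set a])) u v.
Proof.
move=> ces; have [|f [rest [esE con]]] := @tree_orientation es [set a] _ ces.
  by apply/set0Pn; exists a; rewrite inE.
exists f, rest; split=> // u v.
have toa w : connect (eadj (tree_edges f [set a])) w a.
  by have [b /set1P ->] := con w.
by apply: connect_trans (toa u) _; rewrite eadj_sym.
Qed.

Lemma unicyclic_orientation es : size es = k ->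
    (0 < k)%N -> (forall u v, connect (eadj es) u v) ->
  exists f, perm_eq (map (@und k) es) (map (@und k) (fedges f)).
Proof.
move=> ks k0 ces.
have [f [rest [esE con]]] := tree_orientation1 (Ordinal k0) ces.
have : size rest = 1%N.
  move: (perm_size esE); rewrite size_cat !size_map -cardE cardsC1 card_ord ks.
  by rewrite -{1}(prednK k0) -addn1 => /addnI <-.
case: rest esE => [|e [|//]] // esE _.
have ee : und e = e.
  have : e \in map (@und k) es by rewrite (perm_mem esE) mem_cat mem_head orbT.
  by case/mapP=> e' _ ->; rewrite und_und.
(* The tree is rooted anew at an end of the one edge left over; this root, the only vertex without
   an outgoing edge, then receives that edge. *)
have [g [rest [treeE _]]] := tree_orientation1 e.1 con.
have : size rest = 0%N.
  move: (perm_size treeE); rewrite size_cat !size_map -!cardE !cardsC1 card_ord.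
  by rewrite -{1}[k.-1]addn0 => /addnI <-.
move/size0nil => r0; rewrite {rest}r0 cats0 in treeE.
exists (fun v => if v == e.1 then e.2 else g v).
apply: perm_trans esE _; rewrite perm_catC /=.
set h := fun v => _.
have enumE : perm_eq (enum 'I_k) (e.1 :: enum (~: [set e.1])).
  apply: uniq_perm; rewrite ?enum_uniq //=.
    by rewrite mem_enum !inE eqxx enum_uniq.
  by move=> x; rewrite inE !mem_enum !inE orbN.
have /permPr -> := perm_map (@und k) (perm_map (fun v => (v, h v)) enumE).
rewrite /= {1}/h eqxx -surjective_pairing ee perm_cons.
apply: perm_trans treeE _; rewrite (_ : map _ (map _ _) = map (@und k)
  (tree_edges g [set e.1])) //.
congr (map _ _); apply/eq_in_map => x; rewrite mem_enum !inE /h.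
by move=> /negbTE ->.
Qed.

End Orientation.

(** * The chains are spanned by good graphs of self-maps *)

Section LoopGraphs.
Variables (F : fieldType) (V : vectType F).
Hypothesis F0 : [pchar F] =i pred0.
Implicit Types k n m : nat.
Local Notation cls := (pgen (@hgraph_rel F V _)).
Local Notation fil k m := (@filt F V k m).

Lemma components1 k (X : hgraph V k) : components X = 1%N <->
  (0 < k)%N /\ forall u v, connect (adj X) u v.
Proof.
have sX : connect_sym (adj X) := eadj_sym (edges X).
split=> [c1|[k0 con]].
  split.
    case: k X sX c1 => // X _; rewrite /components /n_comp_mem.
    by rewrite eq_card0 // => -[].
  move/eqP/card1P: c1 => [r rE] u v.
  have rootE w : fingraph.root (adj X) w = r.
    suff : fingraph.root (adj X) w \in pred1 r by rewrite inE => /eqP.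
    by rewrite -rE; apply/andP; split=> //; apply: roots_root.
  by rewrite -root_connect // !rootE.
rewrite /components -[RHS](n_comp_connect sX (Ordinal k0)).
by apply: eq_n_comp_r => v; rewrite !inE con.
Qed.

Lemma good_loop_graph k (f : 'I_k -> 'I_k) hs : (0 < k)%N ->
  good f hs -> loop_graph (cls (ugraph f hs)).
Proof.
move=> k0 /and3P[nf adm /forallP cf].
have c1 : components (ugraph f hs) = 1%N.
  apply/components1; split=> // u v.
  apply: (@connect_homo _ _ (fadj f) _ id) (forallP (cf u) v) => a b ab.
  apply: connect1; rewrite /adj /edges /=.
  by case/orP: ab => /eqP <-; rewrite (map_f (fun i => (i, f i))) ?mem_enum
    ?orbT.
constructor=> //; rewrite /betti1 c1 size_map size_enum_ord; lia.
Qed.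

(** Betti number 1 and connectedness give as many edges as vertices, so [unicyclic_orientation]
    applies; a graph with a loop has class 0. *)
Lemma loop_graph_fil k (x : hairy V k) : loop_graph x -> x \in fil k k.
Proof.
have F2 : (2%:R : F) != 0 by apply: char0_neq0.
case=> X adm c1; rewrite /betti1 c1 => b1.
have [k0 con] := (components1 X).1 c1.
have [|f XF] := @unicyclic_orientation k (edges X) _ k0 con.
  by move: b1; lia.
have [nl|nl] := boolP (all (fun e => e.1 != e.2) (edges X)); last first.
  by case: X XF nl {adm c1 b1 con} => es hs _ nl;
    rewrite cls_und // (sg_loop F nl) scale0r rpred0.
have -> : cls X = (sg F (edges X) * sg F (fedges f)) *: cls (ugraph f (hairs
  X)).
  by case: X XF {adm c1 b1 con nl} => es hs; apply: cls_same.
rewrite rpredZ // (eq_ugraph _ (_ : f =1 finfun f)); last by move=> v;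
  rewrite ffunE.
apply: mem_lspan; constructor; last first.
  by rewrite -[X in (_ <= X)%N]card_ord max_card.
have gE : finfun f =1 f by move=> v; rewrite ffunE.
rewrite /good; apply/and3P; split.
- by rewrite -nofixE /fedges (eq_map (_ : _ =1 (fun i => (i, f i)))) => [|v];
    rewrite ?ffunE // -(all_loopless_und XF).
- apply/forallP => v; have := forallP adm v; rewrite !valenceE.
  rewrite (edeg_und _ XF) /ugraph /= /edges /fedges /=.
  by rewrite (eq_map (_ : (fun i => (i, finfun f i)) =1 (fun i => (i, f i))))
    // => w;
    rewrite ffunE.
apply/forallP => u; apply/forallP => v.
apply: (@connect_homo _ _ (adj X) _ id) (con u v) => a b ab.
have [w wE] : exists w, und (a, b) = und (w, f w).
  have : und (a, b) \in map (@und k) (edges X).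
    by case/orP: ab => ab; [apply: map_f|rewrite -(und_flip (a, b));
      apply: map_f].
  by rewrite (perm_mem XF) => /mapP[e /mapP[w _ ->] ->]; exists w.
apply: connect1; rewrite /fadj !gE.
by have [[/= <- <-]|[/= <- <-]] := und_ends wE; rewrite eqxx ?orbT.
Qed.

Lemma chains1_fil k x : (x \in @chains1 F V k.+1) = (x \in fil k.+1 k.+1).
Proof.
apply/idP/idP => /lspanP[s Ss ->]; rewrite big_seq;
  apply: rpred_sum => p /Ss pS; apply: rpredZ.
  exact: loop_graph_fil.
by case: pS => f hs gf _; apply: mem_lspan; apply: good_loop_graph.
Qed.

Lemma fil1 m x : x \in fil 1 m -> x = 0.
Proof.
move=> /lspanP[s Ss ->]; rewrite big_seq big1 // => p /Ss[f hs
  /and3P[/forallP/(_ ord0)]].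
by rewrite [f ord0]ord1.
Qed.

End LoopGraphs.

Lemma pres_span (F : fieldType) (K : choiceType) (S : {freeg K / F} -> Prop)
  (x : pres S) : x \in lspan (fun y => exists z, y = pgen S z).
Proof.
rewrite -[x]qreprK -[qrepr x]freeg_sumE linear_sum; apply: rpred_sum => z _.
have -> : << coeff z (qrepr x) *g z >> = coeff z (qrepr x) *: <<z>> :> {freeg K
  / F}.
  by apply/eqP/freeg_eqP => u; rewrite coeffZ !coeffU mul1r.
by rewrite linearZ rpredZ // mem_lspan //; exists z.
Qed.

Lemma lspan_eq (F : fieldType) (L M : lmodType F) (h h' : {linear L -> M})
    (S : L -> Prop) :
  (forall x, S x -> h x = h' x) -> forall x, x \in lspan S -> h x = h' x.
Proof.
move=> hh' x /lspanP[s Ss ->]; rewrite !linear_sum !big_seq.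
by apply: eq_bigr => p /Ss/hh' hp; rewrite !linearZ /= hp.
Qed.

(** * Homology as the image of [hedgehog] after [std] *)

Section HomologyIso.
Variables (F : fieldType) (V : vectType F).
Hypothesis F0 : [pchar F] =i pred0.
Implicit Types k n m : nat.
Local Notation fil k m := (@filt F V k m).
Let F2 : (2%:R : F) != 0 := char0_neq0 F0 (isT : 0 < 2)%N.

Lemma boundary_fil n m x : x \in fil n.+2 m -> boundary x \in fil n.+1 m.
Proof.
apply: lspan_linear => _ [f hs gf fm] /=.
rewrite boundary_ugraph; apply: rpred_sum => i fi; apply: rpredZ.
have /fil_le : (#|per f :\ i| <= m)%N.
  by apply: leq_trans fm; apply/subset_leq_card/subD1set.
by apply; apply: fil_contract_fun.
Qed.

Lemma good_polygon n (t : {ffun 'I_n.+2 -> V}) :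
  good (finfun (@ordS n.+2)) (std_hairs t).
Proof.
have fE u : finfun (@ordS n.+2) u = ordS u by rewrite ffunE.
have pol_inj : injective (finfun (@ordS n.+2)).
  by move=> u v; rewrite !fE; apply: ordS_inj.
apply/and3P; split.
- apply/forallP => i; rewrite fE -val_eqE /=.
  have [lt|ge] := ltnP i.+1 n.+2; first by rewrite modn_small // gtn_eqF.
  have -> : nat_of_ord i = n.+1 by have := ltn_ord i; lia.
  by rewrite modnn.
- apply/forallP => v; rewrite valence_ugraph npre_inj //.
  rewrite nhairs_simple // /simple -map_comp (eq_map (_ : _ =1 id)) ?map_id //.
- have to0 v : connect (fadj (finfun (@ordS n.+2))) ord0 v.
    case: v => j; elim: j => [|j IHj] jn;
      first by rewrite (_ : Ordinal jn = ord0) //; apply: val_inj.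
    apply: connect_trans (IHj (ltnW jn)) (connect1 _).
    by rewrite /fadj fE -val_eqE /= modn_small ?eqxx.
  apply/forallP => u; apply/forallP => v.
  by apply: connect_trans (to0 v); rewrite fadj_sym.
Qed.

Lemma std_fil n (t : tensor_power V n.+2) : std t \in fil n.+2 n.+2.
Proof.
apply: (@lspan_linear _ _ _ (@std F V n.+2)) (pres_span t) => _ [z ->] /=.
rewrite stdE (eq_ugraph _ (_ : _ =1 finfun (@ordS n.+2))) => [|u]; last first.
  by rewrite ffunE.
apply: mem_lspan; constructor; first exact: good_polygon.
by rewrite -[X in (_ <= X)%N]card_ord max_card.
Qed.

(** Hence on the filtration [hedgehog] takes its values in the image of [hedgehog] after [std]. *)
Lemma hedgehog_std_fil n m x : x \in fil n.+2 m ->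
  hedgehog (std ((poly_stab n.+2)%:R^-1 *: hedgehog x)) = hedgehog x.
Proof.
set a := _^-1; apply: (@lspan_eq _ _ _
   ((@hedgehog F V n.+2 \o @std F V n.+2) \o (a \*: @hedgehog F V n.+2))%R
   (@hedgehog F V n.+2)).
move=> _ [f hs gf _] /=; rewrite linearZ /= std_hedgehog_good //.
case: ifP => // /negbT f0; rewrite linear0; apply/eqP; rewrite eq_sym.
apply: contraTT isT => h0.
by rewrite (hedgehog_fat h0) eqxx in f0.
Qed.

(** The polygon need not be a cycle of the complex, but its boundary is one and is killed by
    [hedgehog]; [exactness] yields a correction that [hedgehog] does not see. *)
Lemma lift_to_cycle n (t : tensor_power V n.+2) :
  exists2 x, x \in @cycles1 F V n.+2 & hedgehog x = hedgehog (std t).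
Proof.
(* With two vertices the boundary falls among the one-vertex chains, which vanish. *)
have sF := std_fil t; case: n t sF => [|n] t sF.
  exists (std t) => //; apply/andP; split; first by rewrite chains1_fil.
  by apply/eqP/(@fil1 F V 2)/boundary_fil.
have dF := boundary_fil sF.
have [||z zF [dz hz]] := exactness F0 dF.
- exact: boundary_sq sF.
- exact: hedgehog_boundary sF.
exists (std t - z); last by rewrite linearB /= hz subr0.
apply/andP; split; first by rewrite chains1_fil // rpredB.
by rewrite linearB /= dz subrr.
Qed.

Lemma homology1_1 (x : homology1 V 1) : x = 0.
Proof.
rewrite -[x]qreprK; set y := qrepr _.
suff -> : y = 0 by rewrite linear0.
apply: val_inj => /=; case: y => y /= /andP[]; rewrite chains1_fil //.
by move/fil1.
Qed.

Variable n : nat.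
Variables (M : glmod V) (phi : {linear tensor_power V n.+2 -> M}).
Hypothesis phi_act : forall g x, phi (glact _ g x) = glact M g (phi x).
Hypothesis phi_inj : forall t, phi (hedgehog (std t)) = 0 -> hedgehog (std t) =
  0.
Hypothesis phi_surj : forall y, exists t, phi (hedgehog (std t)) = y.

Let theta : {linear cycles1_mod V n.+2 -> M} :=
  (phi \o (@hedgehog F V n.+2 \o (val : submod _ -> hairy V n.+2)))%R.

Let theta_boundary x : x \in @boundaries1 F V n.+2 -> theta x = 0.
Proof.
move=> /limageP[y yC xy].
have -> : theta x = phi (hedgehog (boundary (y : hairy V n.+3))).
  by congr (phi (hedgehog _)).
by rewrite (@hedgehog_boundary _ _ F2 n.+1 n.+3) ?linear0 // -chains1_fil.
Qed.

(** Reduces the computation to an equivariant map on the tensor power that is bijective from the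
    image of [hedgehog] after [std]: [exactness] gives injectivity on homology and [lift_to_cycle]
    surjectivity. *)
Lemma homology1_iso : glmod_iso (homology1 V n.+2) M.
Proof.
pose th : {linear homology1 V n.+2 -> M} := qlift theta_boundary.
have thE x : th (qpi _ x) = phi (hedgehog (val x)) by exact: qliftE.
exists th; last first.
  move=> g q; rewrite -[q]qreprK.
  transitivity (th (qpi (@boundaries1 F V n.+2) (glact (cycles1_mod V n.+2) g
    (qrepr q)))).
    by congr (th _); apply: quoactE.
  by rewrite !thE -phi_act -glact_hedgehog.
have th_inj : injective th.
  suff th0 q : th q = 0 -> q = 0.
    move=> a b ab; apply/eqP; rewrite -subr_eq0; apply/eqP/th0.
    by rewrite linearB ab subrr.
  rewrite -[q]qreprK thE; set x := qrepr q => hx.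
  apply/eqP; rewrite qpi_eq0; apply/limageP.
  have /andP[xC /eqP dx] := valP x; rewrite chains1_fil // in xC.
  have hx0 : hedgehog (val x) = 0.
    by rewrite -(hedgehog_std_fil xC); apply: phi_inj;
      rewrite (hedgehog_std_fil xC).
  have [y yF [xy _]] := exactness F0 xC dx hx0.
  by exists y => //; rewrite chains1_fil // (fil_le _ yF).
have /boolp.choice[g gK] : forall y, exists q, th q = y.
  move=> y; have [t ty] := phi_surj y; have [x xC hx] := lift_to_cycle t.
  by exists (qpi _ (Submod xC)); rewrite thE /= hx.
by exists g => // q; apply: th_inj; rewrite gK.
Qed.

End HomologyIso.

(** * Computing in the group algebra *)

Section ListPermutations.
Local Open Scope nat_scope.
Implicit Types (k : nat) (l m : seq nat).

Definition wf k l := perm_eq l (iota 0 k).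

(** Lists of values can be computed with, unlike permutations; the default identity never occurs for
    a [wf] list. *)
Definition lperm k l : 'S_k :=
  odflt 1%g [pick s : 'S_k | [forall i, nat_of_ord (s i) == nth 0 l i]].

Lemma wf_size k l : wf k l -> size l = k.
Proof. by move/perm_size; rewrite size_iota. Qed.

Lemma wf_uniq k l : wf k l -> uniq l.
Proof. by move/perm_uniq ->; apply: iota_uniq. Qed.

Lemma wf_mem k l i : wf k l -> (i \in l) = (i < k).
Proof. by move/perm_mem ->; rewrite mem_iota. Qed.

Lemma wf_nth k l i : wf k l -> i < k -> nth 0 l i < k.
Proof. by move=> wl ik; rewrite -(wf_mem _ wl) mem_nth ?(wf_size wl). Qed.

Lemma lpermE k l i : wf k l -> nat_of_ord (lperm k l i) = nth 0 l i.
Proof.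
move=> wl; rewrite /lperm; case: pickP => [s /forallP/(_ i)/eqP //|none].
have lt (j : 'I_k) : nth 0 l j < k by apply: wf_nth.
have s_inj : injective (fun j => Ordinal (lt j)).
  move=> j j' [] /eqP; rewrite nth_uniq ?(wf_size wl) ?(wf_uniq wl) //.
  by move=> /eqP/val_inj.
have := none (perm s_inj); case/negP; apply/forallP => j.
by rewrite permE.
Qed.

Lemma lperm_eq k l (s : 'S_k) : wf k l ->
  (forall i, nat_of_ord (s i) = nth 0 l i) -> lperm k l = s.
Proof. by move=> wl sE; apply/permP => i; apply/val_inj;
  rewrite /= lpermE ?sE. Qed.

Definition perms k := permutations (iota 0 k).

Lemma mem_perms k l : (l \in perms k) = wf k l.
Proof. by rewrite mem_permutations. Qed.

Lemma list_of_perm_wf k (s : 'S_k) : wf k [seq nat_of_ord (s i) | i <- enum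
  'I_k].
Proof.
rewrite /wf (map_comp (@nat_of_ord k)) -val_enum_ord.
exact/perm_map/perm_map_perm.
Qed.

Lemma lperm_list k (s : 'S_k) : lperm k [seq nat_of_ord (s i) | i <- enum 'I_k]
  = s.
Proof.
apply: lperm_eq (list_of_perm_wf s) _ => i.
by rewrite (nth_map i) ?size_enum_ord ?nth_ord_enum.
Qed.

Lemma perm_enum_perms k : perm_eq (enum 'S_k) (map (lperm k) (perms k)).
Proof.
rewrite perm_sym; apply: uniq_perm; rewrite ?enum_uniq //.
  rewrite map_inj_in_uniq ?permutations_uniq // => l m.
  rewrite !mem_perms => wl wm e; apply: (@eq_from_nth _ 0).
    by rewrite (wf_size wl) (wf_size wm).
  move=> i; rewrite (wf_size wl) => ik.
  by rewrite -[i]/(nat_of_ord (Ordinal ik)) -!lpermE ?e.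
move=> s; rewrite mem_enum; apply/mapP.
exists [seq nat_of_ord (s i) | i <- enum 'I_k]; last by rewrite lperm_list.
by rewrite mem_perms list_of_perm_wf.
Qed.

Definition lcomp l m := [seq nth 0 m i | i <- l].

Lemma wf_lcomp k l m : wf k l -> wf k m -> wf k (lcomp l m).
Proof.
move=> wl wm; apply: (perm_trans (perm_map _ wl)).
by rewrite map_nth_iota0 ?(wf_size wm) // -(wf_size wm) take_size (wf_size wm).
Qed.

Lemma lperm_comp k l m : wf k l -> wf k m ->
  lperm k (lcomp l m) = (lperm k l * lperm k m)%g.
Proof.
move=> wl wm; apply: lperm_eq (wf_lcomp wl wm) _ => i.
by rewrite permM !lpermE // (nth_map 0) ?(wf_size wl).
Qed.

Definition linv l := [seq index i l | i <- iota 0 (size l)].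

Lemma wf_linv k l : wf k l -> wf k (linv l).
Proof.
move=> wl; rewrite /wf /linv (wf_size wl).
have := perm_map (index^~ l) wl; rewrite perm_sym => /perm_trans; apply.
rewrite (_ : map _ l = iota 0 k) //.
apply: (@eq_from_nth _ 0); rewrite ?size_map ?size_iota ?(wf_size wl) // => i
  ik.
by rewrite (nth_map 0) ?(wf_size wl) // nth_iota // index_uniq ?(wf_size wl)
  ?(wf_uniq wl).
Qed.

Lemma lperm_inv k l : wf k l -> lperm k (linv l) = (lperm k l)^-1%g.
Proof.
move=> wl; apply: lperm_eq (wf_linv wl) _ => i.
have ei : nat_of_ord i = nth 0 l ((lperm k l)^-1%g i) by rewrite -lpermE //
  permKV.
rewrite /linv (wf_size wl) (nth_map 0) ?size_iota // nth_iota // add0n.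
by rewrite ei index_uniq ?(wf_size wl) ?(wf_uniq wl).
Qed.

(** The parity of the number of inversions: a first entry [i] takes part in [i] of them, and the
    other values are then renumbered. *)
Fixpoint lodd_rec n l := match n, l with
  | n'.+1, i :: l' => odd i (+) lodd_rec n' [seq unbump i j | j <- l']
  | _, _ => false
  end.

Definition lodd l := lodd_rec (size l) l.

Lemma loddE k l : wf k l -> lodd l = odd_perm (lperm k l).
Proof.
move=> wl; rewrite /lodd (wf_size wl).
elim: k l wl => [|k IHk] l wl.
  by rewrite (_ : lperm 0 l = 1%g) ?odd_perm1 //; apply/permP => -[].
case: l wl => [/wf_size //|i l wl] /=.
have ik : i < k.+1 by rewrite -(wf_mem _ wl) mem_head.
have wl' : wf k [seq unbump i j | j <- l].
  apply: uniq_perm; rewrite ?iota_uniq //.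
    rewrite map_inj_in_uniq; first by case/andP: (wf_uniq wl).
    move=> a b al bl e; have /andP[il _] := wf_uniq wl.
    rewrite -(unbumpK (h := i) (x := a)) ?inE;
      last by apply: contraNneq il => <-.
    by rewrite e unbumpK // inE; apply: contraNneq il => <-.
  move=> a; rewrite mem_iota add0n; apply/mapP/idP => [[b bl ->]|ak].
    have /andP[il _] := wf_uniq wl.
    have bi : b != i by apply: contraNneq il => <-.
    have : b < k.+1 by rewrite -(wf_mem _ wl) inE bl orbT.
    by rewrite /unbump; lia.
  exists (bump i a); last by rewrite bumpK.
  have : bump i a \in i :: l by rewrite (wf_mem _ wl) /bump; lia.
  by rewrite inE => /orP[/eqP e|//]; move: e; rewrite /bump; lia.
rewrite IHk // (_ : lperm k.+1 (i :: l) = lift_perm ord0 (Ordinal ik)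
    (lperm k [seq unbump i j | j <- l])).
  by rewrite odd_lift_perm.
apply: lperm_eq (wl) _ => x; have [j ->|->] := unliftP ord0 x; last first.
  by rewrite lift_perm_id.
rewrite lift_perm_lift lift0 /= lpermE //.
have jl : j < size l by have := wf_size wl; rewrite /= => -[->].
rewrite (nth_map 0) // unbumpK // inE.
by have /andP[il _] := wf_uniq wl; apply: contraNneq il => <-; apply: mem_nth.
Qed.

End ListPermutations.

(** Elements of the integral group ring as formal sums; a permutation may be repeated, and [gnf]
    collects the terms. *)
Definition galg := seq (int * seq nat).

Definition gwf k (a : galg) := all (fun p => wf k p.2) a.

Definition gmul (a b : galg) : galg :=
  [seq (p.1 * q.1, lcomp p.2 q.2) | p <- a, q <- b].

Definition gscale (c : int) (a : galg) : galg := [seq (c * p.1, p.2) | p <- a].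

Definition gcoef (a : galg) l : int :=
  foldr (fun p c => if p.2 == l then p.1 + c else c) 0 a.

Definition gcoefs k (a : galg) : seq int := [seq gcoef a l | l <- perms k].

Definition lsign l : int := if lodd l then -1 else 1.

(** The sign character, by which the element acts on the exterior power ([ext_op]); [gtriv] is the
    trivial character, for the symmetric power. *)
Definition gaug (a : galg) : int := foldr (fun p c => p.1 * lsign p.2 + c) 0 a.

Definition gtriv (a : galg) : int := foldr (fun p c => p.1 + c) 0 a.

Lemma gwf_mul k a b : gwf k a -> gwf k b -> gwf k (gmul a b).
Proof.
move=> /allP wa /allP wb; apply/allP => _ /allpairsP[[p q] /= [pa qb ->]] /=.
by apply: wf_lcomp; [apply: wa pa|apply: wb qb].
Qed.

Lemma gwf_scale k c a : gwf k a -> gwf k (gscale c a).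
Proof. by rewrite /gwf all_map. Qed.

Lemma gwf_cat k a b : gwf k (a ++ b) = gwf k a && gwf k b.
Proof. exact: all_cat. Qed.

Definition gnf k (a : galg) : galg :=
  [seq p <- [seq (gcoef a l, l) | l <- perms k] | p.1 != 0].

Definition gprod k (ls : seq galg) : galg :=
  foldr (fun a b => gnf k (gmul a b)) [:: (1, iota 0 k)] ls.

Lemma gwf_gnf k a : gwf k (gnf k a).
Proof.
apply/allP => p; rewrite mem_filter => /andP[_ /mapP[l + ->]].
by rewrite mem_perms.
Qed.

Section Operators.
Variables (F : fieldType) (V : vectType F) (k : nat).
Local Notation T := (tensor_power V k).
Local Notation tens := (pgen (@multilinear F V k)).

Definition op (a : galg) (x : T) : T :=
  \sum_(p <- a) p.1%:~R *: place_perm (lperm k p.2) x.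

Lemma op_linear a : linear (op a).
Proof.
move=> c x y; rewrite /op scaler_sumr -big_split; apply: eq_bigr => p _ /=.
by rewrite linearP scalerDr !scalerA mulrC.
Qed.

HB.instance Definition _ a := GRing.isLinear.Build F T T *:%R (op a) (op_linear
  a).

Lemma opD a x y : op a (x + y) = op a x + op a y. Proof. exact: linearD. Qed.

Lemma opZ a c x : op a (c *: x) = c *: op a x. Proof. exact: linearZ. Qed.

Lemma op0 a : op a 0 = 0. Proof. exact: linear0. Qed.

Lemma glact_op g a x : glact T g (op a x) = op a (glact T g x).
Proof.
rewrite linear_sum; apply: eq_bigr => p _.
by rewrite linearZ /= glact_place.
Qed.

Lemma place_permM (s r : 'S_k) (x : T) :
  place_perm s (place_perm r x) = place_perm (s * r)%g x.
Proof.
move: x; apply: (@pres_linear_eq _ _ _ _ (place_perm s \o place_perm r)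
  (place_perm (s * r)%g)) => t.
transitivity (place_perm s (place_perm r (tens t))) => //.
rewrite place_permE [LHS]place_permE [RHS]place_permE; congr (tens _).
by apply/ffunP => i; rewrite !ffunE permM.
Qed.

Lemma op_mul a b x : gwf k a -> gwf k b -> op a (op b x) = op (gmul a b) x.
Proof.
move=> /allP wa /allP wb; rewrite /op big_allpairs_dep /=.
rewrite [LHS]big_seq [RHS]big_seq; apply: eq_bigr => p /wa wp.
rewrite linear_sum scaler_sumr /= [LHS]big_seq [RHS]big_seq.
apply: eq_bigr => q /wb wq.
by rewrite linearZ /= scalerA place_permM lperm_comp // intrM.
Qed.

Lemma op_cat a b x : op (a ++ b) x = op a x + op b x.
Proof. by rewrite /op big_cat. Qed.

Lemma op_scale c a x : op (gscale c a) x = c%:~R *: op a x.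
Proof.
rewrite /op big_map scaler_sumr; apply: eq_bigr => p _.
by rewrite scalerA -intrM.
Qed.

Lemma gcoefE a l : gcoef a l = \sum_(p <- a | p.2 == l) p.1.
Proof. by elim: a => [|p a IHa] /=; rewrite ?big_nil // big_cons -IHa. Qed.

Lemma op_norm a x : gwf k a ->
  op a x = \sum_(l <- perms k) (gcoef a l)%:~R *: place_perm (lperm k l) x.
Proof.
move=> /allP wa; transitivity (\sum_(p <- a) \sum_(l <- perms k | p.2 == l)
    p.1%:~R *: place_perm (lperm k l) x).
  rewrite /op [LHS]big_seq [RHS]big_seq; apply: eq_bigr => p /wa wp.
  rewrite (big_rem p.2) ?mem_perms //= eqxx big_seq_cond big1 ?addr0 // => l.
  rewrite (mem_rem_uniq _ (permutations_uniq _)) inE eq_sym.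
  by case/andP=> /andP[/negbTE ->].
rewrite (exchange_big_dep predT) //=; apply: eq_bigr => l _.
by rewrite gcoefE -scaler_suml raddf_sum.
Qed.

Lemma op_gnf a x : gwf k a -> op (gnf k a) x = op a x.
Proof.
move=> wa; rewrite [RHS]op_norm // /gnf /op big_filter big_map /= big_mkcond.
by apply: eq_bigr => l _ /=; case: eqP => //= ->; rewrite scale0r.
Qed.

Definition chain (ls : seq galg) (x : T) : T := foldr op x ls.

Lemma op_id x : op [:: (1, iota 0 k)] x = x.
Proof.
rewrite /op big_seq1 scale1r; have -> : lperm k (iota 0 k) = 1%g.
  by apply: lperm_eq (perm_refl _) _ => i; rewrite perm1 nth_iota.
move: x; apply: (@pres_linear_eq _ _ _ _ (place_perm 1%g) idfun) => t.
rewrite [LHS]place_permE; congr (tens _); apply/ffunP => i.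
by rewrite ffunE perm1.
Qed.

Lemma gwf_prod ls : all (gwf k) ls -> gwf k (gprod k ls).
Proof.
elim: ls => [_|a ls _ _] /=; first by rewrite /wf perm_refl.
exact: gwf_gnf.
Qed.

Lemma chainE ls x : all (gwf k) ls -> chain ls x = op (gprod k ls) x.
Proof.
elim: ls => [_|a ls IHls /andP[wa wls]]; first by rewrite op_id.
by rewrite /= op_gnf ?gwf_mul ?gwf_prod // -op_mul ?gwf_prod // IHls.
Qed.

(** Turns an identity between operators into an equality of lists of integers that [vm_compute]
    decides. *)
Lemma chain_eq (c : int) ls ls' x : all (gwf k) ls -> all (gwf k) ls' ->
  gcoefs k (gprod k ls) = gcoefs k (gscale c (gprod k ls')) ->
  chain ls x = c%:~R *: chain ls' x.
Proof.
move=> wls wls' /eq_in_map e; rewrite !chainE // -op_scale.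
rewrite !op_norm ?gwf_scale ?gwf_prod // big_seq [RHS]big_seq.
by apply: eq_bigr => l /e ->.
Qed.

Lemma chain2_eq (c c1 c2 : int) ls1 ls2 ls x :
  all (gwf k) ls1 -> all (gwf k) ls2 -> all (gwf k) ls ->
  gcoefs k (gscale c1 (gprod k ls1) ++ gscale c2 (gprod k ls2)) =
    gcoefs k (gscale c (gprod k ls)) ->
  c1%:~R *: chain ls1 x + c2%:~R *: chain ls2 x = c%:~R *: chain ls x.
Proof.
move=> w1 w2 w /eq_in_map e; rewrite !chainE // -!op_scale -op_cat.
rewrite !op_norm ?gwf_cat ?gwf_scale ?gwf_prod // big_seq [RHS]big_seq.
by apply: eq_bigr => l /e ->.
Qed.

Lemma big_perms (G : 'S_k -> T) : \sum_s G s = \sum_(l <- perms k) G (lperm k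
  l).
Proof.
by rewrite -big_enum (perm_big _ (perm_enum_perms k)) big_map.
Qed.

Lemma big_perms_cond (P : pred 'S_k) (P' : pred (seq nat)) (G : 'S_k -> T) :
  (forall l, wf k l -> P (lperm k l) = P' l) ->
  \sum_(s | P s) G s = \sum_(l <- perms k | P' l) G (lperm k l).
Proof.
move=> PP'; rewrite big_mkcond big_perms big_seq [RHS]big_mkcond [RHS]big_seq.
by apply: eq_bigr => l; rewrite mem_perms => /PP' ->.
Qed.

Lemma lsignE l : wf k l -> (lsign l)%:~R = (-1) ^+ lperm k l :> F.
Proof. by move=> wl; rewrite /lsign (loddE wl); case: odd_perm;
  rewrite ?mulrN1z. Qed.

End Operators.

Definition antisymmetrizer k : galg := [seq (lsign l, l) | l <- perms k].
Definition symmetrizer k : galg := [seq (1, l) | l <- perms k].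

Definition row_ok lam (l : seq nat) := all (fun i =>
  reshape_index lam (nth 0 l i)%N == reshape_index lam i) (iota 0 (sumn lam)).
Definition col_ok lam (l : seq nat) := all (fun i =>
  reshape_offset lam (nth 0 l i)%N == reshape_offset lam i) (iota 0 (sumn lam)).

Definition gcols lam : galg :=
  [seq (lsign l, l) | l <- perms (sumn lam) & col_ok lam l].
Definition grows lam : galg :=
  [seq (1, l) | l <- perms (sumn lam) & row_ok lam l].

Lemma all_ordP k (P : pred nat) : reflect (forall i : 'I_k, P i) (all P (iota 0
  k)).
Proof.
apply: (iffP allP) => [H i|H i]; first by apply: H; rewrite mem_iota add0n /=.
by rewrite mem_iota add0n => ik; apply: (H (Ordinal ik)).
Qed.

Lemma young_chain (F : fieldType) (V : vectType F) lam x :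
  @young_symmetrizer F V lam x = chain [:: gcols lam; grows lam] x.
Proof.
rewrite /chain /= /op !big_map !big_filter /young_symmetrizer.
rewrite exchange_big /= (@big_perms_cond _ _ _ _ (col_ok lam)) => [|l wl].
  rewrite big_seq_cond [RHS]big_seq_cond; apply: eq_bigr => l.
  rewrite mem_perms => /andP[wl _]; rewrite (lsignE F wl) -scaler_sumr.
  congr (_ *: _); rewrite linear_sum /= (@big_perms_cond _ _ _ _ (row_ok lam)).
    by apply: eq_bigr => m _; rewrite scale1r.
  move=> m wm; rewrite inE; apply/forallP/all_ordP => H i; have := H i;
  by rewrite lpermE.
rewrite inE; apply/forallP/all_ordP => H i; have := H i;
by rewrite lpermE.
Qed.

(** * The dihedral element as an explicit list *)

Section Delta.
Local Open Scope nat_scope.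

Definition nund (e : nat * nat) := if e.1 <= e.2 then e else (e.2, e.1).

Definition nsgn (e : nat * nat) : int :=
  if e.1 < e.2 then 1%R else if e.2 < e.1 then (-1)%R else 0%R.

Definition nsg (es : seq (nat * nat)) : int :=
  foldr (fun e c => nsgn e * c)%R 1%R es.

Definition nedges k (l : seq nat) :=
  [seq (nth 0 l i, nth 0 l (i.+1 %% k)) | i <- iota 0 k].

Definition ncoef k l : int :=
  if perm_eq (map nund (nedges k l)) (map nund (nedges k (iota 0 k)))
  then (lsign l * (nsg (nedges k l) * nsg (nedges k (iota 0 k))))%R else 0%R.

(** The inverse appears because, after renumbering by [s], the label read at [i] is the one that
    stood at the preimage of [i] under [s] ([read_std]). *)
Definition gdelta k : galg := [seq (ncoef k l, linv l) | l <- perms k & ncoef k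
  l != 0%R].

Definition nvals k (e : 'I_k * 'I_k) := (nat_of_ord e.1, nat_of_ord e.2).

Lemma nvals_inj k : injective (@nvals k).
Proof. by move=> [i j] [i' j'] [] /val_inj -> /val_inj ->. Qed.

Lemma nvals_edges k (l : seq nat) : wf k l ->
  map (@nvals k) (map (rel2 (lperm k l)) (fedges (@ordS k))) = nedges k l.
Proof.
move=> wl; rewrite /nedges -(val_enum_ord k) /fedges -!map_comp.
by apply: eq_map => i; rewrite /= /nvals /= !lpermE.
Qed.

Lemma wf_iota k : wf k (iota 0 k).
Proof. exact: perm_refl. Qed.

Lemma nvals_edges1 k : map (@nvals k) (fedges (@ordS k)) = nedges k (iota 0 k).
Proof.
have lp1 : lperm k (iota 0 k) = 1%g.
  by apply: lperm_eq (wf_iota k) _ => i; rewrite perm1 nth_iota.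
rewrite -(nvals_edges (wf_iota k)) lp1 -[in LHS](map_id (fedges _)).
by congr (map _ _); apply: eq_map => -[i j]; rewrite /rel2 !perm1.
Qed.

Lemma nund_und k (es : seq ('I_k * 'I_k)) :
  map nund (map (@nvals k) es) = map (@nvals k) (map (@und k) es).
Proof.
rewrite -!map_comp; apply: eq_map => -[i j].
by rewrite /= /nund /und /=; case: ifP.
Qed.

Lemma nsgE (F : fieldType) k (es : seq ('I_k * 'I_k)) :
  ((nsg (map (@nvals k) es))%:~R)%R = sg F es.
Proof.
rewrite /sg; elim: es => [|e es IHes];
  rewrite ?big_nil // big_cons /= intrM IHes.
congr (_ * _)%R; rewrite /nsgn /sgn /=; case: ifP => //; case: ifP => //.
Qed.

Lemma ncoefE (F : fieldType) k l : wf k l ->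
  ((ncoef k l)%:~R)%R =
  ((-1) ^+ lperm k l * polysign F (map (rel2 (lperm k l)) (fedges (@ordS
    k))))%R.
Proof.
move=> wl; rewrite /ncoef /polysign /polygonal -(nvals_edges wl) -nvals_edges1.
have pE (es es' : seq ('I_k * 'I_k)) :
    perm_eq (map (@nvals k) es) (map (@nvals k) es') = perm_eq es es'.
  by apply/idP/idP; [exact: (perm_map_inj (@nvals_inj k))|exact: perm_map].
rewrite !nund_und pE; case: ifP => _; last by rewrite mulr0.
by rewrite !intrM !nsgE (lsignE F wl).
Qed.

End Delta.

Lemma gwf_delta k : gwf k (gdelta k).
Proof.
apply/allP => _ /mapP[l + ->] /=; rewrite mem_filter => /andP[_ lP].
by apply: wf_linv; rewrite -mem_perms.
Qed.

Lemma read_std (F : fieldType) (V : vectType F) k (s : 'S_k) (t : {ffun 'I_k ->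
  V}) :
  read (lmap s (std_hairs t)) = place_perm (s^-1)%g (pgen (@multilinear F V k)
    t).
Proof.
rewrite place_permE /read.
have -> : simple (lmap s (std_hairs t)).
  rewrite /simple /lmap /std_hairs -map_comp -map_comp.
  exact: perm_map_perm.
congr (pgen _ _); apply/ffunP => i;
  rewrite !ffunE /lmap big_map big_map big_enum_cond /=.
by rewrite (big_pred1 ((s^-1)%g i)) // => j /=; rewrite (canF_eq (permK s)).
Qed.

Lemma hedgehog_std_op (F : fieldType) (V : vectType F) k (x : tensor_power V k)
  :
  hedgehog (std x) = op (gdelta k) x.
Proof.
move: x; apply: (@pres_linear_eq _ _ _ _ (@hedgehog F V k \o @std F V k) (op
  (gdelta k))).
move=> t; transitivity (hedgehog (std (pgen (@multilinear F V k) t))) => //.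
rewrite stdE hedgehogE /hedgehog_gen big_perms [RHS]big_map big_filter.
rewrite [RHS]big_mkcond [LHS]big_seq [RHS]big_seq; apply: eq_bigr => l.
rewrite mem_perms => wl /=; rewrite -(ncoefE F wl) read_std lperm_inv //.
by case: eqP => //= ->; rewrite scale0r.
Qed.

(** * Symmetric, exterior and Schur powers *)

Section Powers.
Variables (F : fieldType) (V : vectType F) (k : nat).
Local Notation T := (tensor_power V k).
Local Notation tens := (pgen (@multilinear F V k)).
Local Notation toS := (qpi (lspan (@sym_rel F V k))).
Local Notation toE := (qpi (lspan (@ext_rel F V k))).

Lemma sym_op a (x : T) : toS (op a x) = (gtriv a)%:~R *: toS x.
Proof.
have placeE s : toS (place_perm s x) = toS x.
  by apply/qpi_eqP/mem_lspan; constructor.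
elim: a => [|p a IHa]; first by rewrite /op big_nil linear0 scale0r.
rewrite /op big_cons linearD /= intrD scalerDl -IHa; congr (_ + _).
by rewrite linearZ /= placeE.
Qed.

Lemma op_symmetrizer (x : T) :
  op (symmetrizer k) x = \sum_(s : 'S_k) place_perm s x.
Proof.
by rewrite big_perms /op big_map; apply: eq_bigr => l _; rewrite scale1r.
Qed.

Lemma symmetrizer_kill (x : T) : toS x = 0 -> op (symmetrizer k) x = 0.
Proof.
move/eqP; rewrite qpi_eq0; move: x.
apply: (@lspan_eq _ _ _ (op (symmetrizer k)) \0) => _ [s x] /=.
rewrite linearB /= !op_symmetrizer; apply/eqP; rewrite subr_eq0; apply/eqP.
rewrite [RHS](reindex_inj (@mulIg _ s)) /=; apply: eq_bigr => r _.
exact: place_permM.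
Qed.

Lemma op_antisymmetrizer (x : T) :
  op (antisymmetrizer k) x = \sum_(s : 'S_k) (-1) ^+ s *: place_perm s x.
Proof.
rewrite big_perms /op big_map big_seq [RHS]big_seq; apply: eq_bigr => l.
by rewrite mem_perms => wl; rewrite (lsignE F wl).
Qed.

Lemma antisymmetrizer_place (r : 'S_k) (x : T) :
  op (antisymmetrizer k) (place_perm r x) =
  (-1) ^+ r *: op (antisymmetrizer k) x.
Proof.
rewrite !op_antisymmetrizer [in RHS](reindex_inj (@mulIg _ r)) scaler_sumr /=.
apply: eq_bigr => s _; rewrite place_permM scalerA; congr (_ *: _).
by rewrite odd_permM signr_addb mulrCA -signr_addb addbb mulr1.
Qed.

(** A tensor with a repeated entry is fixed by a transposition, so its antisymmetrization is its own
    opposite. *)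
Lemma antisymmetrizer_kill (x : T) : (2%:R : F) != 0 ->
  toE x = 0 -> op (antisymmetrizer k) x = 0.
Proof.
move=> F2 /eqP; rewrite qpi_eq0; move: x.
apply: (@lspan_eq _ _ _ (op (antisymmetrizer k)) \0) => _ [t i j ij tij] /=.
apply: (self_opp0 F2).
have {1}-> : tens t = place_perm (tperm i j) (tens t).
  rewrite place_permE; congr (tens _); apply/ffunP => x; rewrite ffunE.
  by case: tpermP => [->|->|].
by rewrite antisymmetrizer_place odd_tperm ij expr1 scaleN1r.
Qed.

Lemma ffupd_comm (t : {ffun 'I_k -> V}) i j u v : i != j ->
  ffupd (ffupd t i u) j v = ffupd (ffupd t j v) i u.
Proof.
move=> ij; apply/ffunP => x; rewrite !ffunE.
by case: eqP => [->|//]; rewrite eq_sym (negbTE ij).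
Qed.

(** Polarization of the relation [E u u = 0]. *)
Lemma ext_tperm (t : {ffun 'I_k -> V}) i j : i != j ->
  toE (place_perm (tperm i j) (tens t)) = - toE (tens t).
Proof.
move=> ij; pose E u v := toE (tens (ffupd (ffupd t i u) j v)).
have EDr u v v' : E u (v + v') = E u v + E u v'.
  by rewrite /E -[v]scale1r pgen_multilinear linearD /= !scale1r.
have EDl u u' v : E (u + u') v = E u v + E u' v.
  rewrite /E !(ffupd_comm _ _ _ ij) -[u]scale1r pgen_multilinear linearD /=.
  by rewrite !scale1r.
have E0 u : E u u = 0.
  apply/eqP; rewrite qpi_eq0; apply: mem_lspan; apply: (ExtRel ij).
  by rewrite !ffunE eqxx (negbTE ij) !eqxx.
have EN u v : E u v = - E v u.
  have := E0 (u + v); rewrite EDl !EDr !E0 add0r addr0 => /eqP.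
  by rewrite addr_eq0 => /eqP.
rewrite place_permE.
have -> : ffperm (tperm i j) t = ffupd (ffupd t i (t j)) j (t i).
  apply/ffunP => x; rewrite !ffunE; case: tpermP => [->|->|/eqP xi /eqP xj].
  - by rewrite (negbTE ij) eqxx.
  - by rewrite eqxx.
  by rewrite (negbTE xi) (negbTE xj).
have tE : t = ffupd (ffupd t i (t i)) j (t j).
  apply/ffunP => x; rewrite !ffunE.
  by case: eqP => [->//|_]; case: eqP => [->|].
by rewrite [in RHS]tE; apply: EN.
Qed.

Lemma ext_place (s : 'S_k) (x : T) : toE (place_perm s x) = (-1) ^+ s *: toE x.
Proof.
have place1 y : place_perm 1%g y = y :> T.
  move: y; apply: (@pres_linear_eq _ _ _ _ (place_perm 1%g) idfun) => t.
  rewrite [LHS]place_permE; congr (tens _); apply/ffunP => i.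
  by rewrite ffunE perm1.
have [ts -> dts] := prod_tpermP s.
elim: ts dts x => [_ x|[i j] ts IHts /andP[/= ij dts] x].
  by rewrite big_nil place1 odd_perm1 scale1r.
rewrite big_cons /= -place_permM odd_mul_tperm ij signr_addb -scalerA.
rewrite -IHts //; set y := place_perm _ x.
rewrite expr1 scaleN1r.
move: y; apply: (@pres_linear_eq _ _ _ _ (toE \o place_perm (tperm i j)) (\-
  toE)).
by move=> t; apply: ext_tperm.
Qed.

Lemma ext_op a (x : T) : gwf k a -> toE (op a x) = (gaug a)%:~R *: toE x.
Proof.
elim: a => [|p a IHa]; first by rewrite /op big_nil linear0 scale0r.
move=> /andP[wp wa]; rewrite /op big_cons linearD /= intrD scalerDl -IHa //.
congr (_ + _); rewrite linearZ /= ext_place scalerA intrM.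
by rewrite (lsignE F wp).
Qed.

Lemma ext_chain c d m m' ls ls' (x y : T) :
  all (gwf k) ls -> all (gwf k) ls' ->
  gaug (gprod k ls) = m -> gaug (gprod k ls') = m' ->
  toE (c *: chain ls x + d *: chain ls' y) =
  (c * m%:~R) *: toE x + (d * m'%:~R) *: toE y.
Proof.
move=> wls wls' <- <-; rewrite !chainE //.
by rewrite linearD !linearZ /= !ext_op ?gwf_prod // !scalerA.
Qed.

End Powers.

Section SchurMap.
Variables (F : fieldType) (V : vectType F) (lam : seq nat).
Local Notation T := (tensor_power V (sumn lam)).

Lemma ysub_subproof (x : T) :
  @young_symmetrizer F V lam x \in limage (@young_symmetrizer F V lam)
    (@full_submod F T).
Proof. by apply/limageP; exists x. Qed.

Definition ysub (x : T) : schur V lam := Submod (ysub_subproof x).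

Lemma ysub_linear : linear ysub.
Proof. by move=> a x y; apply: val_inj; rewrite /= linearP. Qed.

HB.instance Definition _ :=
  GRing.isLinear.Build F T (schur V lam) *:%R ysub ysub_linear.

Lemma ysub_act g x : ysub (glact T g x) = glact (schur V lam) g (ysub x).
Proof. by apply: val_inj; rewrite /= glact_young. Qed.

Lemma ysub_surj (y : schur V lam) : exists w, y = ysub w.
Proof.
have /limageP[w _ yw] := valP y.
by exists w; apply: val_inj.
Qed.

Lemma ysub_eq x y :
  chain [:: gcols lam; grows lam] x = chain [:: gcols lam; grows lam] y ->
  ysub x = ysub y.
Proof. by move=> xy; apply: val_inj; rewrite /= !young_chain. Qed.

Lemma ysub_eq0 x : ysub x = 0 -> chain [:: gcols lam; grows lam] x = 0.
Proof. by move/(congr1 val); rewrite /= young_chain. Qed.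

End SchurMap.

Section Pairing.
Variables (F : fieldType) (L M N : lmodType F) (f : {linear L -> M}) (g :
  {linear L -> N}).

Definition pairing (x : L) : M * N := (f x, g x).

Lemma pairing_linear : linear pairing.
Proof. by move=> a x y; rewrite /pairing !linearP. Qed.

HB.instance Definition _ :=
  GRing.isLinear.Build F L (M * N)%type *:%R pairing pairing_linear.

End Pairing.

(** * Decomposition of the homology for k = 2, ..., 5 *)

Section Main.
Variables (F : fieldType) (V : vectType F).
Hypothesis F0 : [pchar F] =i pred0.

Let int_neq0 (c : int) : c != 0 -> (c%:~R : F) != 0.
Proof.
case: c => n; first by rewrite -pmulrn => n0; apply: char0_neq0 => //;
  rewrite lt0n.
by move=> _; rewrite NegzE mulrNz oppr_eq0 -pmulrn char0_neq0.
Qed.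

Let scale_eq0 (L : lmodType F) (c : int) (x : L) :
  c != 0 -> c%:~R *: x = 0 -> x = 0.
Proof.
by move=> /int_neq0/negbTE c0 /eqP; rewrite scaler_eq0 c0 => /eqP.
Qed.

Let scaleVK (L : lmodType F) (c : int) (x : L) :
  c != 0 -> c%:~R *: (c%:~R^-1 *: x) = x.
Proof. by move=> /int_neq0 c0; rewrite scalerA mulfV ?scale1r. Qed.

Let F2 : (2%:R : F) != 0 := char0_neq0 F0 (isT : 0 < 2)%N.

Let qpi_scaleV (L : lmodType F) (S : submodClosed L) (c : int) (y : quotmod S) :
  c != 0 -> c%:~R *: qpi S (c%:~R^-1 *: qrepr y) = y.
Proof.
by move=> c0; rewrite [qpi S _]linearZ -[y in RHS]qreprK; apply: scaleVK.
Qed.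

Lemma homology1_2 : glmod_iso (homology1 V 2) (ext_power V 2).
Proof.
pose A := antisymmetrizer 2; pose D := gdelta 2.
apply: (@homology1_iso F V F0 0 (ext_power V 2) (qpi (lspan (@ext_rel F V 2)))).
- by move=> g x; apply/esym/quoactE.
- move=> t; rewrite hedgehog_std_op => /(antisymmetrizer_kill F2) e.
  (* Here [D] is the antisymmetrizer itself, whose square is twice itself. *)
  have e2 : chain [:: A; D] t = 2%:~R *: chain [:: D] t.
    by apply: chain_eq; vm_compute.
  by apply: (@scale_eq0 _ 2) => //; rewrite -[LHS]e2.
- move=> y; exists (2%:~R^-1 *: qrepr y).
  rewrite hedgehog_std_op [LHS]ext_op ?gwf_delta //.
  have -> : gaug (gdelta 2) = 2 by vm_compute.
  exact: qpi_scaleV.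
Qed.

Lemma homology1_3 : glmod_iso (homology1 V 3) (sym_power V 3).
Proof.
pose S := symmetrizer 3; pose D := gdelta 3.
apply: (@homology1_iso F V F0 1 (sym_power V 3) (qpi (lspan (@sym_rel F V 3)))).
- by move=> g x; apply/esym/quoactE.
- move=> t; rewrite hedgehog_std_op => /symmetrizer_kill e.
  (* A reflection of the triangle is odd and reverses three edges, so all signs are + and [D] is the
     symmetrizer of S_3. *)
  have e6 : chain [:: S; D] t = 6%:~R *: chain [:: D] t.
    by apply: chain_eq; vm_compute.
  by apply: (@scale_eq0 _ 6) => //; rewrite -[LHS]e6.
- move=> y; exists (6%:~R^-1 *: qrepr y).
  rewrite hedgehog_std_op [LHS]sym_op.
  have -> : gtriv (gdelta 3) = 6 by vm_compute.
  exact: qpi_scaleV.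
Qed.

Lemma homology1_4 : glmod_iso (homology1 V 4)
  (gl_sum (ext_power V 4) (schur V [:: 2; 2]%N)).
Proof.
pose A := antisymmetrizer 4; pose D := gdelta 4.
pose C := gcols [:: 2; 2]%N; pose R := grows [:: 2; 2]%N.
pose ys : {linear tensor_power V (sumn [:: 2; 2]%N) -> schur V [:: 2; 2]%N} :=
  @ysub F V [:: 2; 2]%N.
pose phi : {linear tensor_power V 4 -> gl_sum (ext_power V 4) (schur V [:: 2;
  2]%N)} :=
  pairing (qpi (lspan (@ext_rel F V 4))) ys.
apply: (@homology1_iso F V F0 2 _ phi).
- move=> g x; congr (_, _); first exact/esym/quoactE.
  exact: (@ysub_act F V [:: 2; 2]%N).
- move=> t; rewrite hedgehog_std_op -/D => h.
  have e1 : chain [:: A; D] t = 0 := antisymmetrizer_kill F2 (congr1 fst h).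
  have e2 : chain [:: C; R; D] t = 0 :=
    @ysub_eq0 F V [:: 2; 2]%N _ (congr1 snd h).
  have e3 : chain [:: D; C; R; D] t = 0 by rewrite -[RHS](@op0 F V 4 D) -e2.
  (* The identity is [4 A D + D C R D = 96 D]: as [A D = 8 A], the first term is 96 times the sign
     component [A / 3] of [D], and the second is 96 times its component of type (2,2). *)
  have := @chain2_eq F V 4 96 4 1 [:: A; D] [:: D; C; R; D] [:: D] t.
  rewrite e1 e3 !scaler0 addr0 => e.
  by apply: (@scale_eq0 _ 96) => //; apply/esym/e; vm_compute.
- case=> q y; have [w yw] := ysub_surj y.
  have [z qz] : exists z, qpi (lspan (@ext_rel F V 4)) z = q.
    by exists (qrepr q); apply: qreprK.
  (* The constant 192 = 8 * 24 is the sign character of [D A], and 96 comes from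
     [C R D C R = 96 C R]. The cross terms vanish: [D C R] has sign character 0, and
     [C R D A = 0]. *)
  exists (192%:~R^-1 *: op A z + 96%:~R^-1 *: op C (op R w)).
  have DE : op D (192%:~R^-1 *: op A z + 96%:~R^-1 *: op C (op R w)) =
      192%:~R^-1 *: chain [:: D; A] z + 96%:~R^-1 *: chain [:: D; C; R] w.
    by rewrite opD !opZ.
  rewrite hedgehog_std_op -/D DE; congr (_, _).
    apply: etrans (@ext_chain F V 4 192%:~R^-1 96%:~R^-1 192 0 [:: D; A] [:: D;
      C; R] z w
      ltac:(by vm_compute) ltac:(by vm_compute)
      ltac:(by vm_compute) ltac:(by vm_compute)) _.
    by rewrite mulr0 scale0r addr0 mulVf ?int_neq0 // scale1r; apply: qz.
  rewrite yw; apply: ysub_eq; rewrite /= -/C -/R !opD !opZ.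
  have -> : op C (op R (op D (op A z))) = 0%:~R *: z.
    by apply: (@chain_eq _ _ _ 0 [:: C; R; D; A] [::]); vm_compute.
  have -> : op C (op R (op D (op C (op R w)))) = 96%:~R *: op C (op R w).
    by apply: (@chain_eq _ _ _ 96 [:: C; R; D; C; R] [:: C; R]); vm_compute.
  by rewrite scale0r scaler0 add0r scalerA mulVf ?scale1r ?int_neq0.
Qed.

Lemma homology1_5 : glmod_iso (homology1 V 5)
  (gl_sum (schur V [:: 3; 1; 1]%N) (schur V [:: 3; 1; 1]%N)).
Proof.
pose C := gcols [:: 3; 1; 1]%N; pose R := grows [:: 3; 1; 1]%N.
pose D := gdelta 5.
pose p1 : galg := [:: (1, [:: 0; 1; 2; 3; 4]%N)].
pose p2 : galg := [:: (1, [:: 0; 1; 3; 2; 4]%N)].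
(* With [Y] the Young symmetrizer, [Y p_i D p_j Y = M i j * Y] for the matrix *)
(* [M = 40 * [[2, 1], [-1, 2]]]; [a1] and [a2] are given by the rows of       *)
(* [200 * M^-1].                                                              *)
pose a1 := gscale 2 p1 ++ gscale (-1) p2.
pose a2 := gscale 1 p1 ++ gscale 2 p2.
pose ys : {linear tensor_power V (sumn [:: 3; 1; 1]%N) -> schur V [:: 3; 1;
  1]%N} :=
  @ysub F V [:: 3; 1; 1]%N.
pose phi : {linear tensor_power V 5 ->
    gl_sum (schur V [:: 3; 1; 1]%N) (schur V [:: 3; 1; 1]%N)} :=
  pairing (ys \o op a1)%R (ys \o op a2)%R.
apply: (@homology1_iso F V F0 3 _ phi).
- move=> g x; congr (_, _); rewrite /= -glact_op;
  exact: (@ysub_act F V [:: 3; 1; 1]%N).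
- move=> t; rewrite hedgehog_std_op -/D => h.
  have e1 : chain [:: C; R; a1; D] t = 0 :=
    @ysub_eq0 F V [:: 3; 1; 1]%N _ (congr1 fst h).
  have e2 : chain [:: C; R; a2; D] t = 0 :=
    @ysub_eq0 F V [:: 3; 1; 1]%N _ (congr1 snd h).
  have f1 : chain [:: D; p1; C; R; a1; D] t = 0.
    by rewrite -[RHS](@op0 F V 5 D) -[in RHS](@op0 F V 5 p1) -e1.
  have f2 : chain [:: D; p2; C; R; a2; D] t = 0.
    by rewrite -[RHS](@op0 F V 5 D) -[in RHS](@op0 F V 5 p2) -e2.
  (* With [Y] as above, [D p1 Y a1 D + D p2 Y a2 D = 200 D], so the two components of [phi] together
     determine [D t]. *)
  have := @chain2_eq F V 5 200 1 1 [:: D; p1; C; R; a1; D]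
    [:: D; p2; C; R; a2; D] [:: D] t.
  rewrite f1 f2 !scaler0 addr0 => e.
  by apply: (@scale_eq0 _ 200) => //; apply/esym/e; vm_compute.
- case=> y1 y2; have [w1 ->] := ysub_surj y1; have [w2 ->] := ysub_surj y2.
  (* These four identities say that the matrix of [a1], [a2] times [M] is 200 times the identity. *)
  have e11 w : chain [:: C; R; a1; D; p1; C; R] w = 200%:~R *: chain [:: C; R] w
    :> tensor_power V 5 by apply: chain_eq; vm_compute.
  have e12 w : chain [:: C; R; a1; D; p2; C; R] w = 0%:~R *: chain [:: C; R] w
    :> tensor_power V 5 by apply: chain_eq; vm_compute.
  have e21 w : chain [:: C; R; a2; D; p1; C; R] w = 0%:~R *: chain [:: C; R] w
    :> tensor_power V 5 by apply: chain_eq; vm_compute.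
  have e22 w : chain [:: C; R; a2; D; p2; C; R] w = 200%:~R *: chain [:: C; R] w
    :> tensor_power V 5 by apply: chain_eq; vm_compute.
  exists (200%:~R^-1 *: (chain [:: p1; C; R] w1 + chain [:: p2; C; R] w2)).
  rewrite hedgehog_std_op -/D; congr (_, _); apply: ysub_eq;
    rewrite /= -/C -/R !opZ !opD.
    rewrite [X in X + _]e11 [X in _ + X]e12 scale0r addr0.
    by rewrite scalerA mulVf ?scale1r ?int_neq0.
  rewrite [X in X + _]e21 [X in _ + X]e22 scale0r add0r.
  by rewrite scalerA mulVf ?scale1r ?int_neq0.
Qed.

End Main.

Theorem mainTheorem6 (F : fieldType) (charF0 : [pchar F] =i pred0)
    (V : vectType F) (omega : {skew_symmetric V})
    (omega_symplectic : is_psymplectic omega) :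
  (forall x : homology1 V 1, x = 0) /\
  glmod_iso (homology1 V 2) (ext_power V 2) /\
  glmod_iso (homology1 V 3) (sym_power V 3) /\
  glmod_iso (homology1 V 4)
    (gl_sum (ext_power V 4) (schur V [:: 2; 2]%N)) /\
  glmod_iso (homology1 V 5)
    (gl_sum (schur V [:: 3; 1; 1]%N) (schur V [:: 3; 1; 1]%N)).
Proof.
split; first exact: homology1_1.
split; first exact: homology1_2.
split; first exact: homology1_3.
by split; [apply: homology1_4|apply: homology1_5].
Qed.
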